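(* Let $\mathbb T$ be a time scale and let $\mathbf A:\mathbb T\to M_{n,n}(\mathbb R)$ be an rd-continuous matrix-valued function which is uniformly regressive with respect to $\mathbb T$, uniformly bounded together with the inverse matrix $\mathbf A^{-1}$, and hyperbolic (i.e. the system $x^\Delta=\mathbf A(t)x$ is hyperbolic on $\mathbb T$). Then for any function $\mathbf f\in\mathbb L^\infty(\mathbb T\to\mathbb R^n)$ the system $$x^\Delta=\mathbf A(t)x+\mathbf f(t)$$ has a solution that is bounded on $\mathbb T$.
   Context: A time scale $\mathbb T$ is an unbounded closed subset of $[0,+\infty)$ with $0\in\mathbb T$. For $t\in\mathbb T$ put $\sigma(t)=\inf\{\tau\in\mathbb T:\tau>t\}$ and $\mu(t)=\sigma(t)-t$; $t$ is right-dense if $\mu(t)=0$ and right-scattered otherwise. A function on $\mathbb T$ is rd-continuous if it is continuous at all right-dense points and left continuous at all left-dense points. A function $f$ on $\mathbb T$ is $\Delta$-differentiable at $t\in\mathbb T$ with derivative $f^\Delta(t)=\gamma$ if for every $\varepsilon>0$ there is a neighborhood $W\subset\mathbb T$ of $t$ with $|f(\sigma(t))-f(\tau)-\gamma(\sigma(t)-\tau)|\le\varepsilon|\sigma(t)-\tau|$ for all $\tau\in W$ (componentwise for vectors). $\mathbb L^\infty(\mathbb T\to\mathbb R^n)$ is the space of bounded functions on $\mathbb T$ measurable with respect to the sigma-algebra induced from $\mathbb R$, with the supremum norm. For $\mathbf f\in\mathbb L^\infty$, a solution of $x^\Delta=\mathbf A(t)x+\mathbf f(t)$ is understood in the integral sense,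 $x(t)=x(0)+\int_0^t(\mathbf A(\tau)x(\tau)+\mathbf f(\tau))\,\Delta\tau$, with the Lebesgue $\Delta$-integral. $E_n$ is the $n\times n$ unit matrix. $\mathbf A$ is uniformly regressive if $E_n+\mu(t)\mathbf A(t)$ is invertible for every $t\in\mathbb T$ and $(E_n+\mu(t)\mathbf A(t))^{-1}$ is bounded on $\mathbb T$. For $t\ge0$ let $[t]_{\mathbb T}=\max\{\tau\in\mathbb T:\tau\le t\}$, and $s(t)=\int_0^t\frac{\log(1+\mu([\tau]_{\mathbb T}))}{\mu([\tau]_{\mathbb T})}\,d\tau$, where the integrand is $1$ when $\mu([\tau]_{\mathbb T})=0$. Fix a matrix logarithm $\log$ on nondegenerate $n\times n$ matrices with: $\exp(\log B)=B$; $\log$ is measurable and bounded on each set $\{B:\max(|B|,|B^{-1}|)\le R\}$, $R>0$; $\log B$ is real whenever $B$ is the exponential of a real matrix. The ordinary differential system corresponding to $x^\Delta=\mathbf A(t)x$ is $dx/ds=A(s)x$ on $[0,+\infty)$, where $A(s(t))=\mathbf A(t)$ for $t\in\mathbb T$ and $$A(s(t))=\frac{\log[E_n+\mu([t]_{\mathbb T})\mathbf A([t]_{\mathbb T})]}{\log(1+\mu([t]_{\mathbb T}))}\qquad\text{for } t\notin\mathbb T.$$ A linear system $dx/ds=A(s)x$ on $[0,+\infty)$ with Cauchy matrix $\Phi_A(s,\tau)$ is hyperbolic if for every $s\ge0$ there are linear subspaces $U^+(s),U^-(s)$ (stable and unstable spaces) of the phase space ($\mathbb R^n$, or $\mathbb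 C^n$ if $A$ is complex-valued) and constants $C,\lambda_0>0$ such that: $U^+(s)\oplus U^-(s)$ is the whole phase space; $\Phi_A(s,\tau)U^\pm(\tau)=U^\pm(s)$; $|\Phi_A(s,\tau)x_0|\le C\exp(-\lambda_0(s-\tau))|x_0|$ for $s>\tau$, $x_0\in U^+(\tau)$; $|\Phi_A(s,\tau)x_0|\le C\exp(\lambda_0(s-\tau))|x_0|$ for $s<\tau$, $x_0\in U^-(\tau)$. A time scale system $x^\Delta=\mathbf A(t)x$ with $\mathbf A$ uniformly regressive and $\sup_{t\in\mathbb T}(|\mathbf A(t)|+|\mathbf A^{-1}(t)|)<+\infty$ is called hyperbolic if the corresponding ordinary differential system is hyperbolic. *)

(* Defs.v *)
From HB Require Import structures.
From mathcomp Require Import all_boot all_order all_algebra.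
From mathcomp Require Import complex.
From mathcomp Require Import all_classical all_reals all_analysis.

Set Implicit Arguments.
Unset Strict Implicit.
Unset Printing Implicit Defensive.
Import Order.TTheory GRing.Theory Num.Theory.
Import numFieldNormedType.Exports.
Local Open Scope classical_set_scope.
Local Open Scope ring_scope.
Local Open Scope complex_scope.

(* Functions on a time scale T (or on the half-line) are represented by
   functions on the whole of R; every notion below only depends on their values
   on T (resp. on the half-line).  Vectors and matrices carry the library norm,
   i.e. the maximum of the absolute values of the entries. *)

Record timeScale (R : realType) := TimeScale {
  ts_set :> set R ;
  ts_closed : closed ts_set ;
  ts_ge0 : forall t, ts_set t -> 0 <= t ;
  ts_0 : ts_set 0 ;
  ts_unbounded : forall M, exists2 t, ts_set t & M < t }.

Section time_scale.
Context {R : realType}.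
Implicit Types (T : set R) (t : R).

Definition sigma T t : R := inf [set u | T u /\ t < u].

Definition graininess T t : R := sigma T t - t.

Definition left_dense T t := closure (T `&` [set u | u < t]) t.

(* A supremum that is attained when T is closed, 0 \in T and 0 <= t. *)
Definition ts_floor T t : R := sup [set u | T u /\ u <= t].

Definition rd_continuous {n m} T (f : R -> 'M[R]_(n, m)) :=
  (forall t, T t -> graininess T t = 0 ->
     f @ within T (nbhs t) --> f t) /\
  (forall t, T t -> left_dense T t ->
     f @ within (T `&` [set u | u < t]) (nbhs t) --> f t).

Definition bounded_on {n m} T (f : R -> 'M[R]_(n, m)) :=
  exists M : R, forall t, T t -> `|f t| <= M.

Definition uniformly_regressive {n} T (A : R -> 'M[R]_n) :=
  (forall t, T t -> 1%:M + graininess T t *: A t \in unitmx) /\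
  bounded_on T (fun t => invmx (1%:M + graininess T t *: A t)).

Definition bounded_with_inverse {n} T (A : R -> 'M[R]_n) :=
  (forall t, T t -> A t \in unitmx) /\
  exists M : R, forall t, T t -> `|A t| + `|invmx (A t)| <= M.

Definition Linfty {n} T (f : R -> 'cV[R]_n) :=
  (forall i, measurable_fun T (fun t => f t i 0)) /\ bounded_on T f.

End time_scale.

Section delta_integral.
Context {R : realType} (T : timeScale R).

Lemma sigma_has_inf t : has_inf [set u | ts_set T u /\ t < u].
Proof.
split; first by have [u Tu tu] := ts_unbounded T t; exists u.
by exists t => u [_ /ltW].
Qed.

Lemma sigma_nondecreasing : nondecreasing (sigma T).
Proof.
move=> a b ab; apply: lb_le_inf; first exact: (sigma_has_inf b).1.
move=> u [Tu bu]; apply: ge_inf; first exact: (sigma_has_inf a).2.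
by split=> //; exact: le_lt_trans bu.
Qed.

Lemma sigma_right_continuous : right_continuous (sigma T).
Proof.
move=> a; apply/cvgrPdist_lt => e e0.
have [u [Tu au] ule] := inf_adherent e0 (sigma_has_inf a).
near=> x.
have ax : a <= x by near: x; exact: nbhs_right_ge.
have xu : x < u by near: x; exact: nbhs_right_lt.
rewrite distrC ger0_norm ?subr_ge0 ?sigma_nondecreasing//.
rewrite ltrBlDl; apply: le_lt_trans ule.
by apply: ge_inf; [exact: (sigma_has_inf x).2 | split].
Unshelve. all: by end_near. Qed.

HB.instance Definition _ := isCumulative.Build R _ R (sigma T)
  sigma_nondecreasing sigma_right_continuous.

(* The Lebesgue Delta-measure, i.e. the Caratheodory extension of
   [a, b[ `&` T |-> b - a for a <= b in T.  Since the left limit of sigma T at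
   any t \in T is t, it is the Lebesgue-Stieltjes measure of sigma T; it has an
   atom of mass [graininess T t] at every right-scattered point t and does not
   charge the complement of T. *)
Definition delta_measure : {measure set (measurableTypeR R) -> \bar R} :=
  lebesgue_stieltjes_measure (sigma T).

Definition delta_integrable {n} (t : R) (g : R -> 'cV[R]_n) :=
  forall i, delta_measure.-integrable (T `&` `[0, t[)
    (fun u => (g u i 0)%:E).

Definition delta_integral {n} (t : R) (g : R -> 'cV[R]_n) : 'cV[R]_n :=
  \col_i \int[delta_measure]_(u in T `&` `[0, t[) g u i 0.

Definition delta_solution {n} (A : R -> 'M[R]_n) (f x : R -> 'cV[R]_n) :=
  forall t, ts_set T t ->
    delta_integrable t (fun u => A u *m x u + f u) /\
    x t = x 0 + delta_integral t (fun u => A u *m x u + f u).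

End delta_integral.

Definition is_expmx {K : numFieldType} {n} (L B : 'M[K]_n) : Prop :=
  (fun N => \sum_(k < N) (k`!%:R)^-1 *: L ^+ k) @ \oo --> B.

Definition borel_measurable_fun {S S' : ptopologicalType} (D : set S)
    (f : S -> S') :=
  measurable_fun (D : set (g_sigma_algebraType (@open S)))
    (f : g_sigma_algebraType (@open S) -> g_sigma_algebraType (@open S')).

Definition borel_measurable_mx {K : numFieldType} {n} (D : set 'M[K]_n)
  (f : 'M[K]_n -> 'M[K]_n) := borel_measurable_fun D f.

Section complex_systems.
Context {R : realType} {n : nat}.
Local Notation C := R[i].

Definition cplx_mx {m p} (B : 'M[R]_(m, p)) : 'M[C]_(m, p) :=
  map_mx (real_complex R) B.

Definition real_mx {m p} (B : 'M[C]_(m, p)) :=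
  exists B' : 'M[R]_(m, p), B = cplx_mx B'.

Definition bounded_log (mlog : 'M[C]_n -> 'M[C]_n) :=
  forall r : R, 0 < r -> exists M : R, forall B, B \in unitmx ->
    `|B| <= r%:C -> `|invmx B| <= r%:C -> `|mlog B| <= M%:C.

Definition real_log (mlog : 'M[C]_n -> 'M[C]_n) :=
  forall (L : 'M[R]_n) (B : 'M[C]_n),
    is_expmx (cplx_mx L) B -> real_mx (mlog B).

(* For 1 < n no logarithm is both bounded_log and real_log.  As theta tends to
   pi from below, B = [[cos theta, 1], [- sin theta ^+ 2, cos theta]] and its
   inverse stay bounded, while the real logarithms of B are the matrices
   (theta + 2 k pi) / sin theta *: (B - cos theta), k an integer, whose norms
   tend to infinity; for 2 < n complete B by an identity block.  Requiring only
   one of the two keeps the notion satisfiable in every dimension; it is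
   implied by their conjunction. *)
Definition matrix_log (mlog : 'M[C]_n -> 'M[C]_n) :=
  [/\ forall B, B \in unitmx -> is_expmx (mlog B) B,
      borel_measurable_mx [set B | B \in unitmx] mlog
    & bounded_log mlog \/ real_log mlog].

Definition cintegrable (D : set R) (g : R -> C) :=
  (@lebesgue_measure R).-integrable D (fun u => (complex.Re (g u))%:E) /\
  (@lebesgue_measure R).-integrable D (fun u => (complex.Im (g u))%:E).

Definition oriented_integral (a b : R) (g : R -> R) : R :=
  if a <= b then \int[lebesgue_measure]_(u in `[a, b]) g u
  else - \int[lebesgue_measure]_(u in `[b, a]) g u.

Definition cintegral (a b : R) (g : R -> C) : C :=
  oriented_integral a b (fun u => complex.Re (g u)) +i*
  oriented_integral a b (fun u => complex.Im (g u)).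

Definition locally_integrable_mx (A : R -> 'M[C]_n) :=
  forall (b : R) i j, cintegrable `[0, b] (fun u => A u i j).

(* Phi s tau is the Cauchy matrix of dx/ds = A(s) x on [0, +oo[, in the sense of
   Caratheodory: A is locally integrable, and the system is integrated. *)
Definition cauchy_matrix (A : R -> 'M[C]_n) (Phi : R -> R -> 'M[C]_n) :=
  locally_integrable_mx A /\
  forall tau : R, 0 <= tau ->
    locally_integrable_mx (fun u => A u *m Phi u tau) /\
    forall s : R, 0 <= s -> Phi s tau =
      1%:M + \matrix_(i, j) cintegral tau s (fun u => (A u *m Phi u tau) i j).

End complex_systems.

(* F is the field of scalars of the phase space, R or R[i], and emb the
   inclusion of R in F. *)
Definition exp_dichotomy {R : realType} {F : numFieldType} {n} (emb : R -> F)
    (Phi : R -> R -> 'M[F]_n) :=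
  exists (Up Um : R -> {vspace 'cV[F]_n}) (c lam : R),
  [/\ 0 < c /\ 0 < lam,
      forall s : R, 0 <= s ->
        (Up s + Um s)%VS = fullv /\ (Up s :&: Um s)%VS = 0%VS,
      forall s tau : R, 0 <= s -> 0 <= tau ->
        (linfun (mulmx (Phi s tau)) @: Up tau)%VS = Up s /\
        (linfun (mulmx (Phi s tau)) @: Um tau)%VS = Um s,
      forall (s tau : R) (x : 'cV[F]_n), 0 <= tau -> tau < s -> x \in Up tau ->
        `|Phi s tau *m x| <= emb (c * expR (- lam * (s - tau))) * `|x|
    & forall (s tau : R) (x : 'cV[F]_n), 0 <= s -> s < tau -> x \in Um tau ->
        `|Phi s tau *m x| <= emb (c * expR (lam * (s - tau))) * `|x|].

Section hyperbolicity.
Context {R : realType} {n : nat}.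
Local Notation C := R[i].

(* The phase space is R^n when A is real-valued and C^n otherwise. *)
Definition hyperbolic_ode (A : R -> 'M[C]_n) :=
  let real_valued := forall s : R, 0 <= s -> real_mx (A s) in
  (real_valued -> exists2 Phi : R -> R -> 'M[R]_n,
     cauchy_matrix A (fun s tau => cplx_mx (Phi s tau)) &
     exp_dichotomy (fun r : R => r) Phi) /\
  (~ real_valued -> exists2 Phi : R -> R -> 'M[C]_n,
     cauchy_matrix A Phi & exp_dichotomy (real_complex R) Phi).

Definition ts_rate (T : set R) (u : R) : R :=
  let m := graininess T (ts_floor T u) in
  if m == 0 then 1 else ln (1 + m) / m.

Definition ts_clock (T : set R) (t : R) : R :=
  \int[lebesgue_measure]_(u in `[0, t]) ts_rate T u.

(* As ts_clock T is a bijection of [0, +oo[, this determines A' there. *)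
Definition corresponding_ode (T : set R) (mlog : 'M[C]_n -> 'M[C]_n)
    (A : R -> 'M[R]_n) (A' : R -> 'M[C]_n) :=
  (forall t, T t -> A' (ts_clock T t) = cplx_mx (A t)) /\
  (forall t : R, 0 <= t -> ~ T t ->
     let m := graininess T (ts_floor T t) in
     A' (ts_clock T t) =
       (ln (1 + m))^-1%:C *: mlog (cplx_mx (1%:M + m *: A (ts_floor T t)))).

Definition hyperbolic_ts (T : set R) (mlog : 'M[C]_n -> 'M[C]_n)
    (A : R -> 'M[R]_n) :=
  exists2 A' : R -> 'M[C]_n, corresponding_ode T mlog A A' & hyperbolic_ode A'.

End hyperbolicity.

(* Main.v *)
(* Let s be the clock and X(t) = Phi(s(t), 0) for t in T.  On the image of a gap
   the differential system is autonomous and its flow multiplies by the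
   exponential of the matrix logarithm, that is by E + mu A; at right-dense points
   X has the right derivative A X.  Hence X solves the homogeneous Delta-system,
   and Phi(s(t), s(tau)) = X(t) X(tau)^-1 is real on T even if A is complex.

   The projection P on the stable space at 0 along the unstable one gives the Green
   function X(t) P X(tau)^-1, - X(t) (E - P) X(tau)^-1.  It decays exponentially
   because the projections are bounded on T: a step with large mu expands every
   vector, as mu (E + mu A)^-1 = A^-1 (E - (E + mu A)^-1) is bounded, so mu is
   bounded as soon as the stable space is nontrivial, and then the growth of X is
   exponentially bounded and the angle between the two spaces is bounded below.
   The bounded solution is X(t) (c(t) + x0), where c(t) is the Delta-integral of
   X(sigma(u))^-1 f(u) over [0, t) and - x0 is a cluster value of (E - P) c(N) as N
   tends to infinity.  The logarithmic clock matches the factors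
   |(E + mu A)^-1| = O(1 / (1 + mu)), so that large steps do no harm.

   Integrals over T are only compared by means of the induction principle
   [ts_nonincreasing], which replaces changes of variables. *)
Require Import Defs.
From HB Require Import structures.
From mathcomp Require Import all_boot all_order all_algebra.
From mathcomp Require Import complex.
From mathcomp Require Import all_classical all_reals all_analysis.
From mathcomp Require Import measurable_realfun ring lra.

Set Implicit Arguments.
Unset Strict Implicit.
Unset Printing Implicit Defensive.
Import Order.TTheory GRing.Theory Num.Theory.
Import numFieldNormedType.Exports.
Local Open Scope classical_set_scope.
Local Open Scope ring_scope.
Local Open Scope complex_scope.

(** * Time scales *)

(** What a gap contributes is known exactly only at its two ends, through the exponential of the
    logarithm. The differential system and the time scale are therefore compared between points of
    T, with whole gaps integrated at once ([clock_mean]).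

    Calculus on T is done with monotone comparison functions: a quantity is corrected by a linear
    drift or an exponential until it does not increase at jumps and just after right-dense points,
    and a local Lipschitz bound does the rest. Gronwall's inequality, both bounds on the Green
    function and the integral equation have this form. In the Green bounds the correction is a
    multiple of the exponential of - lam times the clock distance from the fixed time t to the
    running time; its variation dominates that of the bounded quantity, which takes the place of
    integrating an exponential over T.

    As f is only measurable, c need not have a Delta-derivative; the integral equation is obtained
    by showing that its defect [D] is flat at right-dense points and unchanged over gaps, hence
    constant. A cluster value can replace the improper integral because the unstable bound is
    uniform in N. *)

Lemma ler_mulDl1 (R : realFieldType) (m e : R) : 0 <= m -> 0 <= e ->
  m * (e / (m + 1)) <= e.
Proof.
move=> m0 e0; rewrite mulrCA ler_piMr// ler_pdivrMr ?mul1r ?lerDl//.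
by rewrite ltr_wpDl.
Qed.

(** Tolerances are divided by [m + 1] rather than [m], since the constants [m] below, often
    multiples of the dimension, may vanish. *)
Lemma ler_mulDl1_le (R : realFieldType) (a m e : R) : 0 <= m -> 0 <= e ->
  a <= e / (m + 1) -> m * a <= e.
Proof.
by move=> m0 e0 h; apply: le_trans (ler_wpM2l m0 h) _; exact: ler_mulDl1.
Qed.

Section time_scale_order.
Context {R : realType} (T : timeScale R).
Implicit Types a b t u v r : R.

Lemma closed_adherent (D : set R) t : closed D ->
  (forall e, 0 < e -> exists2 u, D u & `|t - u| < e) -> D t.
Proof.
move=> cD h; apply: cD => B /nbhs_ballP[e /= e0 eB].
by have [u Du tu] := h _ e0; exists u; split => //; exact: eB.
Qed.

Lemma sigma_ge t : t <= sigma T t.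
Proof. by apply: lb_le_inf; [exact: (sigma_has_inf T t).1 | move=> u [_ /ltW]]. Qed.

Lemma sigma_le t u : ts_set T u -> t < u -> sigma T t <= u.
Proof. by move=> Tu tu; apply: ge_inf; [exact: (sigma_has_inf T t).2 | split]. Qed.

Lemma sigma_in t : ts_set T (sigma T t).
Proof.
apply: closed_adherent (@ts_closed R T) _ => e e0.
have [u [Tu tu] ul] := inf_adherent e0 (sigma_has_inf T t).
exists u => //; rewrite distrC ger0_norm ?subr_ge0 ?sigma_le//.
by rewrite ltrBlDl.
Qed.

Lemma graininess_ge0 t : 0 <= graininess T t.
Proof. by rewrite subr_ge0 sigma_ge. Qed.

Lemma graininessE t : sigma T t = t + graininess T t.
Proof. by rewrite /graininess addrC subrK. Qed.

Lemma sigma_adherent t e : 0 < e -> exists u, [/\ ts_set T u, t < u & u < sigma T t + e].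
Proof.
by move=> e0; have [u [Tu tu] ul] := inf_adherent e0 (sigma_has_inf T t); exists u.
Qed.

Let floor_has_sup r : 0 <= r -> has_sup [set u | ts_set T u /\ u <= r].
Proof.
by move=> r0; split; [exists 0; split => //; exact: ts_0 | exists r => u []].
Qed.

Lemma ts_floor_le r : 0 <= r -> ts_floor T r <= r.
Proof. by move=> r0; apply: sup_le_ub => [|u []//]; exact: (floor_has_sup r0).1. Qed.

Lemma ts_floor_ub r u : ts_set T u -> u <= r -> u <= ts_floor T r.
Proof. by move=> Tu ur; apply: ub_le_sup => //; exists r => v []. Qed.

Lemma ts_floor_in r : 0 <= r -> ts_set T (ts_floor T r).
Proof.
move=> r0; apply: closed_adherent (@ts_closed R T) _ => e e0.
have [u [Tu ur] ul] := sup_adherent e0 (floor_has_sup r0).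
exists u => //; rewrite ger0_norm ?subr_ge0 ?ts_floor_ub//.
by move: ul; rewrite /ts_floor; lra.
Qed.

Lemma ts_floor_id t : ts_set T t -> ts_floor T t = t.
Proof.
move=> Tt; apply/le_anti; rewrite ts_floor_ub// andbT.
by rewrite ts_floor_le//; exact: ts_ge0 Tt.
Qed.

Lemma ts_floor_gap t r : ts_set T t -> t <= r < sigma T t -> ts_floor T r = t.
Proof.
move=> Tt /andP[tr rs]; have r0 : 0 <= r by apply: le_trans tr; exact: ts_ge0 Tt.
apply/le_anti; rewrite ts_floor_ub// andbT leNgt; apply/negP => tf.
have := sigma_le (ts_floor_in r0) tf; rewrite leNgt => /negP; apply.
by apply: le_lt_trans rs; exact: ts_floor_le.
Qed.

Lemma ts_floor_notin r : 0 <= r -> ~ ts_set T r ->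
  ts_floor T r < r < sigma T (ts_floor T r).
Proof.
move=> r0 nTr; have fr : ts_floor T r < r.
  rewrite lt_neqAle ts_floor_le// andbT; apply/eqP => e.
  by apply: nTr; rewrite -e; exact: ts_floor_in.
rewrite fr /= ltNge; apply/negP => sr.
have [e e0 he] : exists2 e, 0 < e & forall u, ts_set T u -> `|r - u| < e -> False.
  apply: contrapT => h; apply: nTr; apply: closed_adherent (@ts_closed R T) _ => e e0.
  apply: contrapT => h'; apply: h; exists e => // u Tu ru; apply: h'; by exists u.
(* If [sigma] of the floor were still at most [r], it would be the floor itself by maximality. The
   floor would then be right-dense, and [T] would have points strictly between it and [r]. *)
have sf : sigma T (ts_floor T r) = ts_floor T r.
  apply/le_anti; rewrite sigma_ge andbT ts_floor_ub//; exact: sigma_in.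
have d0 : 0 < r - ts_floor T r by rewrite subr_gt0.
have [u [Tu fu ul]] := sigma_adherent (ts_floor T r) d0.
by have := ts_floor_ub Tu (u := u) (r := r); rewrite sf in ul; lra.
Qed.

(* A continuous induction: the supremum of the times up to which [H] stays below
   [H a] is reached, and can be exceeded if it is not [b]. *)
Lemma ts_nonincreasing (H : R -> R) L a b : ts_set T a -> ts_set T b -> a <= b -> 0 <= L ->
  (forall t, ts_set T t -> a <= t -> t < b -> t < sigma T t -> H (sigma T t) <= H t) ->
  (forall t, ts_set T t -> a <= t -> t < b -> sigma T t = t ->
     exists2 d, 0 < d & forall u, ts_set T u -> t < u -> u < t + d -> u <= b -> H u <= H t) ->
  (forall u v, ts_set T u -> ts_set T v -> a <= u -> u <= v -> v <= b -> H v - H u <= L * (v - u)) ->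
  H b <= H a.
Proof.
move=> Ta Tb ab L0 HS HD HL.
pose S := [set t | [/\ ts_set T t, a <= t, t <= b &
  forall u, ts_set T u -> a <= u -> u <= t -> H u <= H a]].
have Sa : S a.
  split => // u Tu au ua; suff -> : u = a by [].
  by apply/le_anti; rewrite ua au.
have supS : has_sup S by split; [exists a | exists b => t []].
pose c := sup S.
have ac : a <= c by apply: ub_le_sup => //; exact: supS.2.
have cb : c <= b by apply: sup_le_ub => [|t []//]; exact: supS.1.
have Tc : ts_set T c.
  apply: closed_adherent (@ts_closed R T) _ => e e0.
  have [u Su ul] := sup_adherent e0 supS.
  exists u; first by case: Su.
  rewrite ger0_norm; first by rewrite -/c in ul; lra.
  by rewrite subr_ge0; apply: ub_le_sup => //; exact: supS.2.
(* The one-sided Lipschitz bound carries the inequality to [c] when [c] is only a limit of points of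
   [S] from the left. *)
have Sc : S c.
  split => // u Tu au uc; have [ult|uge] := ltP u c.
    have [v Sv vu] := sup_adherent (eps := c - u) ltac:(lra) supS.
    by case: Sv => _ _ _; apply => //; rewrite -/c in vu; lra.
  have -> : u = c by lra.
  apply/ler_addgt0Pr => e e0.
  have eL : 0 < e / (L + 1) by rewrite divr_gt0// ltr_wpDl.
  have [v [Tv av vb vH] vl] := sup_adherent eL supS.
  have vc : v <= c by apply: ub_le_sup; [exact: supS.2 | split].
  have := HL v c Tv Tc av vc cb; have := vH v Tv av (lexx _).
  suff : L * (c - v) <= e by lra.
  apply: (@le_trans _ _ (L * (e / (L + 1)))).
    by apply: ler_wpM2l => //; rewrite -/c in vl; lra.
  by apply: ler_mulDl1 => //; exact: ltW.
have [ltcb|] := ltP c b; last first.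
  move=> bc; have <- : c = b by lra.
  by case: Sc => _ _ _; apply.
have [] := eqVneq (sigma T c) c => sc; last first.
  have csc : c < sigma T c by rewrite lt_neqAle eq_sym sc sigma_ge.
  suff : S (sigma T c) by move=> /(ub_le_sup supS.2); rewrite leNgt csc.
  split; [exact: sigma_in | exact: le_trans (ltW csc) | exact: sigma_le |].
  move=> u Tu au us; have [cu|uc] := ltP c u.
    have -> : u = sigma T c by apply/le_anti; rewrite us sigma_le.
    apply: le_trans (HS c Tc ac ltcb csc) _.
    by case: Sc => _ _ _; apply.
  by case: Sc => _ _ _; apply.
have [d d0 hd] := HD c Tc ac ltcb sc.
have m0 : 0 < Num.min d (b - c) by rewrite lt_min d0 subr_gt0.
have [u [Tu cu ul]] := sigma_adherent c m0.
have [ud ub] : u < c + d /\ u <= b.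
  by move: ul; rewrite sc -ltrBlDl lt_min; lra.
suff : S u by move=> /(ub_le_sup supS.2); rewrite leNgt cu.
split => //; first lra.
move=> v Tv av vu; have [cv|vc] := ltP c v.
  apply: (@le_trans _ _ (H c)); last by case: Sc => _ _ _; apply.
  by apply: hd => //; lra.
by case: Sc => _ _ _; apply.
Qed.

End time_scale_order.

(** * Integration and the clock *)

Section real_integration.
Context {R : realType}.

Lemma Rintegral_bounds d (S : measurableType d) (mu : {measure set S -> \bar R})
    (D : set S) (g : S -> R) (l u : R) : measurable D -> (mu D < +oo)%E ->
  mu.-integrable D (EFin \o g) -> (forall x, D x -> l <= g x <= u) ->
  l * fine (mu D) <= \int[mu]_(x in D) g x <= u * fine (mu D).
Proof.
move=> mD Doo ig gb.
have ic (k : R) : mu.-integrable D (EFin \o (fun=> k)).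
  apply: (@measurable_bounded_integrable _ _ _ mu (cst k)) => //.
  exact: bounded_cst.
by rewrite -!Rintegral_cst//; apply/andP; split;
  apply: le_Rintegral => // x /gb /andP[].
Qed.

Lemma Rintegral_bounds_norm d (S : measurableType d) (mu : {measure set S -> \bar R})
    (D : set S) (g : S -> R) (v e : R) : measurable D -> (mu D < +oo)%E ->
  mu.-integrable D (EFin \o g) -> (forall x, D x -> `|g x - v| <= e) ->
  `|\int[mu]_(x in D) g x - fine (mu D) * v| <= e * fine (mu D).
Proof.
move=> mD Doo ig gb.
have /(Rintegral_bounds mD Doo ig) /andP[h1 h2] :
    forall x, D x -> v - e <= g x <= v + e.
  by move=> x /gb; rewrite ler_norml => /andP[h1 h2]; apply/andP; split; lra.
by rewrite ler_norml; apply/andP; split; lra.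
Qed.

Lemma fine_lebesgue_itv (a b : R) (x y : bool) : a <= b ->
  fine (@lebesgue_measure R [set` Interval (BSide x a) (BSide y b)]) = b - a.
Proof.
move=> ab; rewrite lebesgue_measure_itv /= lte_fin.
case: ltP => [//|ba] /=; lra.
Qed.

Lemma lebesgue_itv_lty (a b : R) (x y : bool) :
  (@lebesgue_measure R [set` Interval (BSide x a) (BSide y b)] < +oo)%E.
Proof.
by rewrite lebesgue_measure_itv /= lte_fin; case: ifP => // _; rewrite -EFinB ltry.
Qed.

Lemma Rintegral_itv_diff (g : R -> R) (c a b : R) : c <= a -> a <= b ->
  lebesgue_measure.-integrable `[c, b] (EFin \o g) ->
  \int[lebesgue_measure]_(x in `[c, b]) g x -
    \int[lebesgue_measure]_(x in `[c, a]) g x =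
  \int[lebesgue_measure]_(x in `[a, b]) g x.
Proof.
move=> ca ab ig; rewrite Rintegral_itvB// ?bnd_simp//.
rewrite Rintegral_itv_obnd_cbnd//; apply: integrableS ig => //.
by apply: subset_itv; rewrite bnd_simp.
Qed.

Lemma measurable_inv : measurable_fun [set: R] (GRing.inv : R -> R).
Proof.
have -> : [set: R] = [set 0] `|` ~` [set 0] by rewrite setUv.
apply/measurable_funU => //; first exact: measurableC.
split; first exact: measurable_fun_set1.
apply: open_continuous_measurable_fun.
  by rewrite openC; exact: accessible_closed_set1 (@hausdorff_accessible _ (@Rhausdorff R)) 0.
by move=> x /set_mem /= /eqP x0; exact: inv_continuous.
Qed.

(** This is [ln (1 + y) <= y] at [y = - x / (1 + x)], for which [1 + y] is the inverse of
    [1 + x]. *)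
Lemma ln1D_ge (x : R) : 0 <= x -> x / (1 + x) <= ln (1 + x).
Proof.
move=> x0; have x1 : 0 < 1 + x by lra.
have h : 1 + (- (x / (1 + x))) = (1 + x)^-1 by field; lra.
have /le_ln1Dx : -1 < - (x / (1 + x)).
  have : 0 < (1 + x)^-1 by rewrite invr_gt0.
  by move: h; set y := x / _; lra.
by rewrite h lnV ?posrE//; lra.
Qed.

End real_integration.

Section clock.
Context {R : realType} (T : timeScale R).
Implicit Types a b t u v r : R.
Local Notation s := (ts_clock T).
Local Notation mu := (@lebesgue_measure R).

(** The clock is never faster than time and, by [ln1D_ge], slower by at most the factor [1 + M]
    where the graininess is at most [M]; this is what makes lengths in the two times comparable. *)
Lemma ts_rate_bounds (M r : R) : graininess T (ts_floor T r) <= M ->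
  (1 + M)^-1 <= ts_rate T r <= 1.
Proof.
rewrite /ts_rate; set m := graininess _ _ => mM; have m0 : 0 <= m := graininess_ge0 T _.
have h : (1 + M)^-1 <= (1 + m)^-1 by rewrite lef_pV2 ?posrE; lra.
case: eqVneq => [|mn0].
  by move=> e; rewrite lexx andbT invf_le1; lra.
have mp : 0 < m by lra.
rewrite ler_pdivrMr// mul1r le_ln1Dx ?andbT; last lra.
apply: le_trans h _; rewrite ler_pdivlMr// mulrC; exact: ln1D_ge.
Qed.

Lemma ts_rate_gt0 r : 0 < ts_rate T r.
Proof.
have /andP[h _] := ts_rate_bounds (lexx (graininess T (ts_floor T r))).
by apply: lt_le_trans h; rewrite invr_gt0; have := graininess_ge0 T (ts_floor T r); lra.
Qed.

Lemma ts_rate_le1 r : ts_rate T r <= 1.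
Proof. by have /andP[] := ts_rate_bounds (lexx (graininess T (ts_floor T r))). Qed.

Lemma ts_floor_nondecreasing : {homo ts_floor T : a b / a <= b}.
Proof.
move=> a b ab; have [a0|a0] := leP 0 a.
  by apply: ts_floor_ub; [exact: ts_floor_in | apply: le_trans ab; exact: ts_floor_le].
have -> : ts_floor T a = 0.
  rewrite /ts_floor (_ : [set u | _] = set0) ?sup0//.
  by rewrite -subset0 => u [/ts_ge0 u0 ua] /=; exfalso; lra.
have [b0|b0] := leP 0 b; first by apply: ts_floor_ub => //; exact: ts_0.
rewrite /ts_floor (_ : [set u | _] = set0) ?sup0//.
by rewrite -subset0 => u [/ts_ge0 u0 ua] /=; exfalso; lra.
Qed.

Lemma measurable_sigma : measurable_fun setT (sigma T).
Proof. by apply: nondecreasing_measurable => //; exact: sigma_nondecreasing. Qed.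

Lemma measurable_ts_rate : measurable_fun setT (ts_rate T).
Proof.
have mm : measurable_fun setT (fun r => graininess T (ts_floor T r)).
  have mf : measurable_fun setT (ts_floor T).
    by apply: nondecreasing_measurable => //; exact: ts_floor_nondecreasing.
  by apply: measurable_funB => //; apply: measurableT_comp mf; exact: measurable_sigma.
have -> : ts_rate T = (fun r => if graininess T (ts_floor T r) == 0 then 1 else
  ln (1 + graininess T (ts_floor T r)) / graininess T (ts_floor T r)) by [].
apply: measurable_fun_ifT.
- exact: measurable_fun_eqr.
- exact: measurable_cst.
- apply: measurable_funM.
    apply: measurableT_comp; first exact: measurable_ln.
    exact: measurable_funD.
  by apply: measurableT_comp mm; exact: measurable_inv.
Qed.

Lemma integrable_ts_rate a b : mu.-integrable `[a, b] (EFin \o ts_rate T).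
Proof.
apply: measurable_bounded_integrable => //; first exact: lebesgue_itv_lty.
  exact: measurable_funTS measurable_ts_rate.
exists 1; split => // M M1 x _ /=; rewrite ger0_norm ?(ltW (ts_rate_gt0 x))//.
exact: le_trans (ts_rate_le1 x) (ltW M1).
Qed.

(** The interval is open on the right because the rate at [b] belongs to what follows [b]; over a
    gap the integrand is then constant. *)
Lemma clock_diff a b : 0 <= a -> a <= b ->
  s b - s a = \int[mu]_(x in `[a, b[) ts_rate T x.
Proof.
move=> a0 ab; rewrite /ts_clock Rintegral_itv_diff//; last exact: integrable_ts_rate.
rewrite Rintegral_itv_bndo_bndc//; apply: integrableS (integrable_ts_rate a b) => //.
by apply: subset_itv; rewrite bnd_simp.
Qed.

(** The condition starts at the floor of [a], since [a] may lie inside a gap, where the rate is that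
    of the left end. *)
Lemma clock_bounds (M a b : R) : 0 <= a -> a <= b ->
  (forall t, ts_set T t -> ts_floor T a <= t -> t < b -> graininess T t <= M) ->
  (b - a) / (1 + M) <= s b - s a <= b - a.
Proof.
move=> a0 ab hM; rewrite clock_diff//.
have := @Rintegral_bounds _ _ _ mu `[a, b[%classic (ts_rate T) (1 + M)^-1 1.
rewrite fine_lebesgue_itv// mul1r mulrC; apply => //.
- exact: lebesgue_itv_lty.
- apply: integrableS (integrable_ts_rate a b) => //.
  by apply: subset_itv; rewrite bnd_simp.
- move=> x /=; rewrite in_itv /= => /andP[ax xb]; have x0 := le_trans a0 ax.
  apply: ts_rate_bounds; apply: hM; first exact: ts_floor_in.
    exact: ts_floor_nondecreasing.
  by apply: le_lt_trans xb; exact: ts_floor_le.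
Qed.

Lemma clock_lip a b : 0 <= a -> a <= b -> 0 <= s b - s a <= b - a.
Proof.
move=> a0 ab; rewrite clock_diff//.
have := @Rintegral_bounds _ _ _ mu `[a, b[%classic (ts_rate T) 0 1.
rewrite fine_lebesgue_itv// mul1r mul0r; apply => //.
- exact: lebesgue_itv_lty.
- apply: integrableS (integrable_ts_rate a b) => //.
  by apply: subset_itv; rewrite bnd_simp.
- by move=> x _; rewrite ts_rate_le1 andbT ltW// ts_rate_gt0.
Qed.

Lemma clock_le a b : 0 <= a -> a <= b -> s a <= s b.
Proof. by move=> a0 /(clock_lip a0) /andP[]; rewrite subr_ge0. Qed.

Lemma clock0 : s 0 = 0.
Proof. by rewrite /ts_clock set_itv1 Rintegral_set1. Qed.

Lemma clock_ge0 a : 0 <= a -> 0 <= s a.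
Proof. by move=> a0; rewrite -{1}clock0; exact: clock_le. Qed.

Lemma clock_gap t r : ts_set T t -> t < sigma T t -> t <= r -> r <= sigma T t ->
  s r - s t = (r - t) * (ln (1 + graininess T t) / graininess T t).
Proof.
move=> Tt ts tr rs; have t0 := ts_ge0 Tt.
set k := ln _ / _.
rewrite clock_diff//.
rewrite (@eq_Rintegral _ _ _ mu _ (fun=> k)); last first.
  move=> x /set_mem /=; rewrite in_itv /= => /andP[tx xr].
  rewrite /ts_rate (@ts_floor_gap _ _ t)//; last by rewrite tx (lt_le_trans xr).
  by rewrite subr_eq0 gt_eqF.
by rewrite Rintegral_cst//= fine_lebesgue_itv// mulrC.
Qed.

Lemma clock_sigma t : ts_set T t -> s (sigma T t) - s t = ln (1 + graininess T t).
Proof.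
move=> Tt; have := sigma_ge T t; rewrite le_eqVlt => /predU1P[e|ts].
  by rewrite /graininess -e !subrr addr0 ln1.
by rewrite clock_gap ?sigma_ge// mulrC divfK// subr_eq0 gt_eqF.
Qed.

Lemma clock_lt a b : 0 <= a -> a < b -> s a < s b.
Proof.
move=> a0 ab; pose M := sigma T b.
(* A gap that starts before [b] starts at a nonnegative time and ends by [sigma T b], which
   therefore bounds its length. *)
have hM : forall t, ts_set T t -> ts_floor T a <= t -> t < b -> graininess T t <= M.
  move=> t Tt _ tb; have := sigma_nondecreasing T (ltW tb).
  by rewrite /graininess /M; have := ts_ge0 Tt; lra.
have /andP[h _] := clock_bounds a0 (ltW ab) hM.
rewrite -subr_gt0; apply: lt_le_trans h.
have M0 : 0 < 1 + M by move: (sigma_ge T b); rewrite -/M; lra.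
by rewrite divr_gt0// subr_gt0.
Qed.

Lemma clock_surj a b y : 0 <= a -> a <= b -> s a <= y <= s b ->
  exists2 r, a <= r <= b & s r = y.
Proof.
move=> a0 ab yab; have [] := @IVT _ s a b y ab.
- apply: continuous_subspaceW (@parameterized_integral_continuous _ 0 b (ts_rate T) _ _).
  + by apply: subset_itv; rewrite bnd_simp.
  + exact: le_trans ab.
  + exact: integrable_ts_rate.
- by rewrite min_l ?max_r// clock_le.
- by move=> r; rewrite in_itv /= => rab sr; exists r.
Qed.

End clock.

(** * Matrix exponentials *)

Section taylor.
Context {R : realType}.
Local Notation mu := (@lebesgue_measure R).

(** The functions [phi k] are successive derivatives in the integral sense. The mean value theorem
    is applied to the Taylor sum [H N] with moving base point, whose derivative telescopes to a
    single term; this Cauchy form of the remainder is the origin of [N!] in place of [(N+1)!]. *)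
Lemma taylor_remainder (phi : nat -> R -> R) (a b : R) (N : nat) (m : R) : a < b ->
  (forall k, mu.-integrable `[a, b] (EFin \o phi k)) ->
  (forall k x, a <= x -> x <= b ->
    phi k x = phi k a + \int[mu]_(u in `[a, x]) phi k.+1 u) ->
  (forall x, a <= x -> x <= b -> `|phi N.+1 x| <= m) ->
  `|phi 0%N b - \sum_(k < N.+1) (b - a) ^+ k / k`!%:R * phi k a| <=
    m * (b - a) ^+ N.+1 / N`!%:R.
Proof.
move=> ab iphi ephi bphi.
(* [psi k] agrees with [phi k] on [a, b] and is a genuine indefinite integral, to which the
   fundamental theorem of calculus applies. *)
pose psi k x := phi k a + \int[mu]_(u in `[a, x]) phi k.+1 u.
have cpsi k : {within `[a, b], continuous (psi k)}.
  move=> x; apply: cvgD; first exact: cvg_cst.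
  exact: (parameterized_integral_continuous (ltW ab) (iphi k.+1)).
have dpsi k x : x \in `]a, b[ -> is_derive x 1 (psi k) (phi k.+1 x).
  move=> xab; have /andP[ax xb] : a < x < b by move: xab; rewrite in_itv.
  have cphi : {for x, continuous (phi k.+1)}.
    have [+ _ _] := (continuous_within_itvP _ ab).1 (cpsi k.+1).
    move=> /(_ _ xab); rewrite /prop_for /continuous_at -{1}(_ : phi k.+1 x = psi k.+1 x).
      apply: cvg_trans; apply: near_eq_cvg; near=> y.
      have /andP[ay yb] : a < y < b.
        have : y \in `]a, b[ by near: y; exact: near_in_itvoo.
        by rewrite in_itv.
      by rewrite [RHS]ephi// ltW.
    by rewrite [LHS]ephi// ltW.
  have [d1 d2] := continuous_FTC1_closed xb (iphi k.+1) ax cphi.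
  have h : is_derive x 1 (fun y => \int[mu]_(u in `[a, y]) phi k.+1 u) (phi k.+1 x).
    by rewrite -d2 derive1E; exact: DeriveDef.
  by rewrite -[phi k.+1 x]add0r; exact: is_deriveD.
pose H n x := \sum_(k < n.+1) (b - x) ^+ k / k`!%:R * psi k x.
have dH n x : x \in `]a, b[ -> is_derive x 1 (H n) ((b - x) ^+ n / n`!%:R * phi n.+1 x).
  move=> xab; have /andP[ax xb] : a < x < b by move: xab; rewrite in_itv.
  elim: n => [|n IH].
    rewrite (_ : H 0%N = psi 0%N); last first.
      by apply/funext => y; rewrite /H big_ord1 expr0 mul1r fact0 invr1 mul1r.
    by rewrite expr0 mul1r fact0 invr1 mul1r; exact: dpsi.
  rewrite (_ : H n.+1 = H n \+ (fun y => (b - y) ^+ n.+1 / n.+1`!%:R * psi n.+1 y));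
    last by apply/funext => y; rewrite /H big_ord_recr.
  have hp : is_derive x 1 (fun y : R => (b - y) ^+ n.+1 / n.+1`!%:R)
      (- ((b - x) ^+ n / n`!%:R)).
    have h1 : is_derive x 1 (fun y : R => b - y) (-1).
      by rewrite -[-1]add0r; apply: is_deriveB.
    have h2 := is_deriveX n.+1 h1.
    have h3 := @is_deriveZ R R^o R _ (n.+1`!%:R)^-1 _ _ _ h2.
    have -> : (fun y : R => (b - y) ^+ n.+1 / n.+1`!%:R) =
        (n.+1`!%:R)^-1 \*: ((fun y : R => b - y) ^+ n.+1).
      by apply/funext => y /=; rewrite exprfctE mulrC.
    apply: is_derive_eq h3 _.
    rewrite factS natrM /GRing.scale /= -mulr_natr.
    have f0 : n`!%:R != 0 :> R by rewrite pnatr_eq0 -lt0n fact_gt0.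
    by field; rewrite f0 /=; have := ler0n R n; lra.
  have hM := is_deriveM hp (dpsi n.+1 _ xab).
  apply: (is_derive_eq (is_deriveD IH hM)).
  rewrite /GRing.scale /=.
  have -> : psi n.+1 x = phi n.+1 x by rewrite /psi -ephi// ltW.
  by ring.
have cH n : {within `[a, b], continuous (H n)}.
  elim: n => [|n IH].
    rewrite (_ : H 0%N = psi 0%N) //.
    by apply/funext => y; rewrite /H big_ord1 expr0 mul1r fact0 invr1 mul1r.
  rewrite (_ : H n.+1 = H n \+ (fun y => (b - y) ^+ n.+1 / n.+1`!%:R * psi n.+1 y));
    last by apply/funext => y; rewrite /H big_ord_recr.
  have cp : continuous (fun y : R => (b - y) ^+ n.+1 / n.+1`!%:R).
    move=> y; apply: cvgMl; apply: (@cvg_comp _ _ _ (fun y => b - y) (fun z => z ^+ n.+1)).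
      by apply: cvgB; [exact: cvg_cst | exact: cvg_id].
    exact: exprn_continuous.
  move=> x; apply: cvgD; first exact: IH.
  by apply: cvgM; [exact: (continuous_subspaceT cp) | exact: cpsi].
have [c /[!in_itv] /= /andP[ac cb] Hc] := MVT_segment (ltW ab) (dH N) (cH N).
have Hb : H N b = phi 0%N b.
  rewrite /H big_ord_recl /= big1 => [|i _].
    by rewrite expr0 mul1r fact0 invr1 mul1r addr0 /psi -ephi// ltW.
  by rewrite subrr expr0n /= !mul0r.
have Ha : H N a = \sum_(k < N.+1) (b - a) ^+ k / k`!%:R * phi k a.
  by apply: eq_bigr => k _; rewrite /psi set_itv1 Rintegral_set1 addr0.
rewrite -Hb -Ha Hc !normrM (ger0_norm (x := b - a)); last lra.
rewrite normrV ?unitfE ?pnatr_eq0 -?lt0n ?fact_gt0// normr_nat normrX ger0_norm; last lra.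
rewrite exprSr -!mulrA [leRHS]mulrC -!mulrA.
have f0 : 0 <= (N`!%:R : R)^-1 by rewrite invr_ge0.
have p0 : (b - c) ^+ N <= (b - a) ^+ N by rewrite lerXn2r ?nnegrE; lra.
have p1 : 0 <= (b - c) ^+ N by rewrite exprn_ge0; lra.
have m0 := bphi c ac cb.
have q : (b - c) ^+ N * `|phi N.+1 c| <= (b - a) ^+ N * m by apply: ler_pM.
have d0 : 0 <= (N`!%:R)^-1 * (b - a) by apply: mulr_ge0 => //; lra.
have := ler_wpM2l d0 q; lra.
Unshelve. all: by end_near. Qed.

End taylor.

Lemma addmxE (R : pzRingType) m n (M N : 'M[R]_(m, n)) i j : (M + N) i j = M i j + N i j.
Proof. exact: mxE. Qed.

Lemma oppmxE (R : pzRingType) m n (M : 'M[R]_(m, n)) i j : (- M) i j = - M i j.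
Proof. exact: mxE. Qed.

Lemma scalemxE (R : pzRingType) m n (a : R) (M : 'M[R]_(m, n)) i j :
  (a *: M) i j = a * M i j.
Proof. exact: mxE. Qed.

Definition entryE := (addmxE, oppmxE).

(** * Matrix norms, real and imaginary parts *)

Section matrix_norm.
Context {K : numFieldType}.

Lemma mx_norm_entry m n (M : 'M[K]_(m, n)) i j : `|M i j| <= `|M|.
Proof.
rewrite [leRHS]/Num.Def.normr /= mx_normE.
have -> : `|M i j| = (`|M i j|%:nng)%:num by [].
by rewrite num_le (bigmax_sup (i, j)).
Qed.

Lemma mx_norm_le m n (M : 'M[K]_(m, n)) (c : K) : 0 <= c ->
  (forall i j, `|M i j| <= c) -> `|M| <= c.
Proof.
move=> c0 h; rewrite [leLHS]/Num.Def.normr /=.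
have [->//|] := eqVneq (mx_norm M) 0.
by move=> /mx_norm_neq0[[i j] ->].
Qed.

Lemma mx_norm_mul m n p (M : 'M[K]_(m, n)) (N : 'M[K]_(n, p)) :
  `|M *m N| <= n%:R * `|M| * `|N|.
Proof.
apply: mx_norm_le => [|i j]; first by rewrite !mulr_ge0.
rewrite mxE; apply: le_trans (ler_norm_sum _ _ _) _.
rewrite -mulrA -[X in X%:R]card_ord mulr_natl -sumr_const; apply: ler_sum => k _.
by rewrite normrM ler_pM// mx_norm_entry.
Qed.

Lemma mx_norm1 n : `|1%:M : 'M[K]_n| <= 1.
Proof.
by apply: mx_norm_le => // i j; rewrite mxE normr_nat; case: eqP.
Qed.

End matrix_norm.

Section Rintegral_sum.
Context {R : realType} d (S : measurableType d) (mu : {measure set S -> \bar R}).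

Lemma integrable_sumr (D : set S) (I : Type) (l : seq I) (F : I -> S -> R) :
  measurable D -> (forall i, mu.-integrable D (EFin \o F i)) ->
  mu.-integrable D (EFin \o (fun x => \sum_(i <- l) F i x)).
Proof.
move=> mD iF; elim: l => [|i l IH].
  under [X in EFin \o X]eq_fun do rewrite big_nil.
  exact: integrable0.
under [X in EFin \o X]eq_fun do rewrite big_cons.
exact: (integrableD mD (iF i) IH).
Qed.

Lemma Rintegral_sumr (D : set S) (I : Type) (l : seq I) (F : I -> S -> R) :
  measurable D -> (forall i, mu.-integrable D (EFin \o F i)) ->
  \int[mu]_(x in D) (\sum_(i <- l) F i x) = \sum_(i <- l) \int[mu]_(x in D) F i x.
Proof.
move=> mD iF; elim: l => [|i l IH].
  under eq_Rintegral do rewrite big_nil.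
  by rewrite big_nil Rintegral_cst// mul0r.
under eq_Rintegral do rewrite big_cons.
by rewrite RintegralD ?IH ?big_cons//; exact: integrable_sumr.
Qed.

Lemma integrable_scale (D : set S) (k : R) (g : S -> R) : measurable D ->
  mu.-integrable D (EFin \o g) -> mu.-integrable D (EFin \o (fun x => k * g x)).
Proof. by move=> mD ig; exact: (integrableZl mD k ig). Qed.

End Rintegral_sum.

Section complex_parts.
Context {R : realType}.
Local Notation C := R[i].
Local Notation Re := (@complex.Re R).
Local Notation Im := (@complex.Im R).

(** The norm of a complex matrix is an element of [R[i]]; this is the same number in [R]. *)
Definition cnorm m n (M : 'M[C]_(m, n)) : R := Re `|M|.

Lemma cnormE m n (M : 'M[C]_(m, n)) : (cnorm M)%:C = `|M|.
Proof. by rewrite RRe_real// normr_real. Qed.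

Lemma ReD (x y : C) : Re (x + y) = Re x + Re y. Proof. by case: x y => [? ?] [? ?]. Qed.
Lemma ReN (x : C) : Re (- x) = - Re x. Proof. by case: x. Qed.
Lemma ReM (x y : C) : Re (x * y) = Re x * Re y - Im x * Im y.
Proof. by case: x y => [? ?] [? ?]. Qed.
Lemma ReZ (a : R) (x : C) : Re (a%:C * x) = a * Re x.
Proof. by rewrite ReM /= mul0r subr0. Qed.
Lemma Re_sum (I : Type) (l : seq I) (F : I -> C) :
  Re (\sum_(i <- l) F i) = \sum_(i <- l) Re (F i).
Proof. exact: (big_morph Re ReD). Qed.

Lemma Re_le_cnorm m n (M : 'M[C]_(m, n)) i j : `|Re (M i j)| <= cnorm M.
Proof.
rewrite -lecR cnormE; apply: le_trans (normc_ge_Re _) _; exact: mx_norm_entry.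
Qed.

Lemma cnorm_mul m n p (M : 'M[C]_(m, n)) (N : 'M[C]_(n, p)) :
  cnorm (M *m N) <= n%:R * cnorm M * cnorm N.
Proof.
rewrite -lecR !rmorphM /= !cnormE rmorph_nat; exact: mx_norm_mul.
Qed.

Lemma cnorm_ge0 m n (M : 'M[C]_(m, n)) : 0 <= cnorm M.
Proof. by rewrite -ler0c cnormE. Qed.

Lemma cnormB m n (M N : 'M[C]_(m, n)) : cnorm (M - N) <= cnorm M + cnorm N.
Proof. by rewrite -lecR rmorphD /= !cnormE ler_normB. Qed.

Lemma cnormZ m n (c : R) (M : 'M[C]_(m, n)) : cnorm (c%:C *: M) = `|c| * cnorm M.
Proof.
apply: (@complexI R); rewrite rmorphM /= !cnormE mx_normZ; congr (_ * _).
by rewrite normc_def /= expr0n /= addr0 sqrtr_sqr.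
Qed.

Lemma norm_le_ReIm (x : C) : `|x| <= (`|Re x| + `|Im x|)%:C.
Proof.
rewrite {1}[x]complexE rmorphD /=; apply: le_trans (ler_normD _ _) _.
have h (a : R) : `|a%:C| = `|a|%:C :> C.
  by rewrite normc_def /= expr0n /= addr0 sqrtr_sqr.
have hi : `|'i| = 1 :> C by rewrite normc_def /= expr0n /= expr1n add0r sqrtr1.
by rewrite normrM !h hi mul1r.
Qed.

Lemma mx_exprZ n (c : C) (M : 'M[C]_n) k : (c *: M) ^+ k = c ^+ k *: M ^+ k.
Proof.
elim: k => [|k IH]; first by rewrite !expr0 scale1r.
by rewrite !exprS IH -!mulmxE -scalemxAl -scalemxAr scalerA.
Qed.

End complex_parts.

Lemma continuous_within_sum {R : realType} (D : set R) (I : Type) (l : seq I)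
    (g : I -> R -> R) : (forall i, {within D, continuous (g i)}) ->
  {within D, continuous (fun x => \sum_(i <- l) g i x)}.
Proof.
move=> cg; elim: l => [|k l IH].
  rewrite (_ : (fun x => _) = cst 0); first by move=> x; exact: cvg_cst.
  by apply/funext => x; rewrite big_nil.
rewrite (_ : (fun x => _) = g k \+ (fun x => \sum_(i <- l) g i x)).
  by move=> x; apply: cvgD; [exact: cg | exact: IH].
by apply/funext => x; rewrite big_cons.
Qed.

(** At the ends of a gap the coefficient of the differential system is the value of [A] there and
    not the scaled logarithm of the gap, so that integrands over the gap agree only in its
    interior. *)
Lemma Rintegral_eq_oo {R : realType} (g h : R -> R) (a b : R) :
  lebesgue_measure.-integrable `[a, b] (EFin \o g) ->
  lebesgue_measure.-integrable `[a, b] (EFin \o h) ->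
  (forall x, a < x -> x < b -> g x = h x) ->
  \int[lebesgue_measure]_(x in `[a, b]) g x =
  \int[lebesgue_measure]_(x in `[a, b]) h x.
Proof.
have oo (k : R -> R) : lebesgue_measure.-integrable `[a, b] (EFin \o k) ->
    \int[lebesgue_measure]_(x in `[a, b]) k x = \int[lebesgue_measure]_(x in `]a, b[) k x.
  move=> ik; rewrite -Rintegral_itv_obnd_cbnd -?Rintegral_itv_bndo_bndc//.
    by apply: integrableS ik => //; apply: subset_itv; rewrite bnd_simp.
  by apply: integrableS ik => //; apply: subset_itv; rewrite bnd_simp.
move=> ig ih gh; rewrite !oo//; apply: eq_Rintegral => x /set_mem /=.
by rewrite in_itv /= => /andP[ax xb]; exact: gh.
Qed.

Lemma primitive_continuous {R : realType} (g Z : R -> R) (a b : R) :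
  lebesgue_measure.-integrable `[a, b] (EFin \o g) ->
  (forall x, a <= x -> x <= b ->
     Z x = Z a + \int[lebesgue_measure]_(u in `[a, x]) g u) ->
  {within `[a, b], continuous Z}.
Proof.
move=> ig Zg; have [ab|ba] := leP a b; last first.
  by rewrite set_itv_ge ?bnd_simp -?ltNge//; exact: continuous_subspace0.
have h : {within `[a, b], continuous (fun x => Z a + \int[lebesgue_measure]_(u in `[a, x]) g u)}.
  move=> x; apply: cvgD; first exact: cvg_cst.
  exact: (parameterized_integral_continuous ab ig).
apply: subspace_eq_continuous h => x /set_mem /=; rewrite in_itv /= => /andP[ax xb].
exact/esym/Zg.
Qed.

Section exponential_flow.
Context {R : realType} {n : nat}.
Local Notation C := R[i].
Local Notation Re := (@complex.Re R).
Local Notation Im := (@complex.Im R).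
Local Notation mu := (@lebesgue_measure R).

(* The Taylor remainder at order N is a bounded multiple of the N-th term of the
   exponential series, which tends to 0 because the series converges to [B]. *)
Lemma exp_flow (L B : 'M[C]_n) (z G : R -> 'M[C]_n) (a b : R) : a < b ->
  (forall u, a < u -> u < b -> G u = L *m z u) ->
  (forall i j, cintegrable `[a, b] (fun u => G u i j)) ->
  (forall x i j, a <= x -> x <= b ->
     z x i j = z a i j + cintegral a x (fun u => G u i j)) ->
  is_expmx ((b - a)%:C *: L) B -> z b = B *m z a.
Proof.
move=> ab Gz iz ez eB.
have eRe x i j : a <= x -> x <= b -> Re (z x i j) =
    Re (z a i j) + \int[mu]_(u in `[a, x]) Re (G u i j).
  by move=> ax xb; rewrite ez// ReD /cintegral /oriented_integral ax.
have eIm x i j : a <= x -> x <= b -> Im (z x i j) =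
    Im (z a i j) + \int[mu]_(u in `[a, x]) Im (G u i j).
  move=> ax xb; rewrite ez// /cintegral /oriented_integral ax.
  by case: (z a i j).
have cRe i j : {within `[a, b], continuous (fun x => Re (z x i j))}.
  by apply: primitive_continuous (iz i j).1 _ => x ax xb; exact: eRe.
have cIm i j : {within `[a, b], continuous (fun x => Im (z x i j))}.
  by apply: primitive_continuous (iz i j).2 _ => x ax xb; exact: eIm.
pose phi (M : 'M[C]_n) i j x := Re ((M *m z x) i j).
have phiE M i j x : phi M i j x =
    \sum_k (Re (M i k) * Re (z x k j) + (- Im (M i k)) * Im (z x k j)).
  rewrite /phi mxE Re_sum; apply: eq_bigr => k _.
  by rewrite ReM mulNr.
have sub x : a <= x -> x <= b -> `[a, x]%classic `<=` `[a, b]%classic.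
  by move=> ax xb; apply: subset_itv; rewrite bnd_simp.
have cphi M i j : {within `[a, b], continuous (phi M i j)}.
  rewrite (_ : phi M i j = fun x =>
    \sum_k (Re (M i k) * Re (z x k j) + (- Im (M i k)) * Im (z x k j))); last first.
    by apply/funext => x; exact: phiE.
  apply: continuous_within_sum => k x.
  by apply: cvgD; apply: cvgMl_tmp; [exact: cRe | exact: cIm].
have iphi M i j : mu.-integrable `[a, b] (EFin \o phi M i j).
  apply: continuous_compact_integrable => //; exact: segment_compact.
have fphi M i j x : a <= x -> x <= b -> phi M i j x = phi M i j a +
    \int[mu]_(u in `[a, x]) phi (M *m L) i j u.
  move=> ax xb.
  have iR k : mu.-integrable `[a, x] (EFin \o (fun u => Re (G u k j))).
    by apply: integrableS (iz k j).1 => //; exact: sub.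
  have iI k : mu.-integrable `[a, x] (EFin \o (fun u => Im (G u k j))).
    by apply: integrableS (iz k j).2 => //; exact: sub.
  rewrite (_ : \int[mu]_(u in _) _ = \int[mu]_(u in `[a, x]) (\sum_k
     (Re (M i k) * Re (G u k j) + (- Im (M i k)) * Im (G u k j)))).
    rewrite (@Rintegral_sumr _ _ _ mu `[a, x]%classic _ _
      (fun k u => (Re (M i k) * Re (G u k j) +
      (- Im (M i k)) * Im (G u k j))))//; last first.
      move=> k; have mD : measurable (`[a, x]%classic : set (measurableTypeR R)) by [].
      exact: (integrableD mD (integrable_scale (Re (M i k)) mD (iR k))
        (integrable_scale (- Im (M i k)) mD (iI k))).
    rewrite !phiE -big_split /=; apply: eq_bigr => k _.
    rewrite RintegralD//; [|exact: integrable_scale..].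
    rewrite !RintegralZl// eRe// eIm//; lra.
  apply: Rintegral_eq_oo.
  - by apply: integrableS (iphi (M *m L) i j) => //; exact: sub.
  - apply: integrable_sumr => // k.
    have mD : measurable (`[a, x]%classic : set (measurableTypeR R)) by [].
    exact: (integrableD mD (integrable_scale (Re (M i k)) mD (iR k))
        (integrable_scale (- Im (M i k)) mD (iI k))).
  - move=> u au ux; rewrite /phi -mulmxA mxE Re_sum.
    by apply: eq_bigr => k _; rewrite ReM mulNr Gz// (lt_le_trans ux).
pose t k : 'M[C]_n := (k`!%:R)^-1 *: ((b - a)%:C *: L) ^+ k.
pose S N := \sum_(k < N) t k.
have Scvg e : 0 < e -> exists N0, forall N, (N0 <= N)%N -> cnorm (B - S N) <= e.
  move=> e0; have e0' : 0 < e%:C by rewrite ltcR.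
  have /cvgrPdist_le /(_ _ e0') [N0 _ h] := eB; exists N0 => N /h.
  by rewrite /= -cnormE lecR.
(* [M = 1] gives the real part of the claim and [M = i] its imaginary part. *)
suff key M i j e : 0 < e -> `|phi M i j b - Re ((M *m (B *m z a)) i j)| <= e.
  have key2 M i j : phi M i j b = Re ((M *m (B *m z a)) i j).
    apply/eqP; rewrite -subr_eq0 -normr_le0; apply/ler_addgt0Pr => e e0.
    by rewrite add0r; exact: key.
  apply/matrixP => i j; apply/eqP; rewrite eq_complex; apply/andP; split.
    by have := key2 1%:M i j; rewrite /phi !mul1mx => ->.
  have := key2 ('i%:M) i j; rewrite /phi !mul_scalar_mx !mxE mulrC ReiNIm.
  by rewrite [in X in _ = X]mulrC ReiNIm => /oppr_inj ->.
move=> e0.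
pose V x := \sum_i \sum_j (`|Re (z x i j)| + `|Im (z x i j)|).
have cV : {within `[a, b], continuous V}.
  apply: continuous_within_sum => k; apply: continuous_within_sum => l x.
  by apply: cvgD; apply: cvg_norm; [exact: cRe | exact: cIm].
have [c _ Vc] := EVT_max (ltW ab) cV.
have zV x : a <= x -> x <= b -> cnorm (z x) <= V c.
  move=> ax xb; apply: le_trans (Vc x _); last by rewrite in_itv /= ax.
  have V0 k l : 0 <= `|Re (z x k l)| + `|Im (z x k l)| by rewrite addr_ge0.
  rewrite -lecR cnormE; apply: mx_norm_le => [|k l].
    by rewrite ler0c; apply: sumr_ge0 => k _; apply: sumr_ge0 => l _.
  apply: le_trans (norm_le_ReIm _) _; rewrite lecR /V.
  rewrite (bigD1 k)//= (bigD1 l)//= -addrA lerDl addr_ge0//.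
    by apply: sumr_ge0.
  by apply: sumr_ge0 => k' _; apply: sumr_ge0.
have Vc0 : 0 <= V c by apply: le_trans (zV a _ _); rewrite ?cnorm_ge0// ltW.
have tE k : t k = ((b - a) ^+ k / k`!%:R)%:C *: L ^+ k.
  rewrite /t mx_exprZ scalerA mulrC; congr (_ *: _).
  by rewrite rmorphM rmorphXn /= fmorphV rmorph_nat.
have taylorE N : \sum_(k < N) (b - a) ^+ k / k`!%:R * phi (M *m L ^+ k) i j a =
    Re ((M *m (S N *m z a)) i j).
  rewrite /S mulmx_suml mulmx_sumr summxE Re_sum; apply: eq_bigr => k _.
  by rewrite tE -scalemxAl -scalemxAr mxE ReZ mulmxA.
(* First summand: the Taylor remainder is the term [t N] times fixed factors, and [t N], a
   difference of two partial sums close to [B], is at most twice the tolerance. Second summand: the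
   distance from [S N.+1] to [B]. *)
pose K1 := 2%:R * (n%:R * (n%:R * (n%:R * cnorm M) * cnorm ((b - a)%:C *: L)) * V c) +
  n%:R * cnorm M * (n%:R * cnorm (z a)).
have K10 : 0 <= K1 by rewrite /K1 !(addr_ge0, mulr_ge0, cnorm_ge0).
have e1 : 0 < e / (K1 + 1) by rewrite divr_gt0// ltr_wpDl.
have [N hN] := Scvg _ e1.
have tN : cnorm (t N) <= 2%:R * (e / (K1 + 1)).
  have -> : t N = S N.+1 - S N by rewrite /S big_ord_recr /= addrAC subrr add0r.
  have -> : S N.+1 - S N = (B - S N) - (B - S N.+1) by rewrite opprB [in RHS]addrC addrA subrK.
  apply: le_trans (cnormB _ _) _; have := hN N (leqnn _); have := hN N.+1 (leqnSn _); lra.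
pose m := n%:R * cnorm (M *m L ^+ N.+1) * V c.
have iph k : mu.-integrable `[a, b] (EFin \o phi (M *m L ^+ k) i j) by [].
have bphi x : a <= x -> x <= b -> `|phi (M *m L ^+ N.+1) i j x| <= m.
  move=> ax xb; apply: le_trans (Re_le_cnorm _ _ _) _.
  apply: le_trans (cnorm_mul _ _) _; apply: ler_wpM2l; last exact: zV.
  by rewrite mulr_ge0 ?cnorm_ge0.
have := taylor_remainder ab iph _ bphi; rewrite expr0 mulmx1 taylorE.
have step k x : a <= x -> x <= b -> phi (M *m L ^+ k) i j x =
    phi (M *m L ^+ k) i j a + \int[mu]_(u in `[a, x]) phi (M *m L ^+ k.+1) i j u.
  by move=> ax xb; rewrite exprSr -mulmxE mulmxA; exact: fphi.
move=> /(_ step).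
have mE : m * (b - a) ^+ N.+1 / N`!%:R <=
    n%:R * (n%:R * (n%:R * cnorm M * cnorm (t N)) * cnorm ((b - a)%:C *: L)) * V c.
  have -> : m * (b - a) ^+ N.+1 / N`!%:R =
      n%:R * cnorm (M *m t N *m ((b - a)%:C *: L)) * V c.
    have -> : M *m t N *m ((b - a)%:C *: L) =
        ((b - a) ^+ N.+1 / N`!%:R)%:C *: (M *m L ^+ N.+1).
      rewrite tE -!scalemxAr -scalemxAl scalerA -rmorphM /= [L ^+ N.+1]exprSr -mulmxE mulmxA.
      by congr (_%:C *: _); rewrite exprS mulrA.
    rewrite cnormZ ger0_norm; first by rewrite /m; ring.
    by rewrite divr_ge0// exprn_ge0// subr_ge0 ltW.
  apply: ler_wpM2r => //; apply: ler_wpM2l => //.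
  apply: le_trans (cnorm_mul _ _) _; apply: ler_wpM2r; first exact: cnorm_ge0.
  by apply: ler_wpM2l => //; exact: cnorm_mul.
have SB : `|Re ((M *m (S N.+1 *m z a)) i j) - Re ((M *m (B *m z a)) i j)| <=
    n%:R * cnorm M * (n%:R * cnorm (B - S N.+1) * cnorm (z a)).
  rewrite -normrN opprB -ReN -ReD.
  have -> : (M *m (B *m z a)) i j - (M *m (S N.+1 *m z a)) i j =
      (M *m ((B - S N.+1) *m z a)) i j by rewrite mulmxBl mulmxBr !mxE.
  apply: le_trans (Re_le_cnorm _ _ _) _; apply: le_trans (cnorm_mul _ _) _.
  by apply: ler_wpM2l; [rewrite mulr_ge0 ?cnorm_ge0 | exact: cnorm_mul].
move=> h1.
have h2 : n%:R * (n%:R * (n%:R * cnorm M * cnorm (t N)) * cnorm ((b - a)%:C *: L)) * V c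
   <= n%:R * (n%:R * (n%:R * cnorm M) * cnorm ((b - a)%:C *: L)) * V c *
     (2%:R * (e / (K1 + 1))).
  rewrite (_ : _ * V c = n%:R * (n%:R * (n%:R * cnorm M) *
    cnorm ((b - a)%:C *: L)) * V c * cnorm (t N)); last by ring.
  by apply: ler_wpM2l tN; rewrite !mulr_ge0 ?cnorm_ge0.
have h3 : n%:R * cnorm M * (n%:R * cnorm (B - S N.+1) * cnorm (z a)) <=
   n%:R * cnorm M * (n%:R * cnorm (z a)) * (e / (K1 + 1)).
  rewrite (_ : n%:R * cnorm M * (n%:R * _ * _) =
    n%:R * cnorm M * (n%:R * cnorm (z a)) * cnorm (B - S N.+1)); last by ring.
  by apply: ler_wpM2l (hN _ (leqnSn N)); rewrite !mulr_ge0 ?cnorm_ge0.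
have h4 : K1 * (e / (K1 + 1)) <= e by apply: ler_mulDl1 => //; exact: ltW.
have h5 := ler_normD (phi M i j b - Re ((M *m (S N.+1 *m z a)) i j))
  (Re ((M *m (S N.+1 *m z a)) i j) - Re ((M *m (B *m z a)) i j)).
rewrite addrA subrK in h5.
apply: le_trans h5 _; apply: le_trans h4; rewrite mulrDl; apply: lerD.
  apply: le_trans h1 _; apply: le_trans mE _; apply: le_trans h2 _.
  by rewrite le_eqVlt; apply/orP; left; apply/eqP; ring.
exact: le_trans SB h3.
Qed.

End exponential_flow.

(** * Averages along the clock *)

Section clock_integrals.
Context {R : realType} (T : timeScale R).
Local Notation s := (ts_clock T).
Local Notation mu := (@lebesgue_measure R).

Lemma gaps_disjoint (t t' u : R) : ts_set T t -> ts_set T t' ->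
  s t <= u -> u < s (sigma T t) -> s t' <= u -> u < s (sigma T t') -> t = t'.
Proof.
move=> Tt Tt' h1 h2 h3 h4; case: (ltgtP t t') => // tt'.
  have h := clock_le T (ts_ge0 (sigma_in T t)) (sigma_le Tt' tt'); lra.
have h := clock_le T (ts_ge0 (sigma_in T t')) (sigma_le Tt tt'); lra.
Qed.

(* The clock images of the gaps are countably many disjoint intervals, and the
   rest of [s a, s b[ consists of images of right-dense points. *)
Lemma clock_integral_ge0 (k : R -> R) (a b : R) : ts_set T a -> ts_set T b -> a <= b ->
  mu.-integrable `[s a, s b[ (EFin \o k) ->
  (forall t, ts_set T t -> a <= t -> t < b -> sigma T t = t -> 0 <= k (s t)) ->
  (forall t, ts_set T t -> a <= t -> t < b -> t < sigma T t ->
    0 <= \int[mu]_(u in `[s t, s (sigma T t)[) k u) ->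
  0 <= \int[mu]_(u in `[s a, s b[) k u.
Proof.
move=> Ta Tb ab ik kd kg; have a0 := ts_ge0 Ta.
(* A rational number inside each gap numbers the gaps; their clock images form a sequence [F n],
   empty when no gap has the number [n]. *)
have /choice[q hq] : forall t, exists q : rat, t < sigma T t -> ratr q \in `]t, (sigma T t)[.
  move=> t; have [ts|] := pselect (t < sigma T t); last by exists 0.
  by have [q ?] := rat_in_itvoo ts; exists q.
pose P t n := [/\ ts_set T t, a <= t, t < b, t < sigma T t & pickle (q t) = n].
pose F n := [set u | exists t, P t n /\ s t <= u < s (sigma T t)].
have Puniq n t t' : P t n -> P t' n -> t = t'.
  move=> [Tt _ _ ts tn] [Tt' _ _ ts' t'n].
  have e : q t = q t' by apply: (pcan_inj pickleK); rewrite tn.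
  have := hq t ts; have := hq t' ts'; rewrite e !in_itv /= => /andP[x1 x2] /andP[x3 x4].
  case: (ltgtP t t') => // tt'; first by have := sigma_le Tt' tt'; lra.
  by have := sigma_le Tt tt'; lra.
have FE n t : P t n -> F n = `[s t, s (sigma T t)[%classic.
  move=> Pt; apply/seteqP; split => u /=.
    by move=> [t' [Pt' ut']]; rewrite in_itv /= (Puniq _ _ _ Pt Pt').
  by rewrite in_itv => ut; exists t.
have F0 n : ~ (exists t, P t n) -> F n = set0.
  by move=> h; rewrite -subset0 => u /= [t [Pt _]]; apply: h; exists t.
have mF n : measurable (F n : set (measurableTypeR R)).
  have [[t Pt]|/F0->//] := pselect (exists t, P t n).
  by rewrite (FE _ _ Pt).
have tF : trivIset setT F.
  move=> i j _ _ [u [[t [[Tt at_ tb ts ti] /andP[h1 h2]]] [t' [[Tt' at' tb' ts' tj] /andP[h3 h4]]]]].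
  by rewrite -ti -tj (gaps_disjoint Tt Tt' h1 h2 h3 h4).
pose J := \bigcup_n F n.
have mJ : measurable (J : set (measurableTypeR R)) by exact: bigcupT_measurable.
pose D : set (measurableTypeR R) := `[s a, s b[%classic.
have mD : measurable D by exact: measurable_itv.
have JD : J `<=` D.
  move=> u [n _ [t [[Tt at_ tb ts ti] /andP[h1 h2]]]]; rewrite /D /= in_itv /=.
  have := clock_le T a0 at_; have := clock_le T (ts_ge0 (sigma_in T t)) (sigma_le Tb tb).
  by move=> x1 x2; apply/andP; split; lra.
have iJ : mu.-integrable J (EFin \o k) by apply: integrableS ik.
rewrite -/D -(setDUK JD) Rintegral_setU//.
- apply: addr_ge0.
    rewrite /Rintegral integral_bigcup//; apply: fine_ge0; apply: nneseries_ge0 => n _ _.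
    have [[t Pt]|/F0->] := pselect (exists t, P t n); last by rewrite integral_set0.
    have [Tt at_ tb ts _] := Pt; rewrite (FE _ _ Pt).
    have := kg t Tt at_ tb ts; rewrite /Rintegral -lee_fin fineK//.
    apply: integrable_fin_num => //; apply: integrableS iJ => //.
    by rewrite -(FE _ _ Pt); exact: bigcup_sup.
  (* Off the images of the gaps, a clock value comes from a right-dense point of [T]: any other time
     lies in a gap or is its left end, and both belong to [F n]. *)
  apply: Rintegral_ge0 => u [+ nJ]; rewrite /D /= in_itv /= => /andP[au ub].
  have [|r /andP[ar rb] sr] := @clock_surj _ T a b u a0 ab; first by rewrite au ltW.
  have r0 := le_trans a0 ar.
  have rltb : r < b by rewrite lt_neqAle rb andbT; apply/eqP => e; move: ub; rewrite -sr e ltxx.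
  have [Tr|nTr] := pselect (ts_set T r).
    rewrite -sr; apply: kd => //; apply/le_anti; rewrite sigma_ge andbT leNgt; apply/negP => rs.
    apply: nJ; exists (pickle (q r)) => //; exists r; split => //.
    by rewrite -sr lexx /=; exact: clock_lt.
  have /andP[fr rs] := ts_floor_notin r0 nTr.
  exfalso; apply: nJ; exists (pickle (q (ts_floor T r))) => //; exists (ts_floor T r); split.
    split => //; [exact: ts_floor_in | exact: ts_floor_ub | exact: lt_trans rltb
      | exact: lt_trans rs].
  by rewrite -sr clock_lt// (clock_le T (ts_ge0 (ts_floor_in T r0)) (ltW fr)).
- exact: measurableD.
- by rewrite setDUK.
- by apply/disj_setPS => u [Ju [_]].
Qed.

(** A mean value inequality, from the nonnegativity of the integrals of [e + v - g] and [e - v + g],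
    which are [d = 1] and [d = -1] below. Over a gap only the total increment of [Z] is controlled,
    since inside it [g] involves the logarithm. *)
Lemma clock_mean (g Z : R -> R) (v e a b : R) : ts_set T a -> ts_set T b -> a <= b ->
  (forall N, mu.-integrable `[0, N] (EFin \o g)) ->
  (forall x y, 0 <= x -> x <= y -> Z y = Z x + \int[mu]_(u in `[x, y]) g u) ->
  (forall t, ts_set T t -> a <= t -> t < b -> sigma T t = t -> `|g (s t) - v| <= e) ->
  (forall t, ts_set T t -> a <= t -> t < b -> t < sigma T t ->
    `|Z (s (sigma T t)) - Z (s t) - ln (1 + graininess T t) * v| <=
       e * ln (1 + graininess T t)) ->
  `|Z (s b) - Z (s a) - (s b - s a) * v| <= e * (s b - s a).
Proof.
move=> Ta Tb ab ig Zg gd gg; have a0 := ts_ge0 Ta.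
have igxy x y : 0 <= x -> mu.-integrable `[x, y[ (EFin \o g).
  move=> x0; apply: integrableS (ig y) => //; apply: subset_itv; rewrite ?bnd_simp//.
have ic x y (c : R) : mu.-integrable `[x, y[ (EFin \o cst c).
  by apply: measurable_bounded_integrable => //; [exact: lebesgue_itv_lty | exact: bounded_cst].
have ih c d x y : 0 <= x -> mu.-integrable `[x, y[ (EFin \o (fun u => c + d * g u)).
  move=> x0; have mD : measurable (`[x, y[%classic : set (measurableTypeR R)) by [].
  exact: (integrableD mD (ic x y c) (integrable_scale d mD (igxy x y x0))).
have eh c d x y : 0 <= x -> x <= y ->
    \int[mu]_(u in `[x, y[) (c + d * g u) = c * (y - x) + d * (Z y - Z x).
  move=> x0 xy; have mD : measurable (`[x, y[%classic : set (measurableTypeR R)) by [].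
  rewrite (RintegralD mD (ic x y c) (integrable_scale d mD (igxy x y x0))).
  rewrite Rintegral_cst// fine_lebesgue_itv// RintegralZl//; last exact: igxy.
  by rewrite (Zg x y)// Rintegral_itv_bndo_bndc ?[Z x + _]addrC ?addrK//; exact: igxy.
have sa0 := clock_ge0 T a0; have sab := clock_le T a0 ab.
have key d : `|d| = 1 -> 0 <= \int[mu]_(u in `[s a, s b[) ((e + d * v) + (- d) * g u).
  move=> d1; have dle x : `|x| <= e -> 0 <= e - d * x.
    by move=> xe; rewrite subr_ge0 (le_trans (ler_norm _))// normrM d1 mul1r.
  apply: clock_integral_ge0 => //; first exact: ih.
    move=> t Tt at_ tb st; have := dle _ (gd t Tt at_ tb st); lra.
  move=> t Tt at_ tb st; have t0 := ts_ge0 Tt.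
  rewrite eh ?clock_ge0 ?clock_le ?(ltW st)// clock_sigma//.
  have l0 : 0 <= ln (1 + graininess T t) by apply: ln_ge0; have := graininess_ge0 T t; lra.
  have := gg t Tt at_ tb st; move=> /(ler_wpM2l (normr_ge0 d)).
  rewrite -normrM d1 mul1r => /(le_trans (ler_norm _)); lra.
have h1 := key 1 (normr1 _); have h2 := key (-1) ltac:(by rewrite normrN normr1).
rewrite !eh// in h1 h2.
by rewrite ler_norml; apply/andP; split; lra.
Qed.

End clock_integrals.

(** * Flows on a time scale *)

Section ts_lipschitz.
Context {R : realType} (T : timeScale R).
Implicit Types (a b t : R).

Definition ts_lipschitz {n m} (g : R -> 'M[R]_(n, m)) :=
  forall N, exists2 L, 0 <= L & forall a b, ts_set T a -> ts_set T b ->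
    a <= b -> b <= N -> `|g b - g a| <= L * (b - a).

Lemma ts_lipschitz_bounded n m (g : R -> 'M[R]_(n, m)) : ts_lipschitz g ->
  forall N, exists2 B, 0 <= B & forall t, ts_set T t -> t <= N -> `|g t| <= B.
Proof.
move=> lg N; have [L L0 hL] := lg N; exists (`|g 0| + L * `|N|).
  by rewrite addr_ge0// mulr_ge0.
move=> t Tt tN; rewrite -[g t](subrK (g 0)) addrC.
apply: le_trans (ler_normD _ _) _; rewrite lerD2l.
have t0 := ts_ge0 Tt; apply: le_trans (hL 0 t (ts_0 T) Tt t0 tN) _.
by apply: ler_wpM2l => //; rewrite subr0; apply: le_trans tN (ler_norm _).
Qed.

Lemma ts_lipschitz_mul n m p (g : R -> 'M[R]_(n, m)) (h : R -> 'M[R]_(m, p)) :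
  ts_lipschitz g -> ts_lipschitz h -> ts_lipschitz (fun t => g t *m h t).
Proof.
move=> lg lh N; have [L L0 hL] := lg N; have [M M0 hM] := lh N.
have [B B0 hB] := ts_lipschitz_bounded lg N; have [D D0 hD] := ts_lipschitz_bounded lh N.
exists (m%:R * L * D + m%:R * B * M); first by rewrite addr_ge0// !mulr_ge0.
move=> a b Ta Tb ab bN.
have -> : g b *m h b - g a *m h a = (g b - g a) *m h b + g a *m (h b - h a).
  by rewrite mulmxBl mulmxBr addrA subrK.
apply: le_trans (ler_normD _ _) _; rewrite mulrDl; apply: lerD.
  apply: le_trans (mx_norm_mul _ _) _; rewrite [leRHS]mulrAC; apply: ler_pM; rewrite ?mulr_ge0//.
    by rewrite -[leRHS]mulrA; apply: ler_wpM2l => //; exact: hL.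
  exact: hD.
apply: le_trans (mx_norm_mul _ _) _; rewrite -!mulrA; apply: ler_wpM2l => //.
by apply: ler_pM => //; [apply: hB => //; exact: le_trans bN | exact: hM].
Qed.

Lemma ts_lipschitz_addr n m (g : R -> 'M[R]_(n, m)) (M : 'M[R]_(n, m)) :
  ts_lipschitz g -> ts_lipschitz (fun t => g t + M).
Proof.
move=> lg N; have [L L0 hL] := lg N; exists L => // a b Ta Tb ab bN.
by rewrite [g a + M]addrC opprD addrA addrK; exact: hL.
Qed.

Lemma ts_lipschitz_invmx n (X : R -> 'M[R]_n) : ts_lipschitz X ->
  (forall t, ts_set T t -> X t \in unitmx) ->
  (forall N, exists2 B, 0 <= B & forall t, ts_set T t -> t <= N -> `|invmx (X t)| <= B) ->
  ts_lipschitz (fun t => invmx (X t)).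
Proof.
move=> lX Xu hB N; have [L L0 hL] := lX N; have [B B0 {}hB] := hB N.
exists (n%:R * (n%:R * B * L) * B); first by rewrite !mulr_ge0.
move=> a b Ta Tb ab bN.
have -> : invmx (X b) - invmx (X a) = - (invmx (X b) *m (X b - X a) *m invmx (X a)).
  rewrite mulmxBr mulmxBl mulVmx ?Xu// mul1mx -mulmxA mulmxV ?Xu// mulmx1.
  by rewrite opprB.
rewrite normrN; apply: le_trans (mx_norm_mul _ _) _.
rewrite [leRHS]mulrAC; apply: ler_pM; rewrite ?mulr_ge0//; last first.
  by apply: hB => //; exact: le_trans bN.
rewrite -[leRHS]mulrA; apply: ler_wpM2l => //; apply: le_trans (mx_norm_mul _ _) _.
rewrite -[leRHS]mulrA; apply: ler_pM; rewrite ?mulr_ge0//; last exact: hL.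
by apply: ler_wpM2l => //; exact: hB.
Qed.

Lemma ts_lipschitz_small n m (g : R -> 'M[R]_(n, m)) (N e : R) : 0 < e -> ts_lipschitz g ->
  exists2 d, 0 < d & forall a b, ts_set T a -> ts_set T b -> a <= b -> b <= N ->
    b < a + d -> `|g b - g a| <= e.
Proof.
move=> e0 lg; have [L L0 hL] := lg N.
exists (e / (L + 1)) => [|a b Ta Tb ab bN bd]; first by rewrite divr_gt0// ltr_wpDl.
apply: le_trans (hL a b Ta Tb ab bN) _; apply: ler_mulDl1_le => //; first exact: ltW.
by rewrite lerBlDl ltW.
Qed.

Lemma rd_continuous_right n m (A : R -> 'M[R]_(n, m)) (e t : R) : rd_continuous T A ->
  0 < e -> ts_set T t -> sigma T t = t ->
  exists2 d, 0 < d & forall u, ts_set T u -> t < u -> u < t + d -> `|A u - A t| <= e.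
Proof.
move=> [rd _] e0 Tt st.
have gt0 : graininess T t = 0 by rewrite /graininess st subrr.
have /cvgrPdist_le /(_ e e0) := rd t Tt gt0.
move=> /nbhs_ballP [d /= d0 hd]; exists d => // u Tu tu ud.
rewrite distrC; apply: hd => //=.
by rewrite /ball /= distrC gtr0_norm ?subr_gt0// ltrBlDl.
Qed.

End ts_lipschitz.

(** * Solutions of the homogeneous Delta-system *)

Section delta_flows.
Context {R : realType} (T : timeScale R) {n : nat} (A : R -> 'M[R]_n).
Implicit Types (t u : R).

(** Solutions of the homogeneous system in the form that [ts_nonincreasing] consumes: exact jumps, a
    right derivative at right-dense points, and a local Lipschitz bound in place of left
    derivatives. *)
Definition delta_flow {m} (X : R -> 'M[R]_(n, m)) :=
  [/\ forall t, ts_set T t -> X (sigma T t) = X t + graininess T t *: (A t *m X t),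
      ts_lipschitz T X
    & forall t e, ts_set T t -> sigma T t = t -> 0 < e ->
        exists2 d, 0 < d & forall u, ts_set T u -> t < u -> u < t + d ->
          `|X u - X t - (u - t) *: (A t *m X t)| <= e * (u - t)].

Lemma delta_flowB m (X Y : R -> 'M[R]_(n, m)) :
  delta_flow X -> delta_flow Y -> delta_flow (fun t => X t - Y t).
Proof.
move=> [X1 X2 X3] [Y1 Y2 Y3]; split.
- by move=> t Tt; rewrite X1// Y1// mulmxBr scalerBr opprD addrACA.
- move=> N; have [L L0 hL] := X2 N; have [M M0 hM] := Y2 N.
  exists (L + M); first exact: addr_ge0.
  move=> a b Ta Tb ab bN; rewrite opprD addrACA -opprD mulrDl.
  by apply: le_trans (ler_normB _ _) _; apply: lerD; [exact: hL | exact: hM].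
- move=> t e Tt st e0; have e2 : 0 < e / 2 by rewrite divr_gt0.
  have [d1 d10 h1] := X3 t _ Tt st e2; have [d2 d20 h2] := Y3 t _ Tt st e2.
  exists (Num.min d1 d2); first by rewrite lt_min d10.
  move=> u Tu tu; rewrite -ltrBlDl lt_min => /andP[u1 u2].
  have -> : X u - Y u - (X t - Y t) - (u - t) *: (A t *m (X t - Y t)) =
    (X u - X t - (u - t) *: (A t *m X t)) - (Y u - Y t - (u - t) *: (A t *m Y t)).
    rewrite mulmxBr scalerBr; apply/matrixP => i j; rewrite !mxE; ring.
  apply: le_trans (ler_normB _ _) _.
  have := h1 u Tu tu ltac:(lra); have := h2 u Tu tu ltac:(lra); lra.
Qed.

Lemma delta_flowMr m p (X : R -> 'M[R]_(n, m)) (M : 'M[R]_(m, p)) :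
  delta_flow X -> delta_flow (fun t => X t *m M).
Proof.
move=> [X1 X2 X3]; pose c := m%:R * `|M|; have c0 : 0 <= c by exact: mulr_ge0.
have mulM (N : 'M[R]_(n, m)) : `|N *m M| <= c * `|N|.
  by apply: le_trans (mx_norm_mul _ _) _; rewrite /c mulrAC.
split.
- by move=> t Tt; rewrite X1// mulmxDl -scalemxAl mulmxA.
- move=> N; have [L L0 hL] := X2 N; exists (c * L); first exact: mulr_ge0.
  move=> a b Ta Tb ab bN; rewrite -mulmxBl -mulrA; apply: le_trans (mulM _) _.
  by apply: ler_wpM2l => //; exact: hL.
- move=> t e Tt st e0; have e1 : 0 < e / (c + 1) by rewrite divr_gt0// ltr_wpDl.
  have [d d0 h] := X3 t _ Tt st e1; exists d => // u Tu tu ud.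
  rewrite mulmxA scalemxAl -!mulmxBl; apply: le_trans (mulM _) _.
  apply: le_trans (ler_wpM2l c0 (h u Tu tu ud)) _.
  rewrite mulrA; apply: ler_wpM2r; first by rewrite subr_ge0 ltW.
  by apply: ler_mulDl1 => //; exact: ltW.
Qed.

(** Gronwall's inequality: [|X t| exp (- K t) - e t] does not increase, where the drift [e t]
    absorbs the error of the right derivative and [e] tends to 0. The factor [n] comes with the
    maximum norm, which is submultiplicative only up to it. *)
Lemma delta_flow_growth m (X : R -> 'M[R]_(n, m)) (K : R) : 0 <= K ->
  (forall t, ts_set T t -> n%:R * `|A t| <= K) -> delta_flow X ->
  forall a b, ts_set T a -> ts_set T b -> a <= b ->
    `|X b| <= expR (K * (b - a)) * `|X a|.
Proof.
move=> K0 AK [X1 X2 X3] a b Ta Tb ab.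
have AX t : ts_set T t -> `|A t *m X t| <= K * `|X t|.
  move=> Tt; apply: le_trans (mx_norm_mul _ _) _; apply: ler_wpM2r => //; exact: AK.
suff h e : 0 < e -> `|X b| * expR (- K * b) - e * b <= `|X a| * expR (- K * a) - e * a.
  have h2 : `|X b| * expR (- K * b) <= `|X a| * expR (- K * a).
    apply/ler_addgt0Pr => e e0.
    have b0 : 0 < b + 1 by have := ts_ge0 Tb; lra.
    have := h _ (divr_gt0 e0 b0).
    have : e / (b + 1) * (b - a) <= e.
      rewrite mulrAC ler_pdivrMr// ler_wpM2l ?(ltW e0)//; have := ts_ge0 Ta; lra.
    lra.
  have : `|X b| * expR (- K * b) * expR (K * b) <= `|X a| * expR (- K * a) * expR (K * b).
    by apply: ler_wpM2r => //; exact: expR_ge0.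
  rewrite -!mulrA -!expRD.
  have -> : - K * b + K * b = 0 by ring.
  have -> : - K * a + K * b = K * (b - a) by ring.
  by rewrite expR0 mulr1 mulrC.
move=> e0; have [L L0 hL] := X2 b.
apply: (ts_nonincreasing (H := fun t => `|X t| * expR (- K * t) - e * t) Ta Tb ab L0).
- move=> t Tt at_ tb ts; have mt := graininess_ge0 T t.
  have h1 : `|X (sigma T t)| <= expR (K * graininess T t) * `|X t|.
    rewrite X1//; apply: le_trans (ler_normD _ _) _; rewrite mx_normZ ger0_norm//.
    have h2 := ler_wpM2l mt (AX t Tt).
    have := ler_wpM2r (normr_ge0 (X t)) (expR_ge1Dx (K * graininess T t)); lra.
  have h2 := ler_wpM2r (expR_ge0 (- K * sigma T t)) h1.
  have : expR (K * graininess T t) * `|X t| * expR (- K * sigma T t) = `|X t| * expR (- K * t).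
    by rewrite mulrC mulrA -expRD mulrC; congr (_ * expR _); rewrite /graininess; ring.
  have := ler_wpM2l (ltW e0) (ltW ts); lra.
- move=> t Tt at_ tb st; have [d d0 hd] := X3 t e Tt st e0.
  exists d => // u Tu tu ud ub.
  have ut0 : 0 <= u - t by lra.
  have h1 : `|X u| <= expR (K * (u - t)) * `|X t| + e * (u - t).
    have -> : X u = (X u - X t - (u - t) *: (A t *m X t)) + (X t + (u - t) *: (A t *m X t)).
      by apply/matrixP => i j; rewrite !mxE; ring.
    apply: le_trans (ler_normD _ _) _.
    have h2 := ler_normD (X t) ((u - t) *: (A t *m X t)).
    rewrite mx_normZ ger0_norm// in h2.
    have h3 := ler_wpM2l ut0 (AX t Tt).
    have := ler_wpM2r (normr_ge0 (X t)) (expR_ge1Dx (K * (u - t))).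
    have := hd u Tu tu ud; lra.
  have h2 := ler_wpM2r (expR_ge0 (- K * u)) h1.
  have : expR (K * (u - t)) * `|X t| * expR (- K * u) = `|X t| * expR (- K * t).
    by rewrite mulrC mulrA -expRD mulrC; congr (_ * expR _); ring.
  have : e * (u - t) * expR (- K * u) <= e * (u - t).
    rewrite ler_piMr ?mulr_ge0 ?(ltW e0)// expR_le1 mulNr oppr_le0 mulr_ge0//.
    exact: ts_ge0 Tu.
  lra.
- move=> u v Tu Tv au uv vb.
  have h1 : `|X v| * expR (- K * v) <= `|X v| * expR (- K * u).
    by apply: ler_wpM2l => //; rewrite ler_expR; have := ler_wpM2l K0 uv; lra.
  have h2 : (`|X v| - `|X u|) * expR (- K * u) <= L * (v - u).
    have h3 : `|X v| - `|X u| <= L * (v - u).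
      by apply: le_trans (hL u v Tu Tv uv vb); exact: lerB_dist.
    have u0 : 0 <= K * u by rewrite mulr_ge0//; exact: ts_ge0 Tu.
    apply: (@le_trans _ _ (L * (v - u) * expR (- K * u))).
      by apply: ler_wpM2r => //; exact: expR_ge0.
    rewrite ler_piMr ?mulr_ge0 ?subr_ge0// expR_le1; lra.
  have := ler_wpM2l (ltW e0) uv; lra.
Qed.

Lemma delta_flow_unique m (X Y : R -> 'M[R]_(n, m)) (K : R) :
  (forall t, ts_set T t -> `|A t| <= K) -> delta_flow X -> delta_flow Y ->
  X 0 = Y 0 -> forall t, ts_set T t -> X t = Y t.
Proof.
move=> AK dX dY e0 t Tt; have T0 := ts_0 T.
have K0 : 0 <= K by apply: le_trans (AK 0 T0).
have := delta_flow_growth (mulr_ge0 (ler0n R n) K0) _ (delta_flowB dX dY) T0 Tt (ts_ge0 Tt).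
rewrite e0 subrr normr0 mulr0 normr_le0 subr_eq0 => h; apply/eqP/h => u Tu.
by apply: ler_wpM2l => //; exact: AK.
Qed.

End delta_flows.

(** * From the differential system to the Delta-system *)

Section flow_of_clock.
Context {R : realType} (T : timeScale R) {n : nat} (A : R -> 'M[R]_n).
Local Notation s := (ts_clock T).
Local Notation mu := (@lebesgue_measure R).

Lemma mx_bounded_on_segment m p (Z : R -> 'M[R]_(m, p)) (a b : R) :
  (forall i j, {within `[a, b], continuous (fun x => Z x i j)}) ->
  exists2 c, 0 <= c & forall x, a <= x -> x <= b -> `|Z x| <= c.
Proof.
move=> cZ; have [ab|ba] := leP a b; last first.
  by exists 0 => // x ax xb; exfalso; lra.
pose V x := \sum_i \sum_j `|Z x i j|.
have cV : {within `[a, b], continuous V}.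
  apply: continuous_within_sum => i; apply: continuous_within_sum => j x.
  by apply: cvg_norm; exact: cZ.
have [c _ Vc] := EVT_max ab cV.
exists (V c) => [|x ax xb]; first by do 2 apply: sumr_ge0 => ? _.
apply: le_trans (Vc x _); last by rewrite in_itv /= ax.
apply: mx_norm_le => [|i j]; first by do 2 apply: sumr_ge0 => ? _.
rewrite /V (bigD1 i)//= (bigD1 j)//= -addrA lerDl addr_ge0//.
  by apply: sumr_ge0.
by do 2 apply: sumr_ge0 => ? _.
Qed.

Lemma ln1D_bounds (m : R) : 0 <= m -> 0 <= m - ln (1 + m) <= m * ln (1 + m).
Proof.
move=> m0; have h2 := ln1D_ge m0.
rewrite subr_ge0 le_ln1Dx ?(lt_le_trans (ltrN10 R))//=.
have h3 : (1 + m) * (m / (1 + m)) = m by field; lra.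
have := ler_wpM2l (addr_ge0 ler01 m0) h2; rewrite h3; lra.
Qed.

(** A gap of length [m] adds [m y] to the solution while the clock advances by [ln (1 + m)]. The
    discrepancy [m - ln (1 + m)] is at most [m ln (1 + m)], of second order, and is absorbed because
    [m] is small. *)
Lemma scattered_mean (m y v e : R) : 0 <= m -> `|y - v| <= e -> (`|v| + e) * m <= e ->
  `|m * y - ln (1 + m) * v| <= 2 * e * ln (1 + m).
Proof.
move=> m0 yv h; have /andP[l2 l1] := ln1D_bounds m0.
have l0 : 0 <= ln (1 + m) by apply: ln_ge0; lra.
have -> : m * y - ln (1 + m) * v = (m - ln (1 + m)) * y + ln (1 + m) * (y - v) by ring.
apply: le_trans (ler_normD _ _) _; rewrite !normrM (ger0_norm l0) (ger0_norm l2).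
have yw : `|y| <= `|v| + e by have := ler_normD (y - v) v; rewrite subrK; lra.
have h4 : (m - ln (1 + m)) * `|y| <= m * ln (1 + m) * (`|v| + e) by apply: ler_pM.
have h5 : ln (1 + m) * `|y - v| <= ln (1 + m) * e by apply: ler_wpM2l.
have := ler_wpM2r l0 h; lra.
Qed.

(** Just after a right-dense point no gap is longer than the elapsed time [a], so the clock
    increment [S] lies between [a / (1 + a)] and [a]: the clock has right derivative 1 there. *)
Lemma clock_increment_quadratic (a S : R) : 0 <= a -> a / (1 + a) <= S <= a ->
  `|a - S| <= a * a.
Proof.
move=> a0 /andP[h1 h2]; rewrite ger0_norm ?subr_ge0//.
have a1 : 0 < 1 + a by lra.
have h3 : a * (1 - a) <= a / (1 + a).
  rewrite ler_pdivlMr//; have : 0 <= a * a * a by rewrite !mulr_ge0.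
  lra.
lra.
Qed.

(** Stated for real matrices indexed by clock time, so as to apply to the real and to the imaginary
    part of a complex Cauchy matrix; both solve the Delta-system because [A] is real. *)
Lemma delta_flow_of_clock m (X G : R -> 'M[R]_(n, m)) (K : R) :
  (forall t, ts_set T t -> `|A t| <= K) -> rd_continuous T A ->
  (forall i j N, mu.-integrable `[0, N] (EFin \o (fun u => G u i j))) ->
  (forall i j x y, 0 <= x -> x <= y ->
     X y i j = X x i j + \int[mu]_(u in `[x, y]) G u i j) ->
  (forall t, ts_set T t -> G (s t) = A t *m X (s t)) ->
  (forall t, ts_set T t -> t < sigma T t ->
     X (s (sigma T t)) = X (s t) + graininess T t *: (A t *m X (s t))) ->
  delta_flow T A (fun t => X (s t)).
Proof.
move=> AK rdA iG XG GA Xs.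
have K0 : 0 <= K by apply: le_trans (AK 0 (ts_0 T)).
have cX i j N : {within `[0, N], continuous (fun x => X x i j)}.
  by apply: primitive_continuous (iG i j N) _ => x x0 _; exact: XG.
have sle t : ts_set T t -> 0 <= s t <= t.
  move=> Tt; rewrite clock_ge0 ?(ts_ge0 Tt)//=.
  by have := clock_lip T (lexx 0) (ts_ge0 Tt); rewrite clock0 !subr0 => /andP[].
have mean (a b v e : R) i j : ts_set T a -> ts_set T b -> a <= b -> 0 <= e ->
  (forall t, ts_set T t -> a <= t -> t < b -> graininess T t <= b - a ->
     `|graininess T t * (A t *m X (s t)) i j - ln (1 + graininess T t) * v| <=
       e * ln (1 + graininess T t)) ->
  (forall t, ts_set T t -> a <= t -> t < b -> sigma T t = t ->
     `|(A t *m X (s t)) i j - v| <= e) ->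
  `|X (s b) i j - X (s a) i j - (s b - s a) * v| <= e * (b - a).
  move=> Ta Tb ab e0 hs hd.
  apply: (@le_trans _ _ (e * (s b - s a))); last first.
    by apply: ler_wpM2l => //; have /andP[] := clock_lip T (ts_ge0 Ta) ab.
  apply: (@clock_mean _ T (fun u => G u i j) (fun u => X u i j)) => //.
  - exact: XG.
  - by move=> t Tt at_ tb st; rewrite GA//; exact: hd.
  - move=> t Tt at_ tb st; rewrite Xs// addmxE scalemxE.
    rewrite [X in `|X - _|]addrAC subrr add0r; apply: hs => //.
    by rewrite /graininess lerB// sigma_le.
(* The factor 2 compares time and clock over gaps of length at most 1, where
   [m / 2 <= ln (1 + m)]. *)
have lip1 (M a b : R) : ts_set T a -> ts_set T b -> a <= b -> b - a <= 1 -> 0 <= M ->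
  (forall t, ts_set T t -> t <= b -> `|X (s t)| <= M) ->
  `|X (s b) - X (s a)| <= 2 * (n%:R * K * M) * (b - a).
  move=> Ta Tb ab b1 M0 hM.
  have e0 : 0 <= n%:R * K * M by rewrite !mulr_ge0.
  have e20 : 0 <= 2 * (n%:R * K * M) by rewrite mulr_ge0.
  have AX t i j : ts_set T t -> t <= b -> `|(A t *m X (s t)) i j| <= n%:R * K * M.
    move=> Tt tb; apply: le_trans (mx_norm_entry _ _ _) _.
    apply: le_trans (mx_norm_mul _ _) _; apply: ler_pM; rewrite ?mulr_ge0 ?hM//.
    by apply: ler_wpM2l => //; exact: AK.
  apply: mx_norm_le => [|i j]; first by rewrite mulr_ge0// subr_ge0.
  have := mean a b 0 (2 * (n%:R * K * M)) i j Ta Tb ab e20.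
  rewrite mulr0 subr0 addmxE oppmxE; apply=> [t Tt at_ tb mb|t Tt at_ tb st]; last first.
    by rewrite subr0; apply: le_trans (AX t i j Tt (ltW tb)) _; rewrite ler_peMl// ler1n.
  have m0 := graininess_ge0 T t; have m1 := le_trans mb b1.
  rewrite mulr0 subr0 normrM ger0_norm// [leRHS]mulrAC; apply: ler_pM => //.
    have : graininess T t / 2 <= ln (1 + graininess T t).
      apply: le_trans (ln1D_ge m0); apply: ler_wpM2l => //.
      by rewrite lef_pV2 ?posrE ?ltr_pwDl// lerD2l.
    by rewrite ler_pdivrMr// mulrC.
  exact: AX (ltW tb).
have bdX N : exists2 M, 0 <= M & forall t, ts_set T t -> t <= N -> `|X (s t)| <= M.
  have [M M0 hM] := @mx_bounded_on_segment _ _ X 0 N (fun i j => cX i j N).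
  exists M => // t Tt tN; have /andP[s0 st] := sle t Tt.
  by apply: hM => //; exact: le_trans tN.
have lip : ts_lipschitz T (fun t => X (s t)).
  move=> N; have [M M0 hM] := bdX N.
  have e0 : 0 <= 2 * (n%:R * K * M) by rewrite !mulr_ge0.
  have M20 : 0 <= 2 * M by rewrite mulr_ge0.
  exists (2 * (n%:R * K * M) + 2 * M); first exact: addr_ge0.
  move=> a b Ta Tb ab bN; have ba0 : 0 <= b - a by rewrite subr_ge0.
  have hMb t : ts_set T t -> t <= b -> `|X (s t)| <= M.
    by move=> Tt tb; apply: hM => //; exact: le_trans bN.
  have [b1|b1] := leP (b - a) 1.
    by apply: le_trans (lip1 M a b Ta Tb ab b1 M0 hMb) _; rewrite ler_wpM2r// lerDl.
  (* For points further apart than 1 the bound on [X] itself is enough. *)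
  apply: (@le_trans _ _ (2 * M)); last first.
    by apply: le_trans (ler_peMr M20 (ltW b1)) _; rewrite ler_wpM2r// lerDr.
  apply: le_trans (ler_normB _ _) _; rewrite mulr_natl mulr2n.
  by apply: lerD; exact: hMb.
split; [|exact: lip|].
  move=> t Tt; have := sigma_ge T t; rewrite le_eqVlt => /predU1P[e|]; last exact: Xs.
  by rewrite /graininess -e subrr scale0r addr0.
(* Half of [e] pays for the deviation of [A X] from its value [W] at [t], the other half for
   replacing the clock increment by [u - t]. *)
move=> t e Tt st e0; pose N := t + 1.
have [M M0 hM] := bdX N.
move EW : (A t *m X (s t)) => W.
have e4 : 0 < e / 8 by rewrite divr_gt0.
have nM : 0 <= n%:R * M by rewrite mulr_ge0.
have nA : 0 <= n%:R * `|A t| by rewrite mulr_ge0.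
have w0 : 0 <= `|W| + e / 4 by rewrite addr_ge0// divr_ge0// ltW.
have dv p : 0 <= p -> 0 < e / 8 / (p + 1) by move=> p0; rewrite divr_gt0// ltr_wpDl.
have [d1 d10 hd1] := rd_continuous_right rdA (dv _ nM) Tt st.
have [d2 d20 hd2] := ts_lipschitz_small N (dv _ nA) lip.
exists (Num.min (Num.min d1 d2) (Num.min (e / 8 / (`|W| + e / 4 + 1)) 1)).
  by rewrite !lt_min d10 d20 dv// ltr01.
move=> u Tu tu; rewrite -ltrBlDl !lt_min => /andP[/andP[u1 u2] /andP[u3 u4]].
have ut0 : 0 <= u - t by rewrite subr_ge0 ltW.
have uN : u <= N by rewrite -lerBlDl ltW.
have uw : (`|W| + e / 4) * (u - t) <= e / 8 by apply: ler_mulDl1_le => //; exact: ltW.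
have near r i j : ts_set T r -> t <= r -> r < u ->
    `|(A r *m X (s r)) i j - W i j| <= e / 4.
  move=> Tr tr ru; have rt : r - t <= u - t by rewrite lerB// ltW.
  have rN : r <= N by apply: le_trans uN; exact: ltW.
  have hA : `|A r - A t| <= e / 8 / (n%:R * M + 1).
    move: tr; rewrite le_eqVlt => /predU1P[<-|tr]; first by rewrite subrr normr0 ltW// dv.
    by apply: hd1 => //; rewrite -ltrBlDl; exact: le_lt_trans u1.
  rewrite -EW -oppmxE -addmxE.
  have -> : A r *m X (s r) - A t *m X (s t) =
      (A r - A t) *m X (s r) + A t *m (X (s r) - X (s t)).
    by rewrite mulmxBl mulmxBr addrA subrK.
  apply: le_trans (mx_norm_entry _ _ _) _; apply: le_trans (ler_normD _ _) _.
  have -> : e / 4 = e / 8 + e / 8 by field.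
  apply: lerD; apply: le_trans (mx_norm_mul _ _) _.
    apply: (@le_trans _ _ (n%:R * M * `|A r - A t|)).
      by rewrite mulrAC ler_wpM2r// ler_wpM2l// hM.
    by apply: ler_mulDl1_le => //; exact: ltW.
  apply: ler_mulDl1_le => //; first exact: ltW.
  by apply: hd2 => //; rewrite -ltrBlDl; exact: le_lt_trans u2.
have su : (u - t) / (1 + (u - t)) <= s u - s t <= u - t.
  apply: clock_bounds (ts_ge0 Tt) (ltW tu) _ => r Tr; rewrite ts_floor_id// => tr ru.
  by rewrite /graininess lerB// sigma_le.
have e20 : 0 <= e / 2 by rewrite divr_ge0// ltW.
apply: mx_norm_le => [|i j]; first by rewrite mulr_ge0// ltW.
have Ww : `|W i j| <= `|W| by exact: mx_norm_entry.
have h1 : `|X (s u) i j - X (s t) i j - (s u - s t) * W i j| <= e / 2 * (u - t).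
  apply: mean => // [|r Tr tr ru mr|r Tr tr ru _]; first exact: ltW.
    have -> : e / 2 = 2 * (e / 4) by field.
    apply: scattered_mean; [exact: graininess_ge0 | exact: near |].
    apply: (@le_trans _ _ (e / 8)); last by rewrite ler_wpM2l ?(ltW e0)// lef_pV2 ?posrE// ler_nat.
    apply: le_trans uw; apply: ler_pM => //; [|exact: graininess_ge0|by rewrite lerD2r].
    by rewrite addr_ge0// divr_ge0// ltW.
  by apply: le_trans (near r i j Tr tr ru) _; rewrite ler_wpM2l ?(ltW e0)// lef_pV2 ?posrE// ler_nat.
have h2 := clock_increment_quadratic ut0 su.
have h3 : `|(u - t - (s u - s t)) * W i j| <= e / 2 * (u - t).
  rewrite normrM; apply: le_trans (ler_pM (normr_ge0 _) (normr_ge0 _) h2 Ww) _.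
  rewrite mulrAC; apply: ler_wpM2r => //; rewrite mulrC.
  apply: (@le_trans _ _ (e / 8)); last by rewrite ler_wpM2l ?(ltW e0)// lef_pV2 ?posrE// ler_nat.
  by apply: le_trans uw; rewrite ler_wpM2r// lerDl divr_ge0// ltW.
rewrite !addmxE !oppmxE scalemxE.
have -> : X (s u) i j - X (s t) i j - (u - t) * W i j =
  (X (s u) i j - X (s t) i j - (s u - s t) * W i j) - (u - t - (s u - s t)) * W i j by ring.
have -> : e * (u - t) = e / 2 * (u - t) + e / 2 * (u - t) by field.
by apply: le_trans (ler_normB _ _) _; exact: lerD.
Qed.

End flow_of_clock.

(** * The transition matrix *)

Section transition_matrix.
Context {R : realType} {n : nat}.
Local Notation C := R[i].
Local Notation Re := (@complex.Re R).
Local Notation Im := (@complex.Im R).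
Local Notation mu := (@lebesgue_measure R).

Lemma oriented_integralE (g : R -> R) (x y : R) :
  (forall N, mu.-integrable `[0, N] (EFin \o g)) -> 0 <= x -> 0 <= y ->
  oriented_integral x y g =
    \int[mu]_(u in `[0, y]) g u - \int[mu]_(u in `[0, x]) g u.
Proof.
move=> ig x0 y0; rewrite /oriented_integral; case: leP => xy.
  by rewrite (Rintegral_itv_diff x0 xy).
by rewrite -(Rintegral_itv_diff y0 (ltW xy))// opprB.
Qed.

Lemma cplx_mx_ReIm m p (M N : 'M[C]_(m, p)) :
  map_mx Re M = map_mx Re N -> map_mx Im M = map_mx Im N -> M = N.
Proof.
move=> /matrixP eR /matrixP eI; apply/matrixP => i j; apply/eqP.
by have := eR i j; have := eI i j; rewrite !mxE eq_complex => -> ->; rewrite !eqxx.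
Qed.

Lemma map_Re_cplxM m p q (B : 'M[R]_(m, p)) (M : 'M[C]_(p, q)) :
  map_mx Re (cplx_mx B *m M) = B *m map_mx Re M.
Proof.
apply/matrixP => i j; rewrite !mxE Re_sum; apply: eq_bigr => k _.
by rewrite !mxE ReZ.
Qed.

Lemma ImM_real (a : R) (x : C) : Im (a%:C * x) = a * Im x.
Proof. by case: x => [y z]; rewrite /= mul0r addr0. Qed.

Lemma Im_sum (I : Type) (l : seq I) (F : I -> C) :
  Im (\sum_(i <- l) F i) = \sum_(i <- l) Im (F i).
Proof. by apply: (big_morph Im) => // [[? ?] [? ?]]. Qed.

Lemma map_Im_cplxM m p q (B : 'M[R]_(m, p)) (M : 'M[C]_(p, q)) :
  map_mx Im (cplx_mx B *m M) = B *m map_mx Im M.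
Proof.
apply/matrixP => i j; rewrite !mxE Im_sum; apply: eq_bigr => k _.
by rewrite !mxE ImM_real.
Qed.

Lemma map_Re_cplx m p (B : 'M[R]_(m, p)) : map_mx Re (cplx_mx B) = B.
Proof. by apply/matrixP => i j; rewrite !mxE. Qed.

Lemma map_Im_cplx m p (B : 'M[R]_(m, p)) : map_mx Im (cplx_mx B) = 0.
Proof. by apply/matrixP => i j; rewrite !mxE. Qed.

Lemma cplx_mxM m p q (B : 'M[R]_(m, p)) (D : 'M[R]_(p, q)) :
  cplx_mx (B *m D) = cplx_mx B *m cplx_mx D.
Proof. exact: map_mxM. Qed.

Lemma cplx_mx1 m : cplx_mx 1%:M = 1%:M :> 'M[C]_m.
Proof. exact: map_mx1. Qed.

Lemma cplx_mx_inj m p : injective (@cplx_mx R m p).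
Proof. by move=> B D /(congr1 (map_mx Re)); rewrite !map_Re_cplx. Qed.

Variables (T : timeScale R) (mlog : 'M[C]_n -> 'M[C]_n) (A : R -> 'M[R]_n) (K : R).
Variables (A' : R -> 'M[C]_n) (Psi : R -> R -> 'M[C]_n).
Hypothesis mlogK : forall B, B \in unitmx -> is_expmx (mlog B) B.
Hypothesis AK : forall t, ts_set T t -> `|A t| <= K.
Hypothesis rdA : rd_continuous T A.
Hypothesis regA : forall t, ts_set T t -> 1%:M + graininess T t *: A t \in unitmx.
Hypothesis odeA : corresponding_ode T mlog A A'.
Hypothesis cauchyA : cauchy_matrix A' Psi.
Local Notation s := (ts_clock T).

Lemma cauchy_matrix_diag tau : 0 <= tau -> Psi tau tau = 1%:M.
Proof.
move=> t0; have [_ /(_ _ t0)[_ /(_ _ t0) ->]] := cauchyA.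
rewrite -[RHS]addr0; congr (_ + _); apply/matrixP => i j; rewrite !mxE.
by rewrite /cintegral /oriented_integral lexx set_itv1 !Rintegral_set1.
Qed.

Lemma cauchy_matrix_increment tau x y i j : 0 <= tau -> 0 <= x -> x <= y ->
  Psi y tau i j = Psi x tau i j + cintegral x y (fun u => (A' u *m Psi u tau) i j).
Proof.
move=> t0 x0 xy; have [_ /(_ _ t0)[iP eP]] := cauchyA.
have y0 := le_trans x0 xy.
rewrite (eP y y0) (eP x x0) !mxE -addrA; congr (_ + _).
rewrite /cintegral !oriented_integralE//; do ?by move=> N; have [] := iP N i j.
by apply/eqP; rewrite eq_complex /=; apply/andP; split; apply/eqP; ring.
Qed.

(** The clock length [ln (1 + mu)] of the gap cancels the denominator of the coefficient, so that
    the exponent is exactly the logarithm of [E + mu A]. *)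
Lemma cauchy_matrix_gap tau t : 0 <= tau -> ts_set T t -> t < sigma T t ->
  Psi (s (sigma T t)) tau = cplx_mx (1%:M + graininess T t *: A t) *m Psi (s t) tau.
Proof.
move=> t0 Tt ts; have [_ /(_ _ t0)[iP _]] := cauchyA; have [_ odeA2] := odeA.
have tt0 := ts_ge0 Tt; have st0 := clock_ge0 T tt0.
have m0 : 0 < graininess T t by rewrite subr_gt0.
have sst : s t < s (sigma T t) by exact: clock_lt.
have l0 : 0 < ln (1 + graininess T t) by apply: ln_gt0; lra.
pose L := (ln (1 + graininess T t))^-1%:C *:
   mlog (cplx_mx (1%:M + graininess T t *: A t)).
apply: (@exp_flow _ _ L _ (fun u => Psi u tau) (fun u => A' u *m Psi u tau)) => //.
- move=> u us us'.
  have [|r /andP[tr rs] sr] := @clock_surj _ T t (sigma T t) u tt0 (ltW ts).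
    by rewrite !ltW.
  have tr' : t < r.
    by rewrite lt_neqAle tr andbT; apply/eqP => e; move: us; rewrite -sr e ltxx.
  have rs' : r < sigma T t.
    by rewrite lt_neqAle rs andbT; apply/eqP => e; move: us'; rewrite -sr e ltxx.
  have fr : ts_floor T r = t by apply: ts_floor_gap => //; rewrite tr.
  have nTr : ~ ts_set T r by move=> Tr; have := sigma_le Tr tr'; lra.
  by have := odeA2 r (le_trans tt0 tr) nTr; rewrite sr fr => ->.
- move=> i j; have [i1 i2] := iP (s (sigma T t)) i j.
  by split; [apply: integrableS i1 | apply: integrableS i2] => //;
    apply: subset_itv; rewrite bnd_simp.
- by move=> x i j sx _; exact: cauchy_matrix_increment.
- rewrite clock_sigma// /L scalerA -rmorphM /= mulfV ?gt_eqF// scale1r.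
  by apply: mlogK; rewrite map_unitmx; exact: regA.
Qed.

Let flow_Re tau : 0 <= tau -> delta_flow T A (fun t => map_mx Re (Psi (s t) tau)).
Proof.
move=> t0; have [_ /(_ _ t0)[iP _]] := cauchyA; have [odeA1 _] := odeA.
apply: (@delta_flow_of_clock _ _ _ _ _ (fun u => map_mx Re (Psi u tau))
  (fun u => map_mx Re (A' u *m Psi u tau)) K AK rdA).
- move=> i j N; have [h _] := iP N i j.
  by under [X in EFin \o X]eq_fun do rewrite mxE.
- move=> i j x y x0 xy; rewrite !mxE (cauchy_matrix_increment _ _ t0 x0 xy) ReD.
  rewrite /cintegral /oriented_integral xy /=.
  by under [in RHS]eq_Rintegral do rewrite mxE.
- by move=> t Tt; rewrite odeA1// map_Re_cplxM.
- by move=> t Tt ts; rewrite cauchy_matrix_gap// map_Re_cplxM mulmxDl mul1mx -scalemxAl.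
Qed.

Let flow_Im tau : 0 <= tau -> delta_flow T A (fun t => map_mx Im (Psi (s t) tau)).
Proof.
move=> t0; have [_ /(_ _ t0)[iP _]] := cauchyA; have [odeA1 _] := odeA.
apply: (@delta_flow_of_clock _ _ _ _ _ (fun u => map_mx Im (Psi u tau))
  (fun u => map_mx Im (A' u *m Psi u tau)) K AK rdA).
- move=> i j N; have [_ h] := iP N i j.
  by under [X in EFin \o X]eq_fun do rewrite mxE.
- move=> i j x y x0 xy; rewrite !mxE (cauchy_matrix_increment _ _ t0 x0 xy).
  rewrite /cintegral /oriented_integral xy.
  under [in RHS]eq_Rintegral do rewrite mxE.
  by case: (Psi x tau i j).
- by move=> t Tt; rewrite odeA1// map_Im_cplxM.
- by move=> t Tt ts; rewrite cauchy_matrix_gap// map_Im_cplxM mulmxDl mul1mx -scalemxAl.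
Qed.

(** By uniqueness, both parts of [Psi (s t) tau] are [X t] times those of [Psi 0 tau]. At
    [tau = s t] the left side is the identity, so [X t] is invertible, its inverse is the real part
    of [Psi 0 (s t)], and the imaginary part of the latter vanishes. *)
Lemma transition_matrix : exists X : R -> 'M[R]_n,
  [/\ delta_flow T A X, X 0 = 1%:M, forall t, ts_set T t -> X t \in unitmx
    & forall t tau, ts_set T t -> ts_set T tau ->
        Psi (s t) (s tau) = cplx_mx (X t *m invmx (X tau))].
Proof.
pose X t := map_mx Re (Psi (s t) 0).
have fX : delta_flow T A X by exact: flow_Re.
have X0 : X 0 = 1%:M.
  by rewrite /X clock0 cauchy_matrix_diag// -cplx_mx1 map_Re_cplx.
have PsiX tau t : 0 <= tau -> ts_set T t -> Psi (s t) tau = cplx_mx (X t) *m Psi 0 tau.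
  move=> t0 Tt; apply: cplx_mx_ReIm.
    rewrite map_Re_cplxM; apply: (delta_flow_unique AK (flow_Re t0) (delta_flowMr _ fX) _ Tt).
    by rewrite clock0 X0 mul1mx.
  rewrite map_Im_cplxM; apply: (delta_flow_unique AK (flow_Im t0) (delta_flowMr _ fX) _ Tt).
  by rewrite clock0 X0 mul1mx.
have XV tau : ts_set T tau -> X tau *m map_mx Re (Psi 0 (s tau)) = 1%:M /\
    X tau *m map_mx Im (Psi 0 (s tau)) = 0.
  move=> Tt; have st0 := clock_ge0 T (ts_ge0 Tt).
  have := PsiX _ _ st0 Tt; rewrite cauchy_matrix_diag// => e; split.
    by rewrite -map_Re_cplxM -e -cplx_mx1 map_Re_cplx.
  by rewrite -map_Im_cplxM -e -cplx_mx1 map_Im_cplx.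
have Xu t : ts_set T t -> X t \in unitmx by move=> /XV[/mulmx1_unit[]].
exists X; split => // t tau Tt Ttau.
have st0 := clock_ge0 T (ts_ge0 Ttau).
rewrite PsiX// cplx_mxM; congr (_ *m _).
have [eR eI] := XV _ Ttau; apply: cplx_mx_ReIm.
  by rewrite map_Re_cplx -[LHS](mulKmx (Xu _ Ttau)) eR mulmx1.
by rewrite map_Im_cplx -[LHS](mulKmx (Xu _ Ttau)) eI mulmx0.
Qed.

End transition_matrix.

(** * From the dichotomy to a Green function *)

(* [F] is [R] or [R[i]], [emb] the inclusion, [re] the real part, [nv] the modulus. *)
Section green.
Context {R : realType} {F : numFieldType}.
Variables (emb : {rmorphism R -> F}) (re : F -> R) (nv : F -> R).
Hypothesis emb_le : forall x y, (emb x <= emb y) = (x <= y).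
Hypothesis nvE : forall x, emb (nv x) = `|x|.
Hypothesis reD : forall x y, re (x + y) = re x + re y.
Hypothesis reZ : forall a x, re (emb a * x) = a * re x.
Hypothesis re1 : re 1 = 1.
Hypothesis re_le : forall x, `|re x| <= nv x.

Let N {m p} (M : 'M[F]_(m, p)) : R := nv `|M|.

Let NE m p (M : 'M[F]_(m, p)) : emb (N M) = `|M|.
Proof. by rewrite nvE normr_id. Qed.

Let N_ge0 m p (M : 'M[F]_(m, p)) : 0 <= N M.
Proof. by rewrite -emb_le NE rmorph0. Qed.

Let NB m p (M L : 'M[F]_(m, p)) : N (M - L) <= N M + N L.
Proof. by rewrite -emb_le rmorphD /= !NE ler_normB. Qed.

Let NM m p q (M : 'M[F]_(m, p)) (L : 'M[F]_(p, q)) : N (M *m L) <= p%:R * N M * N L.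
Proof. by rewrite -emb_le !rmorphM /= rmorph_nat !NE mx_norm_mul. Qed.

Let emb_norm (a : R) : `|emb a| = emb `|a|.
Proof.
have [a0|a0] := leP 0 a; first by rewrite !ger0_norm// -(rmorph0 emb) emb_le.
by rewrite (ltr0_norm a0) rmorphN ler0_norm// -(rmorph0 emb) emb_le ltW.
Qed.

Let N_emb m p (B : 'M[R]_(m, p)) : N (map_mx emb B) <= `|B|.
Proof.
rewrite -emb_le NE; apply: mx_norm_le => [|i j].
  by rewrite -(rmorph0 emb) emb_le.
by rewrite mxE emb_norm emb_le mx_norm_entry.
Qed.

Let re0 : re 0 = 0.
Proof. by have := reD 0 0; rewrite addr0; lra. Qed.

Let re_sum (I : Type) (l : seq I) (f : I -> F) :
  re (\sum_(i <- l) f i) = \sum_(i <- l) re (f i).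
Proof. exact: (big_morph re reD re0). Qed.

Let map_re_mul m p q r (B : 'M[R]_(m, p)) (M : 'M[F]_(p, q)) (D : 'M[R]_(q, r)) :
  map_mx re (map_mx emb B *m M *m map_mx emb D) = B *m map_mx re M *m D.
Proof.
apply/matrixP => i j; rewrite !mxE re_sum; apply: eq_bigr => k _.
rewrite !mxE mulrC reZ mulrC; congr (_ * _).
by rewrite re_sum; apply: eq_bigr => l _; rewrite !mxE reZ.
Qed.

Let norm_map_re m p (M : 'M[F]_(m, p)) : `|map_mx re M| <= N M.
Proof.
apply: mx_norm_le => // i j; rewrite mxE; apply: le_trans (re_le _) _.
by rewrite -emb_le nvE NE mx_norm_entry.
Qed.

(** The columns of [M] are the images of the unit vectors, of norm at most 1, so that no dimensional
    factor is lost in passing from vectors to the maximum norm. *)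
Let N_le_vec m p (M : 'M[F]_(m, p)) (c : R) : 0 <= c ->
  (forall v : 'cV[F]_p, N (M *m v) <= c * N v) -> N M <= c.
Proof.
move=> c0 h; rewrite -emb_le NE; apply: mx_norm_le => [|i j].
  by rewrite -(rmorph0 emb) emb_le.
have -> : M i j = (M *m delta_mx j 0 : 'cV_m) i 0.
  rewrite mxE (bigD1 j)//= mxE !eqxx mulr1 big1 ?addr0// => k kj.
  by rewrite mxE (negbTE kj) mulr0.
apply: le_trans (mx_norm_entry _ _ _) _; rewrite -NE emb_le.
apply: le_trans (h _) _; rewrite ler_piMr// -emb_le NE rmorph1.
by apply: mx_norm_le => // k l; rewrite mxE normr_nat; case: (_ && _).
Qed.

Variables (n : nat) (T : timeScale R) (A X : R -> 'M[R]_n) (Phi : R -> R -> 'M[F]_n).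
Variables (K K1 : R).
Hypothesis AK : forall t, ts_set T t -> n%:R * `|A t| <= K.
Hypothesis AK1 : forall t, ts_set T t ->
  (1 + graininess T t) * `|invmx (1%:M + graininess T t *: A t)| <= K1.
Hypothesis regA : forall t, ts_set T t -> 1%:M + graininess T t *: A t \in unitmx.
Hypothesis flowX : delta_flow T A X.
Hypothesis X0 : X 0 = 1%:M.
Hypothesis Xu : forall t, ts_set T t -> X t \in unitmx.
Local Notation s := (ts_clock T).
Hypothesis PhiX : forall t tau, ts_set T t -> ts_set T tau ->
  Phi (s t) (s tau) = map_mx emb (X t *m invmx (X tau)).

Let Phi_comp t u v : ts_set T t -> ts_set T u -> ts_set T v ->
  Phi (s t) (s u) *m Phi (s u) (s v) = Phi (s t) (s v).
Proof.
by move=> Tt Tu Tv; rewrite !PhiX// -map_mxM mulmxA mulmxKV// Xu.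
Qed.

Let Phi_id t : ts_set T t -> Phi (s t) (s t) = 1%:M.
Proof. by move=> Tt; rewrite PhiX// mulmxV ?Xu// map_mx1. Qed.

Let Phi_growth t tau (v : 'cV[F]_n) : ts_set T t -> ts_set T tau -> tau <= t ->
  N (Phi (s t) (s tau) *m v) <= n%:R * expR (K * (t - tau)) * N v.
Proof.
move=> Tt Ttau tt; apply: le_trans (NM _ _) _; apply: ler_wpM2r => //.
apply: ler_wpM2l => //; rewrite PhiX//; apply: le_trans (N_emb _) _.
have K0 : 0 <= K by apply: le_trans (AK (ts_0 T)); rewrite mulr_ge0.
have := delta_flow_growth K0 AK (delta_flowMr (invmx (X tau)) flowX) Ttau Tt tt.
move=> /le_trans; apply; rewrite mulmxV ?Xu//.
by rewrite ler_piMr ?expR_ge0// mx_norm1.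
Qed.

Let Phi_step t : ts_set T t ->
  Phi (s (sigma T t)) (s t) = map_mx emb (1%:M + graininess T t *: A t).
Proof.
move=> Tt; rewrite PhiX//; last exact: sigma_in.
have [hs _ _] := flowX; rewrite hs//; congr (map_mx _ _).
by rewrite mulmxDl -scalemxAl -mulmxA mulmxV ?Xu// mulmx1.
Qed.

Let K1_ge0 : 0 <= K1.
Proof.
apply: le_trans (AK1 (ts_0 T)); rewrite mulr_ge0//.
by have := graininess_ge0 T 0; lra.
Qed.

Section dichotomy.
Variables (Up Um : R -> {vspace 'cV[F]_n}) (c lam : R).
Hypothesis c1 : 1 <= c.
Hypothesis lam0 : 0 < lam.
Hypothesis UpD : forall t, ts_set T t ->
  (Up (s t) + Um (s t))%VS = fullv /\ (Up (s t) :&: Um (s t))%VS = 0%VS.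
Hypothesis Upinv : forall t tau x, ts_set T t -> ts_set T tau ->
  x \in Up (s tau) -> Phi (s t) (s tau) *m x \in Up (s t).
Hypothesis Uminv : forall t tau x, ts_set T t -> ts_set T tau ->
  x \in Um (s tau) -> Phi (s t) (s tau) *m x \in Um (s t).
Hypothesis stab : forall t tau (x : 'cV[F]_n), ts_set T t -> ts_set T tau ->
  tau <= t -> x \in Up (s tau) ->
  N (Phi (s t) (s tau) *m x) <= c * expR (- lam * (s t - s tau)) * N x.
Hypothesis unst : forall t tau (x : 'cV[F]_n), ts_set T t -> ts_set T tau ->
  t <= tau -> x \in Um (s tau) ->
  N (Phi (s t) (s tau) *m x) <= c * expR (- lam * (s tau - s t)) * N x.

Let c0 : 0 <= c. Proof. exact: le_trans ler01 c1. Qed.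

Let N_eq0 (v : 'cV[F]_n) : (N v <= 0) = (v == 0).
Proof. by rewrite -emb_le NE rmorph0 normr_le0. Qed.

Let expR_clock_le1 t tau : ts_set T t -> ts_set T tau -> tau <= t ->
  expR (- lam * (s t - s tau)) <= 1.
Proof.
move=> Tt Ttau tt; rewrite expR_le1 mulNr oppr_le0 mulr_ge0 ?(ltW lam0)//.
by rewrite subr_ge0 clock_le//; exact: ts_ge0 Ttau.
Qed.

(* Large steps expand every vector, so that they cannot occur when the stable
   spaces are nontrivial. *)
Let graininess_bounded (v : 'cV[F]_n) : v \in Up (s 0) -> v != 0 ->
  forall t, ts_set T t -> graininess T t <= n%:R * K1 * c.
Proof.
have := c1; have := lam0 => lam_gt0 c_ge1.
move=> vU v0 t Tt; have T0 := ts_0 T; have mt := graininess_ge0 T t.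
pose y := Phi (s t) (s 0) *m v.
have yU : y \in Up (s t) by exact: Upinv.
have y0 : 0 < N y.
  rewrite ltNge N_eq0; apply: contra v0 => /eqP y0.
  have : Phi (s 0) (s t) *m y = v by rewrite /y mulmxA Phi_comp// Phi_id// mul1mx.
  by rewrite y0 mulmx0 => <-.
have h1 := stab (sigma_in T t) Tt (sigma_ge T t) yU.
have h2 : N (Phi (s (sigma T t)) (s t) *m y) <= c * N y.
  apply: le_trans h1 _; apply: ler_wpM2r => //; rewrite ler_piMr//.
  by apply: expR_clock_le1 => //; [exact: sigma_in | exact: sigma_ge].
have h3 : y = map_mx emb (invmx (1%:M + graininess T t *: A t)) *m
    (Phi (s (sigma T t)) (s t) *m y).
  by rewrite Phi_step// mulmxA -map_mxM mulVmx ?regA// map_mx1 mul1mx.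
have h4 : N y <= n%:R * `|invmx (1%:M + graininess T t *: A t)| * (c * N y).
  rewrite {1}h3; apply: le_trans (NM _ _) _; apply: ler_pM; rewrite ?mulr_ge0//.
  by apply: ler_wpM2l => //; exact: N_emb.
have h5 : (1 + graininess T t) * N y <= n%:R * K1 * c * N y.
  have m1 : 0 <= 1 + graininess T t by lra.
  apply: le_trans (ler_wpM2l m1 h4) _.
  have cN : 0 <= n%:R * (c * N y) by rewrite !mulr_ge0//; lra.
  have := ler_wpM2r cN (AK1 Tt); lra.
by have := h5; rewrite ler_pM2r//; lra.
Qed.

(** Over a suitable time of bounded length the flow at least doubles [b] and at most halves [a]. If
    the two nearly cancelled in [a + b], that sum would outgrow [Phi_growth]. *)
Let split_bound : exists2 K0, 0 <= K0 & forall tau a b, ts_set T tau ->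
  a \in Up (s tau) -> b \in Um (s tau) -> N a <= K0 * N (a + b).
Proof.
have := c1; have := lam0 => lam_gt0 c_ge1.
have T0 := ts_0 T.
(* If the stable space at 0 is trivial, invariance makes all of them trivial and [a = 0]. *)
have [[v [vU v0]]|h] := pselect (exists v, v \in Up (s 0) /\ v != 0); last first.
  exists 0 => // tau a b Ttau aU _; rewrite mul0r N_eq0.
  have : Phi (s 0) (s tau) *m a = 0.
    apply/eqP/negP => /negP h'; apply: h.
    by exists (Phi (s 0) (s tau) *m a); split => //; exact: Upinv.
  have e : Phi (s tau) (s 0) *m (Phi (s 0) (s tau) *m a) = a.
    by rewrite mulmxA Phi_comp// Phi_id// mul1mx.
  by move=> h0; rewrite -e h0 mulmx0.
pose mb := n%:R * K1 * c.
have mb0 : 0 <= mb by rewrite /mb !mulr_ge0//; lra.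
have mbT := graininess_bounded vU v0; rewrite -/mb in mbT.
(* Once [lam] times the clock increment reaches [y0], the factor [E >= y0] gives
   [c / E <= 1 / (1 + c) <= 1 / 2]. The time [l] achieves this even at the slowest clock speed
   [1 / (1 + mb)]. *)
pose y0 := c * (1 + c).
have y00 : 0 < y0 by rewrite mulr_gt0//; lra.
pose l := y0 * (1 + mb) / lam.
have l0 : 0 <= l by rewrite divr_ge0 ?mulr_ge0 ?ltW//; lra.
have K0 : 0 <= K by apply: le_trans (AK T0); rewrite mulr_ge0.
pose G := n%:R * expR (K * (l + mb)).
have G0 : 0 <= G by rewrite mulr_ge0// expR_ge0.
exists (G + 2); first by lra.
move=> tau a b Ttau aU bU; have t0 := ts_ge0 Ttau.
have tl0 : 0 <= tau + l by lra.
(* A point of [T] not before [tau + l], which it exceeds by at most [mb]. *)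
pose t := sigma T (ts_floor T (tau + l)).
have Tt : ts_set T t by exact: sigma_in.
have tl : tau + l <= t.
  have [Tl|nTl] := pselect (ts_set T (tau + l)).
    by rewrite /t ts_floor_id// sigma_ge.
  by have /andP[_ /ltW] := ts_floor_notin tl0 nTl.
have tm : t <= tau + l + mb.
  rewrite /t graininessE; apply: lerD; first exact: ts_floor_le.
  by apply: mbT; exact: ts_floor_in.
have taut : tau <= t by lra.
have sy : y0 <= lam * (s t - s tau).
  have /andP[h _] : (t - tau) / (1 + mb) <= s t - s tau <= t - tau.
    by apply: clock_bounds => // r Tr _ _; exact: mbT.
  have h1 : l / (1 + mb) <= (t - tau) / (1 + mb).
    by apply: ler_wpM2r; [rewrite invr_ge0 | ]; lra.
  have h2 : lam * (l / (1 + mb)) = y0 by rewrite /l; field; apply/andP; split; lra.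
  by rewrite -h2; apply: ler_wpM2l; lra.
pose E := expR (lam * (s t - s tau)).
have E0 : 0 < E by exact: expR_gt0.
have Ey : y0 <= E by apply: le_trans sy _; have := expR_ge1Dx (lam * (s t - s tau)); rewrite -/E; lra.
have EV : expR (- lam * (s t - s tau)) = E^-1 by rewrite mulNr expRN.
have ha := stab Tt Ttau taut aU; rewrite EV in ha.
have hb := unst Ttau Tt taut (Uminv Tt Ttau bU); rewrite EV mulmxA Phi_comp// Phi_id// mul1mx in hb.
have hG : N (Phi (s t) (s tau) *m (a + b)) <= G * N (a + b).
  apply: le_trans (Phi_growth _ Tt Ttau taut) _; apply: ler_wpM2r => //.
  by apply: ler_wpM2l => //; rewrite ler_expR; apply: ler_wpM2l; lra.
have hab : N (Phi (s t) (s tau) *m b) <=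
    N (Phi (s t) (s tau) *m (a + b)) + N (Phi (s t) (s tau) *m a).
  apply: le_trans (NB _ _); rewrite mulmxDr.
  by rewrite [_ *m a + _]addrC addrK.
have hba : N a <= N (a + b) + N b by have := NB (a + b) b; rewrite addrK.
have cE : c * E^-1 * (1 + c) <= 1.
  by rewrite mulrAC ler_pdivrMr// mul1r.
have cE0 : 0 <= c * E^-1 by rewrite mulr_ge0 ?invr_ge0 ?(ltW E0)//; lra.
have hb2 : (1 + c) * N b <= N (Phi (s t) (s tau) *m b).
  have h1 := ler_wpM2l (_ : 0 <= 1 + c) hb.
  apply: le_trans (h1 ltac:(lra)) _; rewrite mulrA [(1 + c) * _]mulrC.
  by rewrite ler_piMl.
have ha2 : N (Phi (s t) (s tau) *m a) <= N a / 2.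
  apply: le_trans ha _; rewrite mulrC; apply: ler_wpM2l => //.
  have := ler_wpM2l cE0 (_ : 2 <= 1 + c) => /(_ ltac:(lra)); lra.
have hN : 2 * N b <= (1 + c) * N b by apply: ler_wpM2r => //; lra.
have Na0 := N_ge0 a.
lra.
Qed.

(* [P] is the real part of the projection on the stable space and need not be a
   projection itself. *)
Lemma dichotomy_green_aux : exists (P : 'M[R]_n) (k : R), [/\ 0 <= k,
  forall t tau, ts_set T t -> ts_set T tau -> tau <= t ->
    `|X t *m P *m invmx (X tau)| <= k * expR (- lam * (s t - s tau)),
  forall t tau, ts_set T t -> ts_set T tau -> t <= tau ->
    `|X t *m (1%:M - P) *m invmx (X tau)| <= k * expR (- lam * (s tau - s t))
  & P = 0 \/ exists m, forall t, ts_set T t -> graininess T t <= m].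
Proof.
have := c1; have := lam0 => lam_gt0 c_ge1.
have T0 := ts_0 T; have [K0 K00 hK0] := split_bound.
pose pi := daddv_pi (Up (s 0)) (Um (s 0)).
pose PF : 'M[F]_n := \matrix_(i, j) pi (delta_mx j 0) i 0.
have PFE v : PF *m v = pi v.
  rewrite [in RHS](_ : v = \sum_j v j 0 *: delta_mx j 0); last first.
    rewrite [LHS]matrix_sum_delta; apply: eq_bigr => j _.
    by rewrite big_ord1.
  rewrite linear_sum /=; apply/matrixP => i j; rewrite !mxE summxE ord1.
  by apply: eq_bigr => k _; rewrite linearZ !mxE mulrC.
(* Conjugation by [X] carries the projections at 0 to those at [tau], because the flow preserves
   both families of spaces; [a] and [b] are the components of [v] at [tau]. *)
have key tau (v : 'cV[F]_n) : ts_set T tau -> exists a b,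
  [/\ a \in Up (s tau), b \in Um (s tau), a + b = v,
     PF *m (map_mx emb (invmx (X tau)) *m v) = map_mx emb (invmx (X tau)) *m a &
     (1%:M - PF) *m (map_mx emb (invmx (X tau)) *m v) = map_mx emb (invmx (X tau)) *m b].
  move=> Ttau; pose y := map_mx emb (invmx (X tau)) *m v.
  have [UF U0] := UpD T0.
  have yab : pi y + daddv_pi (Um (s 0)) (Up (s 0)) y = y.
    by apply: daddv_pi_add => //; rewrite UF memvf.
  have PhiT0 : Phi (s tau) (s 0) = map_mx emb (X tau).
    by rewrite PhiX// X0 invmx1 mulmx1.
  have VX z : map_mx emb (invmx (X tau)) *m (Phi (s tau) (s 0) *m z) = z :> 'cV_n.
    by rewrite PhiT0 mulmxA -map_mxM mulVmx ?Xu// map_mx1 mul1mx.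
  exists (Phi (s tau) (s 0) *m pi y), (Phi (s tau) (s 0) *m daddv_pi (Um (s 0)) (Up (s 0)) y).
  split; [exact/Upinv/memv_pi | exact/Uminv/memv_pi | | | ].
  - by rewrite -mulmxDr yab PhiT0 /y mulmxA -map_mxM mulmxV ?Xu// map_mx1 mul1mx.
  - by rewrite VX PFE.
  - by rewrite VX mulmxBl mul1mx PFE -/y -{1}yab addrC addKr.
have PhiE t tau (z : 'cV[F]_n) : ts_set T t -> ts_set T tau ->
    map_mx emb (X t) *m (map_mx emb (invmx (X tau)) *m z) = Phi (s t) (s tau) *m z.
  by move=> Tt Ttau; rewrite mulmxA -map_mxM PhiX.
exists (map_mx re PF), (c * (1 + K0)); split.
- by rewrite mulr_ge0; lra.
- move=> t tau Tt Ttau tt; rewrite -map_re_mul; apply: le_trans (norm_map_re _) _.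
  apply: N_le_vec => [|v]; first by rewrite !mulr_ge0 ?expR_ge0//; lra.
  have [a [b [aU bU abv e1 _]]] := key tau v Ttau.
  rewrite -!mulmxA e1 PhiE//; apply: le_trans (stab Tt Ttau tt aU) _.
  set E := expR _; have E0 : 0 <= E := expR_ge0 _.
  have -> : c * (1 + K0) * E * N v = c * E * ((1 + K0) * N v) by ring.
  apply: ler_wpM2l; first by rewrite mulr_ge0.
  have := hK0 tau a b Ttau aU bU; rewrite abv; have := N_ge0 v; lra.
- move=> t tau Tt Ttau tt.
  (* The real part is additive and fixes 0 and 1, so the complementary half of the Green function is
     a real part as well. *)
  have -> : 1%:M - map_mx re PF = map_mx re (1%:M - PF).
    apply/matrixP => i j; rewrite !mxE.
    have reN x : re (- x) = - re x by have := reD x (- x); rewrite subrr re0; lra.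
    by rewrite reD reN; congr (_ - _); case: eqP => _; rewrite ?re0 ?re1.
  rewrite -map_re_mul; apply: le_trans (norm_map_re _) _.
  apply: N_le_vec => [|v]; first by rewrite !mulr_ge0 ?expR_ge0//; lra.
  have [a [b [aU bU abv _ e1]]] := key tau v Ttau.
  rewrite -!mulmxA e1 PhiE//; apply: le_trans (unst Tt Ttau tt bU) _.
  set E := expR _; have E0 : 0 <= E := expR_ge0 _.
  have -> : c * (1 + K0) * E * N v = c * E * ((1 + K0) * N v) by ring.
  apply: ler_wpM2l; first by rewrite mulr_ge0.
  have h1 := hK0 tau a b Ttau aU bU; rewrite abv in h1.
  have : N b <= N v + N a by have := NB (a + b) a; rewrite [a + b]addrC addrK addrC abv.
  lra.
(* If the stable space is trivial, arbitrarily long gaps may occur, but then the stable half of the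
   Green function is 0. *)
- have [[v [vU v0]]|h] := pselect (exists v, v \in Up (s 0) /\ v != 0).
    by right; exists (n%:R * K1 * c); exact: graininess_bounded vU v0.
  left; apply/matrixP => i j; rewrite !mxE.
  have -> : pi (delta_mx j 0) = 0.
    apply/eqP/negP => /negP h'; apply: h; exists (pi (delta_mx j 0)); split => //.
    exact: memv_pi.
  by rewrite mxE re0.
Qed.

End dichotomy.

Lemma dichotomy_green : exp_dichotomy emb Phi ->
  exists (P : 'M[R]_n) (k lam : R), [/\ 0 <= k, 0 < lam,
  forall t tau, ts_set T t -> ts_set T tau -> tau <= t ->
    `|X t *m P *m invmx (X tau)| <= k * expR (- lam * (s t - s tau)),
  forall t tau, ts_set T t -> ts_set T tau -> t <= tau ->
    `|X t *m (1%:M - P) *m invmx (X tau)| <= k * expR (- lam * (s tau - s t))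
  & P = 0 \/ exists m, forall t, ts_set T t -> graininess T t <= m].
Proof.
move=> [Up [Um [c [lam [[c0 l0] UD inv stab unst]]]]].
have s0 t : ts_set T t -> 0 <= s t by move=> Tt; exact/clock_ge0/(ts_ge0 Tt).
have img (U V : {vspace 'cV[F]_n}) (M : 'M[F]_n) x :
    (linfun (mulmx M) @: U)%VS = V -> x \in U -> M *m x \in V.
  by move=> <- /(memv_img (linfun (mulmx M))); rewrite lfunE.
have clock_lt' t tau : ts_set T t -> ts_set T tau -> tau <= t -> t = tau \/ s tau < s t.
  move=> Tt Ttau; rewrite le_eqVlt => /predU1P[->|h]; first by left.
  by right; apply: clock_lt => //; exact: ts_ge0 Ttau.
(* Raising the constant to [c + 1 >= 1] lets the estimates include equal times, where the dichotomy
   is silent and the Cauchy matrix is the identity. *)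
have cE y (x : 'cV[F]_n) : c * expR y * N x <= (c + 1) * expR y * N x.
  by apply: ler_wpM2r => //; apply: ler_wpM2r; [exact: expR_ge0 | lra].
have c1 (x : 'cV[F]_n) : N x <= (c + 1) * expR (- lam * 0) * N x.
  by rewrite mulr0 expR0 mulr1 mulrDl mul1r lerDr mulr_ge0// ltW.
have [] := @dichotomy_green_aux Up Um (c + 1) lam _ l0.
- by lra.
- by move=> t Tt; apply: UD; exact: s0.
- move=> t tau x Tt Ttau; apply: img.
  by have [] := inv (s t) (s tau) (s0 t Tt) (s0 tau Ttau).
- move=> t tau x Tt Ttau; apply: img.
  by have [] := inv (s t) (s tau) (s0 t Tt) (s0 tau Ttau).
- move=> t tau x Tt Ttau tt xU.
  have [->|st] := clock_lt' t tau Tt Ttau tt; first by rewrite Phi_id// mul1mx subrr.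
  apply: le_trans (cE _ _); rewrite -emb_le rmorphM /= !NE.
  exact: stab (s0 _ Ttau) st xU.
- move=> t tau x Tt Ttau tt xU.
  have [->|st] := clock_lt' tau t Ttau Tt tt; first by rewrite Phi_id// mul1mx subrr.
  apply: le_trans (cE _ _); rewrite -emb_le rmorphM /= !NE.
  have -> : - lam * (s tau - s t) = lam * (s t - s tau) by ring.
  exact: unst (s0 _ Tt) st xU.
- by move=> P [k [k0 h1 h2 h3]]; exists P, k, lam.
Qed.

End green.

(** * The Delta-measure *)

Section delta_measure.
Context {R : realType} (T : timeScale R).
Local Notation dm := (delta_measure T).
Implicit Types (a b t : R).

Lemma delta_measure_itvoc a b : a <= b ->
  dm (`]a, b]%classic : set R) = (sigma T b - sigma T a)%:E.
Proof.
move=> ab; rewrite /delta_measure/= /lebesgue_stieltjes_measure/= /measure_extension/=.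
by rewrite measurable_mu_extE /= ?wlength_itv_bnd//; exact: is_ocitv.
Qed.

Lemma sigmaN1 : sigma T (-1) = 0.
Proof.
apply/le_anti; rewrite (sigma_le (ts_0 T) (ltrN10 R)) /=.
exact: (ts_ge0 (sigma_in T _)).
Qed.

(** The left limit of [sigma] at a point [t] of [T] is [t], since [sigma] at [t - 1/k] lies between
    [t - 1/k] and [t]. The left end -1 precedes [T], so that an atom at 0 is counted. *)
Lemma delta_measure_lt t : ts_set T t -> dm (`]-1, t[%classic : set R) = t%:E.
Proof.
move=> Tt; have t0 := ts_ge0 Tt.
rewrite itv_bnd_open_bigcup//; transitivity (limn (dm \o
    (fun k => `]-1, t - k.+1%:R^-1]%classic : set R))).
  apply/esym/cvg_lim => //; apply: nondecreasing_cvg_mu.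
  - by move=> k.
  - exact: bigcup_measurable.
  - move=> n m nm; apply/subsetPset; apply: subset_itv; rewrite ?bnd_simp//.
    by rewrite lerB// lef_pV2 ?posrE// ler_nat.
rewrite (_ : _ \o _ = fun k => (sigma T (t - k.+1%:R^-1))%:E); last first.
  apply/funext => k /=; rewrite delta_measure_itvoc ?sigmaN1 ?subr0//.
  have : (k.+1%:R^-1 : R) <= 1 by rewrite invf_le1 ?ler1n.
  by move: (_^-1) => y; lra.
apply/cvg_lim => //; apply/cvg_EFin; first exact: nearW.
apply/cvgrPdist_lt => e e0; near=> k.
have k0 : 0 < (k.+1%:R^-1 : R) by rewrite invr_gt0.
have ke : (k.+1%:R^-1 : R) < e by near: k; exact: near_infty_natSinv_lt (PosNum e0).
rewrite /comp /=.
have h1 : sigma T (t - k.+1%:R^-1) <= t by apply: sigma_le => //; rewrite ltrBlDr ltrDl.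
have h2 := sigma_ge T (t - k.+1%:R^-1).
by move: (_^-1) k0 ke h1 h2 => y k0 ke h1 h2; rewrite ger0_norm; lra.
Unshelve. all: by end_near. Qed.

Lemma delta_measure_itvco a b : ts_set T a -> ts_set T b -> a <= b ->
  dm (`[a, b[%classic : set R) = (b - a)%:E.
Proof.
move=> Ta Tb ab; have a0 := ts_ge0 Ta.
have e : (dm (`](-1)%R, a[%classic : set R) + dm (`[a, b[%classic : set R))%E = b%:E.
  rewrite -(delta_measure_lt Tb).
  rewrite (@itv_bndbnd_setU _ _ (BRight (-1 : R)) (BLeft a) (BLeft b)) ?bnd_simp//; last lra.
  rewrite measureU// -subset0 => x [] /=.
  by rewrite !in_itv /= => /andP[_ xa] /andP[ax _]; move: xa; rewrite ltNge ax.
rewrite delta_measure_lt// in e.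
have fin : dm (`[a, b[%classic : set R) \is a fin_num.
  move: e; case: (dm _) => //= r.
by move: e; rewrite -(fineK fin) -EFinD => -[e]; congr (_%:E); lra.
Qed.

Lemma measurable_time_scale : measurable (ts_set T : set (measurableTypeR R)).
Proof. exact: closed_measurable (@ts_closed _ T). Qed.

(** Each of these points is interior to a gap, where [sigma] is constant, hence lies in an interval
    []p, q]] with rational ends and equal values of [sigma]. Such intervals have measure 0 and are
    countably many. *)
Lemma delta_measure_setC : dm.-negligible (~` ts_set T `&` [set t | 0 <= t]).
Proof.
pose F k : set R := if unpickle k is Some (p, q) then
  if (ratr p <= ratr q :> R) && (sigma T (ratr p) == sigma T (ratr q)) then
    `]ratr p, ratr q]%classic else set0 else set0.
have nF : dm.-negligible (\bigcup_k F k).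
  apply: negligible_bigcup => k; rewrite /F; case: unpickle => [[p q]|];
    last exact: negligible_set0.
  case: ifPn => [/andP[pq /eqP e]|_]; last exact: negligible_set0.
  apply/negligibleP => //; apply: etrans (delta_measure_itvoc pq) _.
  by rewrite e subrr.
apply: negligibleS nF => r [nTr /= r0].
have /andP[fr rs] := ts_floor_notin r0 nTr.
have [p pI] := rat_in_itvoo fr; have [q qI] := rat_in_itvoo rs.
move: pI qI; rewrite !in_itv /= => /andP[fp pr] /andP[rq qs].
have sg (x : R) : ts_floor T r < x -> x < sigma T (ts_floor T r) ->
    sigma T x = sigma T (ts_floor T r).
  move=> fx xs; apply/le_anti; rewrite sigma_le//; last exact: sigma_in.
  by apply: sigma_nondecreasing; exact: ltW.
have Fpq : F (pickle (p, q)) = `]ratr p, ratr q]%classic.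
  by rewrite /F pickleK !sg ?eqxx ?andbT ?(ltW (lt_trans pr rq))//;
    [exact: lt_trans rq | exact: lt_trans rs].
move: (pickle (p, q)) Fpq => k Fk; exists k; first by [].
by rewrite Fk /= in_itv /= pr ltW.
Qed.

Lemma delta_measure_ts a b : ts_set T a -> ts_set T b -> a <= b ->
  dm (ts_set T `&` `[a, b[) = (b - a)%:E.
Proof.
move=> Ta Tb ab; rewrite -(delta_measure_itvco Ta Tb ab).
have mI : measurable (`[a, b[%classic : set (measurableTypeR R)) by [].
have mT := measurable_time_scale.
rewrite -[in RHS](setUIDK `[a, b[%classic (ts_set T)).
rewrite measureU//; [|exact: measurableI|exact: measurableD|]; last first.
  by rewrite -subset0 => x [[_ ?] [_ ?]].
rewrite setIC [X in (_ + X)%E](_ : _ = 0%E) ?adde0//.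
apply/negligibleP; first exact: measurableD.
apply: negligibleS delta_measure_setC => x [+ nTx]; rewrite /= in_itv /= => /andP[ax _].
by split => //=; exact: le_trans (ts_ge0 Ta) ax.
Qed.

Lemma measurable_ts_itv a b :
  measurable (ts_set T `&` `[a, b[ : set (measurableTypeR R)).
Proof. by apply: measurableI => //; exact: measurable_time_scale. Qed.

Lemma delta_integrable_bounded (g : R -> R) a b : ts_set T a -> ts_set T b -> a <= b ->
  measurable_fun (ts_set T `&` `[a, b[) g ->
  (exists M, forall t, ts_set T t -> a <= t -> t < b -> `|g t| <= M) ->
  dm.-integrable (ts_set T `&` `[a, b[) (EFin \o g).
Proof.
move=> Ta Tb ab mg [M hM]; apply: measurable_bounded_integrable => //.
- exact: measurable_ts_itv.
- by rewrite delta_measure_ts// ltry.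
- exists M; split; first exact: num_real.
  move=> N MN x [Tx] /=; rewrite in_itv /= => /andP[ax xb].
  by apply: le_trans (ltW MN); exact: hM.
Qed.

(** Increments of vector integrals over [T] are estimated through this mean value inequality; with
    [e = 0] it evaluates the integral over a single gap. *)
Lemma delta_integral_mean m (g : R -> 'cV[R]_m) (v : 'cV[R]_m) (e a b : R) :
  ts_set T a -> ts_set T b -> a <= b -> 0 <= e -> delta_integrable T b g ->
  (forall t, ts_set T t -> a <= t -> t < b -> `|g t - v| <= e) ->
  `|delta_integral T b g - delta_integral T a g - (b - a) *: v| <= e * (b - a).
Proof.
move=> Ta Tb ab e0 ig hg; have a0 := ts_ge0 Ta.
apply: mx_norm_le => [|i j]; first by rewrite mulr_ge0// subr_ge0.
rewrite !mxE ord1.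
have split0 : ts_set T `&` `[0, b[ = (ts_set T `&` `[0, a[) `|` (ts_set T `&` `[a, b[).
  by rewrite -setIUr -itv_bndbnd_setU// bnd_simp.
have igi := ig i.
rewrite split0 in igi *; rewrite Rintegral_setU//; last 3 first.
- exact: measurable_ts_itv.
- exact: measurable_ts_itv.
- apply/disj_setPS => x [[_ /= xa] [_ /= ax]].
  move: xa ax; rewrite !in_itv /= => /andP[_ xa] /andP[ax _].
  by move: xa; rewrite ltNge ax.
rewrite [X in `|X - (b - a) * _|]addrAC subrr add0r.
have iab : dm.-integrable (ts_set T `&` `[a, b[) (EFin \o (fun t => g t i 0)).
  apply: integrableS igi; [rewrite -split0 | | exact: subsetUr];
    exact: measurable_ts_itv.
have := @Rintegral_bounds_norm _ _ _ dm (ts_set T `&` `[a, b[) (fun t => g t i 0) (v i 0) e.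
rewrite delta_measure_ts//= ltry; apply => //; first exact: measurable_ts_itv.
move=> x [Tx] /=; rewrite in_itv /= => /andP[ax xb].
apply: le_trans (hg x Tx ax xb); apply: le_trans (mx_norm_entry _ i 0).
by rewrite !mxE.
Qed.

End delta_measure.

(** * Measurability and linearity of the Delta-integral *)

Section time_scale_integrals.
Context {R : realType} (T : timeScale R).
Local Notation dm := (delta_measure T).
Implicit Types (a b t : R).

Lemma ts_lipschitz_measurable n m (g : R -> 'M[R]_(n, m)) : ts_lipschitz T g ->
  forall b i j, measurable_fun (ts_set T `&` `[0, b[) (fun t => g t i j).
Proof.
move=> lg b i j; have [L L0 hL] := lg b.
apply: subspace_continuous_measurable_fun; first exact: measurable_ts_itv.
apply/subspace_continuousP => t [Tt]; rewrite /= in_itv /= => /andP[t0 tb].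
apply/cvgrPdist_le => e e0.
have L1 : 0 < L + 1 by rewrite ltr_wpDl.
apply/nbhs_ballP; exists (e / (L + 1)); first by rewrite /= divr_gt0.
move=> u; rewrite /ball /= => tu [Tu]; rewrite in_itv /= => /andP[u0 ub].
have -> : g t i j - g u i j = (g t - g u) i j by rewrite !mxE.
apply: le_trans (mx_norm_entry _ _ _) _.
have h : `|g t - g u| <= L * `|t - u|.
  have [ut|tu'] := leP u t; first by rewrite ger0_norm ?subr_ge0//; apply: hL => //; exact: ltW.
  by rewrite distrC [`|t - u|]distrC gtr0_norm ?subr_gt0//; apply: hL => //; exact: ltW.
apply: le_trans h _; apply: le_trans (ler_wpM2l L0 (ltW tu)) _.
by apply: ler_mulDl1 => //; exact: ltW.
Qed.

Lemma measurable_mulmx (D : set R) n m p (g : R -> 'M[R]_(n, m)) (h : R -> 'M[R]_(m, p)) :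
  (forall i j, measurable_fun D (fun t => g t i j)) ->
  (forall i j, measurable_fun D (fun t => h t i j)) ->
  forall i j, measurable_fun D (fun t => (g t *m h t) i j).
Proof.
move=> mg mh i j; under eq_fun do rewrite mxE.
by apply: measurable_sum => k; exact: measurable_funM.
Qed.

Lemma delta_integral_mulmx n m (M : 'M[R]_(n, m)) (g : R -> 'cV[R]_m) b :
  delta_integrable T b g ->
  delta_integrable T b (fun u => M *m g u) /\
  delta_integral T b (fun u => M *m g u) = M *m delta_integral T b g.
Proof.
move=> ig; have mD := @measurable_ts_itv _ T 0 b.
have iM i k : dm.-integrable (ts_set T `&` `[0, b[) (EFin \o (fun u => M i k * g u k 0)).
  by apply: integrable_scale => //; exact: ig.
have E i : (fun u => (M *m g u) i 0) = (fun u => \sum_k M i k * g u k 0).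
  by apply/funext => u; rewrite mxE.
split.
  move=> i; have := integrable_sumr (index_enum _) mD (iM i).
  by rewrite -E.
apply/matrixP => i j; rewrite !mxE ord1 E Rintegral_sumr//.
apply: eq_bigr => k _; rewrite mxE RintegralZl//; exact: ig.
Qed.

Lemma delta_integralB m (g h : R -> 'cV[R]_m) b :
  delta_integrable T b g -> delta_integrable T b h ->
  delta_integrable T b (fun u => g u - h u) /\
  delta_integral T b (fun u => g u - h u) = delta_integral T b g - delta_integral T b h.
Proof.
move=> ig ih; have mD := @measurable_ts_itv _ T 0 b.
have E i : (fun u => (g u - h u) i 0) = (fun u => g u i 0 - h u i 0).
  by apply/funext => u; rewrite !mxE.
split.
  move=> i; have := integrableB mD (ig i) (ih i).
  by rewrite [X in _ -> dm.-integrable _ X](_ : _ = EFin \o (fun u => (g u - h u) i 0))// E.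
apply/matrixP => i j; rewrite !mxE E RintegralB//; [exact: ig | exact: ih].
Qed.

Lemma delta_integral0 m (g : R -> 'cV[R]_m) : delta_integral T 0 g = 0.
Proof.
apply/matrixP => i j; rewrite !mxE.
by rewrite set_itvco0 setI0 Rintegral_set0.
Qed.

End time_scale_integrals.

(** * Bounded solutions *)

Section green_bounds.
Context {R : realType} (T : timeScale R) {n : nat}.
Variables (A X : R -> 'M[R]_n) (P : 'M[R]_n) (c : R -> 'cV[R]_n).
Variables (K1 k lam F0 : R).
Local Notation s := (ts_clock T).
Hypothesis AK1 : forall t, ts_set T t ->
  (1 + graininess T t) * `|invmx (1%:M + graininess T t *: A t)| <= K1.
Hypothesis regA : forall t, ts_set T t -> 1%:M + graininess T t *: A t \in unitmx.
Hypothesis flowX : delta_flow T A X.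
Hypothesis Xu : forall t, ts_set T t -> X t \in unitmx.
Hypothesis k0 : 0 <= k.
Hypothesis lam0 : 0 < lam.
Hypothesis F0_ge0 : 0 <= F0.
Hypothesis greenP : forall t tau, ts_set T t -> ts_set T tau -> tau <= t ->
  `|X t *m P *m invmx (X tau)| <= k * expR (- lam * (s t - s tau)).
Hypothesis greenQ : forall t tau, ts_set T t -> ts_set T tau -> t <= tau ->
  `|X t *m (1%:M - P) *m invmx (X tau)| <= k * expR (- lam * (s tau - s t)).
Hypothesis P0_or_bounded :
  P = 0 \/ exists m, forall t, ts_set T t -> graininess T t <= m.
Hypothesis c0 : c 0 = 0.
Hypothesis c_inc : forall (M : 'M[R]_n) (e a b : R),
  ts_set T a -> ts_set T b -> a <= b -> 0 <= e ->
  (forall t, ts_set T t -> a <= t -> t < b -> `|M *m invmx (X (sigma T t))| <= e) ->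
  `|M *m c b - M *m c a| <= n%:R * e * F0 * (b - a).

Let expR_clock_le1 t tau : ts_set T t -> ts_set T tau -> tau <= t ->
  expR (- lam * (s t - s tau)) <= 1.
Proof.
move=> Tt Ttau tt; rewrite expR_le1 mulNr oppr_le0 mulr_ge0 ?(ltW lam0)//.
by rewrite subr_ge0 clock_le//; exact: ts_ge0 Ttau.
Qed.

Let step_le (x1 x2 y C e1 e2 : R) : x1 - x2 <= y -> y <= C * (e1 - e2) ->
  x1 - C * e1 <= x2 - C * e2.
Proof. lra. Qed.

Let step_ge (x1 x2 y C e1 e2 : R) : x1 - x2 <= y -> y <= C * (e2 - e1) ->
  x1 + C * e1 <= x2 + C * e2.
Proof. lra. Qed.

Let lip_le (y z p q w : R) : p <= q -> y - z <= w -> (y - q) - (z - p) <= w.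
Proof. lra. Qed.

Let lip_ge (y z p q w : R) : q <= p -> y - z <= w -> (y + q) - (z + p) <= w.
Proof. lra. Qed.

(** Since [exp (lam y) >= 1 + lam x], the exponential loses over a clock increment [y] an amount at
    least proportional to [x]; the condition [x <= 1] keeps the denominator below [1 + lam]. *)
Let exp_gap x y : 0 <= x -> x <= 1 -> x <= y -> lam / (1 + lam) * x <= 1 - expR (- lam * y).
Proof.
have l0 := lam0 => x0 x1 xy.
have lx : 0 <= lam * x by rewrite mulr_ge0// ltW.
have h1 : expR (- lam * y) <= (1 + lam * x)^-1.
  rewrite mulNr expRN lef_pV2 ?posrE ?expR_gt0//; last lra.
  apply: le_trans (expR_ge1Dx _); have := ler_wpM2l (ltW l0) xy; lra.
have h2 : 1 - (1 + lam * x)^-1 = lam * x / (1 + lam * x) by field; lra.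
have h3 : lam * x / (1 + lam) <= lam * x / (1 + lam * x).
  apply: ler_wpM2l => //; rewrite lef_pV2 ?posrE; [|lra..].
  by have := ler_wpM2l (ltW l0) x1; lra.
rewrite mulrAC; lra.
Qed.

Let exp_gap_mul (D e x y : R) : 0 <= D -> 0 <= e -> 0 <= x -> x <= 1 -> x <= y ->
  D * e * x <= D * ((1 + lam) / lam) * (e * (1 - expR (- lam * y))).
Proof.
have l0 := lam0 => D0 e0 x0 x1 xy.
have De : 0 <= D * ((1 + lam) / lam) * e.
  by rewrite mulr_ge0// mulr_ge0// divr_ge0 ?(ltW l0)//; lra.
rewrite [leRHS]mulrA; apply: le_trans (ler_wpM2l De (exp_gap x0 x1 xy)).
rewrite le_eqVlt; apply/orP; left; apply/eqP; field.
by apply/andP; split; lra.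
Qed.

(** With [t] fixed and [a] running from 0 to [t], the increments of [X t P c a] are dominated by
    those of [C E a], so that the total is at most [C (E t - E 0) <= C]. Bounded graininess makes
    time and clock increments comparable. *)
Lemma green_bound_stable :
  exists2 C, 0 <= C & forall t, ts_set T t -> `|X t *m P *m c t| <= C.
Proof.
have [P0|[mb mbT]] := P0_or_bounded.
  by exists 0 => [|t Tt]; [exact: lexx | rewrite P0 mulmx0 mul0mx normr0].
have mb0 : 0 <= mb by apply: le_trans (mbT 0 (ts_0 T)); exact: graininess_ge0.
have m10 : 0 < 1 + mb by rewrite ltr_pwDl.
pose K' := n%:R * k * F0; have K'0 : 0 <= K' by rewrite !mulr_ge0.
pose D := K' * (1 + mb); have D0 : 0 <= D by rewrite mulr_ge0// ltW.
pose C := D * ((1 + lam) / lam).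
have C0 : 0 <= C.
  by rewrite mulr_ge0// divr_ge0 ?(ltW lam0)// addr_ge0// ltW.
exists C => [|t Tt]; first exact: C0.
pose E a := expR (- lam * (s t - s a)).
have E0 a : 0 <= E a := expR_ge0 _.
have Ele a b : ts_set T a -> a <= b -> E a <= E b.
  move=> Ta ab; rewrite /E ler_expR !mulNr lerN2; apply: ler_wpM2l; first exact: ltW.
  by rewrite lerB// clock_le//; exact: ts_ge0 Ta.
have Esub a b : E b - E a = E b * (1 - expR (- lam * (s b - s a))).
  by rewrite mulrBr mulr1 /E -expRD; congr (_ - expR _); ring.
have inc a b : ts_set T a -> ts_set T b -> a <= b -> b <= t ->
    `|X t *m P *m c b - X t *m P *m c a| <= K' * E b * (b - a).
  move=> Ta Tb ab bt.
  have -> : K' * E b * (b - a) = n%:R * (k * E b) * F0 * (b - a) by rewrite /K'; ring.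
  apply: c_inc => [//|//|//||r Tr ar rb]; first by rewrite mulr_ge0.
  (* As [b] lies in [T], [sigma T r] does not pass it, and the right-end value [E b] bounds the
     exponential on the whole step. *)
  have sb : sigma T r <= b by exact: sigma_le.
  apply: le_trans (greenP Tt (sigma_in T r) (le_trans sb bt)) _.
  apply: ler_wpM2l; first exact: k0.
  by apply: Ele => //; exact: sigma_in.
have inc2 a b : ts_set T a -> ts_set T b -> a <= b -> b <= t -> b - a <= 1 + mb ->
    `|X t *m P *m c b - X t *m P *m c a| <= C * (E b - E a).
  move=> Ta Tb ab bt ba; apply: le_trans (inc a b Ta Tb ab bt) _.
  have x0 : 0 <= (b - a) / (1 + mb) by rewrite divr_ge0 ?subr_ge0// ltW.
  have x1 : (b - a) / (1 + mb) <= 1 by rewrite ler_pdivrMr// mul1r.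
  have xy : (b - a) / (1 + mb) <= s b - s a.
    by have /andP[] := clock_bounds (M := mb) (ts_ge0 Ta) ab (fun r Tr _ _ => mbT r Tr).
  rewrite Esub; apply: le_trans (exp_gap_mul D0 (E0 b) x0 x1 xy).
  rewrite le_eqVlt; apply/orP; left; apply/eqP; rewrite /D; field.
  by rewrite gt_eqF.
have t0 := ts_ge0 Tt; have T0 := ts_0 T.
have normB (a b : R) := lerB_dist (X t *m P *m c b) (X t *m P *m c a).
have h : `|X t *m P *m c t| - C * E t <= `|X t *m P *m c 0| - C * E 0.
  apply: (@ts_nonincreasing _ T (fun a => `|X t *m P *m c a| - C * E a) K' 0 t T0 Tt t0 K'0).
  - move=> a Ta _ at_ as_; have bt := sigma_le Tt at_.
    have sb : sigma T a - a <= 1 + mb by apply: le_trans (mbT a Ta) _; rewrite lerDr.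
    exact: step_le (normB a (sigma T a)) (inc2 a (sigma T a) Ta (sigma_in T a) (ltW as_) bt sb).
  - move=> a Ta _ at_ sa; exists 1 => [|u Tu au ua ut]; first exact: ltr01.
    have sb : u - a <= 1 + mb.
      by rewrite lerBlDl; apply: le_trans (ltW ua) _; rewrite lerD2l lerDl.
    exact: step_le (normB a u) (inc2 a u Ta Tu (ltW au) ut sb).
  - move=> u v Tu Tv u0 uv vt.
    have E1 : E v <= 1 by exact: expR_clock_le1.
    have h2 : K' * E v * (v - u) <= K' * (v - u).
      by apply: ler_wpM2r; [rewrite subr_ge0 | rewrite ler_piMr].
    have h3 := ler_wpM2l C0 (Ele u v Tu uv).
    exact: lip_le h3 (le_trans (normB u v) (le_trans (inc u v Tu Tv uv vt) h2)).
have Et : E t = 1 by rewrite /E subrr mulr0 expR0.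
move: h; rewrite c0 mulmx0 normr0 Et mulr1 sub0r => h.
rewrite -subr_le0; apply: le_trans h _.
by rewrite oppr_le0 mulr_ge0.
Qed.

(** The same comparison with [a] running upwards from [t] and [E] decreasing, so that the bound does
    not depend on [N]. Gaps may be long here and are treated apart from short steps. *)
Lemma green_bound_unstable :
  exists2 C, 0 <= C & forall t N, ts_set T t -> ts_set T N -> t <= N ->
  `|X t *m (1%:M - P) *m c N - X t *m (1%:M - P) *m c t| <= C.
Proof.
have K1_ge0 : 0 <= K1.
  apply: le_trans (AK1 (ts_0 T)); rewrite mulr_ge0// addr_ge0//.
  exact: graininess_ge0.
pose K' := n%:R * k * F0; have K'0 : 0 <= K' by rewrite !mulr_ge0.
pose K'' := n%:R * (n%:R * k * K1) * F0; have K''0 : 0 <= K'' by rewrite !mulr_ge0.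
(* [2 * K'] serves steps of length at most 1, on which the clock runs at half speed or more, and
   [K''] serves single gaps of any length. *)
pose D := 2 * K' + K''; have D0 : 0 <= D by rewrite addr_ge0// mulr_ge0.
have DK : 2 * K' <= D by rewrite lerDl.
have DK' : K'' <= D by rewrite lerDr mulr_ge0.
pose C := D * ((1 + lam) / lam).
have C0 : 0 <= C.
  by rewrite mulr_ge0// divr_ge0 ?(ltW lam0)// addr_ge0// ltW.
exists C => [|t N Tt TN tN]; first exact: C0.
pose E a := expR (- lam * (s a - s t)).
have E0 a : 0 <= E a := expR_ge0 _.
have Ele a b : ts_set T a -> a <= b -> E b <= E a.
  move=> Ta ab; rewrite /E ler_expR !mulNr lerN2; apply: ler_wpM2l; first exact: ltW.
  by rewrite lerB// clock_le//; exact: ts_ge0 Ta.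
have Esub a b : E a - E b = E a * (1 - expR (- lam * (s b - s a))).
  by rewrite mulrBr mulr1 /E -expRD; congr (_ - expR _); ring.
set Q := 1%:M - P.
have inc a b : ts_set T a -> ts_set T b -> t <= a -> a <= b ->
    `|X t *m Q *m c b - X t *m Q *m c a| <= K' * E a * (b - a).
  move=> Ta Tb ta ab.
  have -> : K' * E a * (b - a) = n%:R * (k * E a) * F0 * (b - a) by rewrite /K'; ring.
  apply: c_inc => [//|//|//||r Tr ar rb]; first by rewrite mulr_ge0.
  have as_ := le_trans ar (sigma_ge T r).
  apply: le_trans (greenQ Tt (sigma_in T r) (le_trans ta as_)) _.
  by apply: ler_wpM2l; [exact: k0 | exact: Ele].
have inc2 a b : ts_set T a -> ts_set T b -> t <= a -> a <= b -> b - a <= 1 ->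
    `|X t *m Q *m c b - X t *m Q *m c a| <= C * (E a - E b).
  move=> Ta Tb ta ab ba; apply: le_trans (inc a b Ta Tb ta ab) _.
  have x0 : 0 <= (b - a) / 2 by rewrite divr_ge0// subr_ge0.
  have x1 : (b - a) / 2 <= 1.
    by rewrite ler_pdivrMr// mul1r; apply: le_trans ba _; rewrite ler1n.
  have xy : (b - a) / 2 <= s b - s a.
    have /andP[+ _] : (b - a) / (1 + 1) <= s b - s a <= b - a.
      apply: clock_bounds => [|//|r Tr]; first exact: ts_ge0 Ta.
      rewrite ts_floor_id// => ar rb; apply: le_trans ba; rewrite lerB//.
      exact: sigma_le Tb rb.
    by [].
  rewrite Esub; apply: le_trans (exp_gap_mul D0 (E0 a) x0 x1 xy).
  have -> : K' * E a * (b - a) = 2 * K' * E a * ((b - a) / 2) by field.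
  by apply: ler_wpM2r; [exact: x0 | apply: ler_wpM2r; [exact: E0 | exact: DK]].
(* Factoring [(E + mu A)^-1] out of the inverse of [X] at [sigma T a] gains [K1 / (1 + mu)]. This
   turns the length [mu] into [mu / (1 + mu) <= ln (1 + mu)], at most the clock length of the
   gap. *)
have incs a : ts_set T a -> t <= a ->
    `|X t *m Q *m c (sigma T a) - X t *m Q *m c a| <= C * (E a - E (sigma T a)).
  move=> Ta ta; have m0 := graininess_ge0 T a; have Ts := sigma_in T a.
  have m10 : 0 < 1 + graininess T a by rewrite ltr_pwDl.
  have h1 : `|X t *m Q *m c (sigma T a) - X t *m Q *m c a| <=
      n%:R * (n%:R * (k * E a) * (K1 / (1 + graininess T a))) * F0 * (sigma T a - a).
    apply: c_inc => [//|//||| r Tr ar rs]; first exact: sigma_ge.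
      by apply: mulr_ge0; [rewrite !mulr_ge0 | rewrite divr_ge0// ltW].
    have -> : r = a.
      by apply/le_anti; rewrite ar andbT leNgt; apply/negP => /(sigma_le Tr); rewrite leNgt rs.
    have [hs _ _] := flowX.
    have -> : invmx (X (sigma T a)) = invmx (X a) *m invmx (1%:M + graininess T a *: A a).
      have e1 : X (sigma T a) = (1%:M + graininess T a *: A a) *m X a.
        by rewrite hs// mulmxDl mul1mx -scalemxAl.
      have e2 : X (sigma T a) *m (invmx (X a) *m invmx (1%:M + graininess T a *: A a)) = 1%:M.
        by rewrite e1 -mulmxA (mulmxA (X a)) mulmxV ?Xu// mul1mx mulmxV ?regA.
      by rewrite -[RHS](mulKmx (Xu Ts)) e2 mulmx1.
    rewrite mulmxA; apply: le_trans (mx_norm_mul _ _) _; apply: ler_pM.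
    - by rewrite mulr_ge0.
    - exact: normr_ge0.
    - by apply: ler_wpM2l; [exact: ler0n | exact: greenQ].
    - by rewrite ler_pdivlMr// mulrC; exact: AK1.
  apply: le_trans h1 _; rewrite Esub clock_sigma//.
  have x0 : 0 <= graininess T a / (1 + graininess T a) by rewrite divr_ge0// ltW.
  have x1 : graininess T a / (1 + graininess T a) <= 1.
    by rewrite ler_pdivrMr// mul1r lerDr.
  apply: le_trans (exp_gap_mul D0 (E0 a) x0 x1 (ln1D_ge m0)).
  rewrite -/(graininess T a).
  have -> : n%:R * (n%:R * (k * E a) * (K1 / (1 + graininess T a))) * F0 * graininess T a =
    K'' * E a * (graininess T a / (1 + graininess T a)) by rewrite /K''; ring.
  by apply: ler_wpM2r; [exact: x0 | apply: ler_wpM2r; [exact: E0 | exact: DK']].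
have normB (a b : R) : `|X t *m Q *m c b - X t *m Q *m c t| -
    `|X t *m Q *m c a - X t *m Q *m c t| <= `|X t *m Q *m c b - X t *m Q *m c a|.
  have -> : X t *m Q *m c b - X t *m Q *m c a = (X t *m Q *m c b - X t *m Q *m c t) -
      (X t *m Q *m c a - X t *m Q *m c t) by rewrite opprB addrA subrK.
  exact: lerB_dist.
have h : `|X t *m Q *m c N - X t *m Q *m c t| + C * E N <=
    `|X t *m Q *m c t - X t *m Q *m c t| + C * E t.
  apply: (@ts_nonincreasing _ T
    (fun a => `|X t *m Q *m c a - X t *m Q *m c t| + C * E a) K' t N Tt TN tN K'0).
  - move=> a Ta ta aN as_.
    exact: step_ge (normB a (sigma T a)) (incs a Ta ta).
  - move=> a Ta ta aN sa; exists 1 => [|u Tu au ua ut]; first exact: ltr01.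
    have sb : u - a <= 1 by rewrite lerBlDl ltW.
    exact: step_ge (normB a u) (inc2 a u Ta Tu ta (ltW au) sb).
  - move=> u v Tu Tv tu uv vt.
    have E1 : E u <= 1 by exact: expR_clock_le1.
    have h2 : K' * E u * (v - u) <= K' * (v - u).
      by apply: ler_wpM2r; [rewrite subr_ge0 | rewrite ler_piMr].
    have h3 := ler_wpM2l C0 (Ele u v Tu uv).
    exact: lip_ge h3 (le_trans (normB u v) (le_trans (inc u v Tu Tv tu uv) h2)).
have Et : E t = 1 by rewrite /E subrr mulr0 expR0.
move: h; rewrite subrr normr0 Et mulr1 add0r; apply: le_trans.
by rewrite lerDl mulr_ge0.
Qed.

Lemma bounded_initial_value : X 0 = 1%:M -> exists (x0 : 'cV[R]_n) (B : R),
  forall t, ts_set T t -> `|X t *m (c t + x0)| <= B.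
Proof.
move=> X0; have [CP CP0 hP] := green_bound_stable; have [CQ CQ0 hQ] := green_bound_unstable.
have /choice[N hN] : forall i : nat, exists b, ts_set T b /\ i%:R < b.
  by move=> i; have [b Tb ib] := ts_unbounded T i%:R; exists b.
(* The unstable bound between 0 and [N i] bounds these vectors, which therefore have a cluster
   value. They are transposed because [bounded_closed_compact] concerns row vectors. *)
pose w i : 'rV[R]_n := (- ((1%:M - P) *m c (N i)))^T.
have wb i : `|w i| <= CQ.
  have := hQ 0 (N i) (ts_0 T) (hN i).1 (ts_ge0 (hN i).1).
  rewrite X0 mul1mx c0 mulmx0 subr0 => h.
  apply: mx_norm_le => [|a b]; first exact: CQ0.
  rewrite !mxE normrN; apply: le_trans h.
  by have := mx_norm_entry ((1%:M - P) *m c (N i)) b a; rewrite mxE.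
have cS : compact [set v : 'rV[R]_n | `|v| <= CQ].
  apply: bounded_closed_compact.
    by exists CQ; split => [|M CM v /= vC]; [exact: num_real | exact: le_trans vC (ltW CM)].
  apply: (@closed_comp _ _ (fun v : 'rV[R]_n => `|v|) [set y : R | y <= CQ]).
    by move=> v _; exact: norm_continuous.
  exact: closed_le.
have [p [_ clp]] : [set v : 'rV[R]_n | `|v| <= CQ] `&` cluster (w @ \oo) !=set0.
  by apply: cS; exists 0%N => // i _; exact: wb.
exists p^T, (CP + CQ) => t Tt; apply/ler_addgt0Pr => e e0.
have nX : 0 <= n%:R * `|X t| by rewrite mulr_ge0.
have nX1 : 0 < n%:R * `|X t| + 1 by rewrite ltr_wpDl.
have e1 : 0 < e / (n%:R * `|X t| + 1) by rewrite divr_gt0.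
have [i0 hi0] : exists i0 : nat, t <= i0%:R.
  by exists (Num.bound t); apply/ltW; apply: archi_boundP; exact: ts_ge0 Tt.
have [||v [[i i0i ->]]] := clp [set v | exists2 i, (i0 <= i)%N & v = w i]
    (ball p (e / (n%:R * `|X t| + 1))).
- by exists i0 => // i i0i; exists i.
- exact: nbhsx_ballx.
rewrite -ball_normE /= => /ltW pw.
have tNi : t <= N i.
  apply: le_trans hi0 _; apply: ltW; apply: le_lt_trans (hN i).2.
  by rewrite ler_nat.
(* The stable part up to [t], the unstable part between [t] and [N i], and an error that is small
   because [w i] is close to [p]. The index [i] depends on [t], the bounds do not. *)
have -> : X t *m (c t + p^T) = X t *m P *m c t -
    (X t *m (1%:M - P) *m c (N i) - X t *m (1%:M - P) *m c t) + X t *m (p - w i)^T.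
  rewrite [(p - w i)^T]linearB /= /w trmxK opprK -!mulmxA -!mulmxBr -mulmxDr.
  congr (_ *m _); rewrite !mulmxBl !mul1mx !mulmxBr.
  move: (P *m c t) (P *m c (N i)) => y1 y2.
  by apply/matrixP => a b; rewrite !mxE; ring.
apply: le_trans (ler_normD _ _) _; apply: lerD.
  apply: le_trans (ler_normB _ _) _; apply: lerD; first exact: hP.
  by apply: hQ => //; exact: (hN i).1.
apply: le_trans (mx_norm_mul _ _) _.
have h : `|(p - w i)^T| <= e / (n%:R * `|X t| + 1).
  apply: mx_norm_le => [|a b]; first exact: ltW.
  by rewrite mxE; apply: le_trans (mx_norm_entry _ _ _) pw.
apply: le_trans (ler_wpM2l nX h) _.
by apply: ler_mulDl1 => //; exact: ltW.
Qed.

End green_bounds.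

(** * The inhomogeneous equation in integral form *)

Section variation_of_constants.
Context {R : realType} (T : timeScale R) {n : nat}.
Variables (A X : R -> 'M[R]_n) (f c : R -> 'cV[R]_n) (K F0 : R).
Hypothesis AK : forall t, ts_set T t -> `|A t| <= K.
Hypothesis rdA : rd_continuous T A.
Hypothesis mA : forall b i j, measurable_fun (ts_set T `&` `[0, b[) (fun t => A t i j).
Hypothesis flowX : delta_flow T A X.
Hypothesis Xu : forall t, ts_set T t -> X t \in unitmx.
Hypothesis invX_bounded : forall N, exists2 B, 0 <= B &
  forall t, ts_set T t -> t <= N -> `|invmx (X t)| <= B.
Hypothesis mf : forall i, measurable_fun (ts_set T) (fun t => f t i 0).
Hypothesis fF0 : forall t, ts_set T t -> `|f t| <= F0.
Hypothesis cE : forall t, c t = delta_integral T t (fun u => invmx (X (sigma T u)) *m f u).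

Let F0_ge0 : 0 <= F0.
Proof. exact: le_trans (normr_ge0 _) (fF0 (ts_0 T)). Qed.

Let K_ge0 : 0 <= K.
Proof. exact: le_trans (normr_ge0 _) (AK (ts_0 T)). Qed.

Let lipX : ts_lipschitz T X.
Proof. by case: flowX. Qed.

Let lipV : ts_lipschitz T (fun t => invmx (X t)).
Proof. by apply: ts_lipschitz_invmx => //; exact: invX_bounded. Qed.

Let g_bounded N : exists2 B, 0 <= B & forall t, ts_set T t -> t < N ->
  `|invmx (X (sigma T t)) *m f t| <= B.
Proof.
have [B B0 hB] := invX_bounded (sigma T N); exists (n%:R * B * F0); first by rewrite !mulr_ge0.
move=> t Tt tN; apply: le_trans (mx_norm_mul _ _) _; apply: ler_pM; rewrite ?mulr_ge0 ?fF0//.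
apply: ler_wpM2l => //; apply: hB; first exact: sigma_in.
by apply: sigma_nondecreasing; exact: ltW.
Qed.

Let measurable_f b i j : measurable_fun (ts_set T `&` `[0, b[) (fun t => f t i j).
Proof.
rewrite ord1; apply: (measurable_funS _ _ (mf i)); first exact: measurable_time_scale.
exact: subIsetl.
Qed.

Lemma forcing_integrable b : ts_set T b ->
  delta_integrable T b (fun u => invmx (X (sigma T u)) *m f u).
Proof.
move=> Tb i; apply: delta_integrable_bounded => //; [exact: ts_0 | exact: ts_ge0 Tb | | ].
  apply: measurable_mulmx; last exact: measurable_f.
  move=> i' j'.
  apply: (@measurable_comp _ _ _ _ _ _ (ts_set T `&` `[0, (sigma T b + 1)[)
    (fun t => invmx (X t) i' j') _ (sigma T)).
  - exact: measurable_ts_itv.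
  - move=> y [u [Tu]] /=; rewrite in_itv /= => /andP[u0 ub] <-; split; first exact: sigma_in.
    rewrite /= in_itv /= (ts_ge0 (sigma_in T u)) /=.
    by apply: le_lt_trans (sigma_nondecreasing T (ltW ub)) _; rewrite ltrDl.
  - exact: ts_lipschitz_measurable.
  - exact: measurable_funTS (measurable_sigma T).
have [B B0 hB] := g_bounded b; exists B => t Tt _ tb.
by apply: le_trans (mx_norm_entry _ _ _) _; exact: hB.
Qed.

Let c_mean p (M : 'M[R]_(p, n)) (v : 'cV[R]_p) (e a b : R) :
  ts_set T a -> ts_set T b -> a <= b -> 0 <= e ->
  (forall t, ts_set T t -> a <= t -> t < b ->
    `|M *m (invmx (X (sigma T t)) *m f t) - v| <= e) ->
  `|M *m c b - M *m c a - (b - a) *: v| <= e * (b - a).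
Proof.
move=> Ta Tb ab e0 h.
have [ig eb] := delta_integral_mulmx M (forcing_integrable Tb).
have [_ ea] := delta_integral_mulmx M (forcing_integrable Ta).
by rewrite !cE -eb -ea; exact: delta_integral_mean.
Qed.

Lemma forcing_increment (M : 'M[R]_n) (e a b : R) :
  ts_set T a -> ts_set T b -> a <= b -> 0 <= e ->
  (forall t, ts_set T t -> a <= t -> t < b -> `|M *m invmx (X (sigma T t))| <= e) ->
  `|M *m c b - M *m c a| <= n%:R * e * F0 * (b - a).
Proof.
move=> Ta Tb ab e0 h.
have := @c_mean _ M 0 (n%:R * e * F0) a b Ta Tb ab; rewrite scaler0 subr0.
apply=> [|t Tt at_ tb]; first by rewrite !mulr_ge0.
rewrite subr0 mulmxA; apply: le_trans (mx_norm_mul _ _) _.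
apply: ler_pM; [by rewrite mulr_ge0 | exact: normr_ge0 | | exact: fF0].
by apply: ler_wpM2l; [exact: ler0n | exact: h].
Qed.

Lemma forcing_lipschitz : ts_lipschitz T c.
Proof.
move=> N; have [B B0 hB] := g_bounded N; exists B => [//|a b Ta Tb ab bN].
have := @c_mean _ 1%:M 0 B a b Ta Tb ab B0; rewrite !mul1mx scaler0 subr0; apply => t Tt _ tb.
by rewrite mul1mx subr0; apply: hB => //; exact: lt_le_trans bN.
Qed.

Variable x0 : 'cV[R]_n.
Let x t := X t *m (c t + x0).
Let h u := A u *m x u + f u.

Let lipx : ts_lipschitz T x.
Proof.
by apply: ts_lipschitz_mul => //; apply: ts_lipschitz_addr; exact: forcing_lipschitz.
Qed.

Let h_integrable b : ts_set T b -> delta_integrable T b h.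
Proof.
move=> Tb i; have [B B0 hB] := ts_lipschitz_bounded lipx b.
apply: delta_integrable_bounded => //; [exact: ts_0 | exact: ts_ge0 Tb | | ].
  have mx i' j' : measurable_fun (ts_set T `&` `[0, b[) (fun t => x t i' j').
    exact: ts_lipschitz_measurable.
  have mAx := measurable_mulmx (@mA b) mx.
  rewrite (_ : (fun u => h u i 0) = (fun u => (A u *m x u) i 0) \+ (fun u => f u i 0)).
    by apply: measurable_funD.
  by apply/funext => u; rewrite /h [LHS]mxE.
exists (n%:R * K * B + F0) => t Tt _ tb.
apply: le_trans (mx_norm_entry _ _ _) _; apply: le_trans (ler_normD _ _) _.
apply: lerD; last exact: fF0.
apply: le_trans (mx_norm_mul _ _) _; apply: ler_pM; rewrite ?mulr_ge0//.
  by apply: ler_wpM2l => //; exact: AK.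
by apply: hB => //; exact: ltW.
Qed.

Let D t := x t - x 0 - delta_integral T t h.

(** Between [t] and [sigma T t] the integrals see only the point [t], so the mean value estimates
    hold with [e = 0]. As [c] carries the inverse of [X] at [sigma T t], its jump multiplied by
    [X (sigma T t)] is exactly [mu f(t)]. *)
Let D_gap t : ts_set T t -> D (sigma T t) = D t.
Proof.
move=> Tt; have Ts := sigma_in T t; have ts := sigma_ge T t.
have only u : ts_set T u -> t <= u -> u < sigma T t -> u = t.
  move=> Tu tu us; apply/le_anti; rewrite tu andbT leNgt; apply/negP => /(sigma_le Tu).
  by rewrite leNgt us.
have hc : X (sigma T t) *m c (sigma T t) =
    X (sigma T t) *m c t + (sigma T t - t) *: f t.
  apply/eqP; rewrite -subr_eq0 opprD addrA -normr_le0.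
  apply: le_trans (@c_mean _ (X (sigma T t)) (f t) 0 t (sigma T t) Tt Ts ts (lexx 0) _) _.
    move=> u Tu tu us; rewrite (only u Tu tu us) mulmxA mulmxV ?Xu// mul1mx subrr normr0.
    exact: lexx.
  by rewrite mul0r.
have hh : delta_integral T (sigma T t) h = delta_integral T t h + (sigma T t - t) *: h t.
  apply/eqP; rewrite -subr_eq0 opprD addrA -normr_le0.
  apply: le_trans (@delta_integral_mean _ T _ h (h t) 0 t (sigma T t) Tt Ts ts (lexx 0)
    (h_integrable Ts) _) _.
    by move=> u Tu tu us; rewrite (only u Tu tu us) subrr normr0 lexx.
  by rewrite mul0r.
have [hX _ _] := flowX.
have ex : x (sigma T t) = x t + (sigma T t - t) *: h t.
  rewrite /x mulmxDr hc addrAC -mulmxDr hX// mulmxDl -scalemxAl -mulmxA.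
  by rewrite /h /x scalerDr addrA.
by rewrite /D hh ex; apply/matrixP => i j; rewrite !entryE; ring.
Qed.

Let D_lipschitz : ts_lipschitz T D.
Proof.
move=> N; have [L L0 hL] := lipx N; have [B B0 hB] := ts_lipschitz_bounded lipx N.
have E0 : 0 <= n%:R * K * B + F0 by rewrite addr_ge0// !mulr_ge0.
exists (L + (n%:R * K * B + F0)) => [|a b Ta Tb ab bN]; first exact: addr_ge0.
have -> : D b - D a = (x b - x a) - (delta_integral T b h - delta_integral T a h - (b - a) *: 0).
  by rewrite /D; apply/matrixP => i j; rewrite !mxE; ring.
apply: le_trans (ler_normB _ _) _; rewrite mulrDl; apply: lerD; first exact: hL.
apply: delta_integral_mean => [//|//|//|//||t Tt at_ tb]; first exact: h_integrable.
rewrite subr0; apply: le_trans (ler_normD _ _) _; apply: lerD; last exact: fF0.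
apply: le_trans (mx_norm_mul _ _) _; apply: ler_pM; rewrite ?mulr_ge0//.
  by apply: ler_wpM2l => //; exact: AK.
by apply: hB => //; apply: ltW; exact: lt_le_trans bN.
Qed.

(* The jumps of [c] cancel the forcing term: the integrand [q] below is close to
   [A t *m x t] although [f] is only measurable. *)
Let D_flat t (e : R) : ts_set T t -> sigma T t = t -> 0 < e ->
  exists2 d, 0 < d & forall u, ts_set T u -> t < u -> u < t + d ->
    `|D u - D t| <= e * (u - t).
Proof.
move=> Tt st e0; pose N := t + 1.
(* Five errors, with factors [m1] to [m5]: the right derivative of [X] and the variations of [c],
   [A], [x] and [X] after [t]. *)
have e5 : 0 < e / 5 by rewrite divr_gt0.
have [Bx Bx0 hBx] := ts_lipschitz_bounded lipx N.
have [By By0 hBy] := ts_lipschitz_bounded (ts_lipschitz_addr x0 forcing_lipschitz) N.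
have [BV BV0 hBV] := invX_bounded (sigma T N).
pose W := A t *m X t.
pose m1 := n%:R * By; have m10 : 0 <= m1 by rewrite mulr_ge0.
pose m2 := n%:R * `|W|; have m20 : 0 <= m2 by rewrite mulr_ge0.
pose m3 := n%:R * Bx; have m30 : 0 <= m3 by rewrite mulr_ge0.
pose m4 := n%:R * `|A t|; have m40 : 0 <= m4 by rewrite mulr_ge0.
pose m5 := n%:R * (n%:R * BV) * F0; have m50 : 0 <= m5 by rewrite !mulr_ge0.
have dv m : 0 <= m -> 0 < e / 5 / (m + 1) by move=> m0; rewrite divr_gt0// ltr_wpDl.
have [_ _ /(_ t _ Tt st (dv _ m10)) [d1 d10 hd1]] := flowX.
have [d2 d20 hd2] := ts_lipschitz_small N (dv _ m20) (ts_lipschitz_addr x0 forcing_lipschitz).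
have [d3 d30 hd3] := rd_continuous_right rdA (dv _ m30) Tt st.
have [d4 d40 hd4] := ts_lipschitz_small N (dv _ m40) lipx.
have [d5 d50 hd5] := ts_lipschitz_small N (dv _ m50) lipX.
exists (Num.min (Num.min (Num.min d1 d2) (Num.min d3 d4)) (Num.min d5 1)).
  by rewrite !lt_min d10 d20 d30 d40 d50 ltr01.
move=> u Tu tu; rewrite -ltrBlDl !lt_min !ltrBlDl.
move=> /andP[/andP[/andP[u1 u2] /andP[u3 u4]] /andP[u5 uN]].
have ut0 : 0 <= u - t by rewrite subr_ge0 ltW.
have hA r : ts_set T r -> t <= r -> r < u -> `|A r - A t| <= e / 5 / (m3 + 1).
  move=> Tr; rewrite le_eqVlt => /predU1P[<- _|tr ru].
    by rewrite subrr normr0 ltW// dv.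
  by apply: hd3 => //; exact: lt_trans u3.
pose q r := h r - X t *m (invmx (X (sigma T r)) *m f r).
have [iXg eXg] := delta_integral_mulmx (X t) (forcing_integrable Tu).
have [iq eq] := delta_integralB (h_integrable Tu) iXg.
have [iXg' eXg'] := delta_integral_mulmx (X t) (forcing_integrable Tt).
have [_ eq'] := delta_integralB (h_integrable Tt) iXg'.
have q_near r : ts_set T r -> t <= r -> r < u ->
    `|q r - A t *m x t| <= e / 5 + e / 5 + e / 5.
  move=> Tr tr ru; have Ts := sigma_in T r.
  have su : sigma T r <= u by exact: sigma_le.
  have -> : q r - A t *m x t = (A r - A t) *m x r + A t *m (x r - x t) +
      (X (sigma T r) - X t) *m invmx (X (sigma T r)) *m f r.
    rewrite /q /h [(X (sigma T r) - X t) *m _]mulmxBl mulmxV ?Xu// !mulmxBl !mulmxBr mul1mx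
      [X t *m (_ *m f r)]mulmxA.
    by apply/matrixP => i j; rewrite !entryE; ring.
  apply: le_trans (ler_normD _ _) _; apply: lerD; first (apply: le_trans (ler_normD _ _) _; apply: lerD).
  - apply: le_trans (mx_norm_mul _ _) _.
    apply: (@le_trans _ _ (m3 * `|A r - A t|)).
      rewrite /m3 mulrAC; apply: ler_wpM2r => //; apply: ler_wpM2l => //.
      by apply: hBx => //; apply: le_trans (ltW ru) (ltW uN).
    by apply: ler_mulDl1_le => //; [exact: ltW | exact: hA].
  - apply: le_trans (mx_norm_mul _ _) _; apply: ler_mulDl1_le => //; first exact: ltW.
    by apply: hd4 => //; [apply: le_trans (ltW ru) (ltW uN) | exact: lt_trans u4].
  - apply: (@le_trans _ _ (m5 * `|X (sigma T r) - X t|)).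
      apply: le_trans (mx_norm_mul _ _) _.
      have -> : m5 * `|X (sigma T r) - X t| =
        n%:R * (n%:R * `|X (sigma T r) - X t| * BV) * F0 by rewrite /m5; ring.
      apply: ler_pM; rewrite ?mulr_ge0 ?fF0//; apply: ler_wpM2l => //.
      apply: le_trans (mx_norm_mul _ _) _; apply: ler_wpM2l; first by rewrite mulr_ge0.
      apply: hBV => //; apply: sigma_nondecreasing; exact: le_trans (ltW ru) (ltW uN).
    apply: ler_mulDl1_le => //; first exact: ltW.
    apply: hd5 => //; [exact: le_trans tr (sigma_ge _ _) | exact: le_trans su (ltW uN) |].
    exact: le_lt_trans su u5.
have e15 : 0 <= e / 5 + e / 5 + e / 5 by rewrite !addr_ge0// ltW.
have := @delta_integral_mean _ T _ q (A t *m x t) _ t u Tt Tu (ltW tu) e15 iq q_near.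
rewrite /q eq eq' eXg eXg' -!cE => hq.
pose y r := c r + x0.
have -> : D u - D t = (X u - X t - (u - t) *: W) *m y u + (u - t) *: (W *m (y u - y t)) -
    (delta_integral T u h - X t *m c u - (delta_integral T t h - X t *m c t) -
       (u - t) *: (A t *m x t)).
  have -> : A t *m x t = W *m y t by rewrite /W /x mulmxA.
  have -> : D u - D t = X u *m y u - X t *m y t - (delta_integral T u h - delta_integral T t h).
    by rewrite /D /x; apply/matrixP => i j; rewrite !entryE; ring.
  rewrite !mulmxBl mulmxBr -scalemxAl.
  have -> : X t *m y t = X t *m c t + X t *m x0 by rewrite mulmxDr.
  have -> : X t *m y u = X t *m c u + X t *m x0 by rewrite mulmxDr.
  rewrite scalerBr.
  by apply/matrixP => i j; rewrite !entryE; ring.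
have p1 : `|(X u - X t - (u - t) *: W) *m y u| <= e / 5 * (u - t).
  apply: le_trans (mx_norm_mul _ _) _.
  apply: (@le_trans _ _ (m1 * (e / 5 / (m1 + 1)) * (u - t))); last first.
    by apply: ler_wpM2r => //; apply: ler_mulDl1_le => //; exact: ltW.
  have -> : m1 * (e / 5 / (m1 + 1)) * (u - t) = n%:R * (e / 5 / (m1 + 1) * (u - t)) * By.
    by rewrite /m1; ring.
  apply: ler_pM; [by rewrite mulr_ge0 | exact: normr_ge0 | | ].
    by apply: ler_wpM2l => //; exact: hd1.
  by apply: hBy => //; exact: ltW.
have p2 : `|(u - t) *: (W *m (y u - y t))| <= e / 5 * (u - t).
  rewrite mx_normZ (ger0_norm ut0) mulrC; apply: ler_wpM2r => //.
  apply: le_trans (mx_norm_mul _ _) _; apply: ler_mulDl1_le => //; first exact: ltW.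
  by apply: hd2 => //; exact: ltW.
have -> : e * (u - t) = e / 5 * (u - t) + e / 5 * (u - t) +
    (e / 5 + e / 5 + e / 5) * (u - t) by field.
apply: le_trans (ler_normB _ _) _; apply: lerD; last exact: hq.
by apply: le_trans (ler_normD _ _) _; exact: lerD.
Qed.

Let drift_le (p q e a b : R) : p - q <= e * (b - a) -> p - e * b <= q - e * a.
Proof. lra. Qed.

Let drift_lip (p q e a b w : R) : 0 <= e -> a <= b -> p - q <= w ->
  (p - e * b) - (q - e * a) <= w.
Proof. by move=> e0 ab; have := ler_wpM2l e0 ab; lra. Qed.

Let drift_lim (p q e e' t : R) : p - e' * t <= q - e' * 0 -> t * e' <= e -> p <= q + e.
Proof. lra. Qed.

(** Row functionals reduce the vector [D] to real functions, to which the induction principle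
    applies after a drift [- e a] has absorbed the error of [D_flat]. Taking [v] and [- v] makes [D]
    constant. *)
Let D_le0 (v : 'M[R]_(1, n)) t : ts_set T t -> (v *m D t) 0 0 <= (v *m D 0) 0 0.
Proof.
move=> Tt; have t0 := ts_ge0 Tt.
pose m := n%:R * `|v|; have m0 : 0 <= m by rewrite mulr_ge0.
have vD a b : (v *m D b) 0 0 - (v *m D a) 0 0 <= m * `|D b - D a|.
  have -> : (v *m D b) 0 0 - (v *m D a) 0 0 = (v *m (D b - D a)) 0 0.
    by rewrite [in RHS]mulmxBr addmxE oppmxE.
  apply: le_trans (ler_norm _) _; apply: le_trans (mx_norm_entry _ _ _) _.
  exact: mx_norm_mul.
have [L L0 hL] := D_lipschitz t.
have mL : 0 <= m * L by exact: mulr_ge0.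
suff hs e : 0 < e -> (v *m D t) 0 0 - e * t <= (v *m D 0) 0 0 - e * 0.
  apply/ler_addgt0Pr => e e0; have t1 : 0 < t + 1 by rewrite ltr_wpDl.
  have te : t * (e / (t + 1)) <= e by apply: ler_mulDl1_le => //; exact: ltW.
  exact: drift_lim (hs _ (divr_gt0 e0 t1)) te.
move=> e0.
apply: (@ts_nonincreasing _ T (fun a => (v *m D a) 0 0 - e * a) (m * L) 0 t (ts_0 T) Tt t0 mL).
- move=> a Ta _ _ as_; rewrite D_gap// lerD2l lerN2.
  by apply: ler_wpM2l; exact: ltW.
- move=> a Ta _ at_ sa; have m1 : 0 < e / (m + 1) by rewrite divr_gt0// ltr_wpDl.
  have [d d0 hd] := D_flat Ta sa m1; exists d => // u Tu au ud _.
  have h1 : (v *m D u) 0 0 - (v *m D a) 0 0 <= e * (u - a).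
    apply: le_trans (vD a u) _; apply: le_trans (ler_wpM2l m0 (hd u Tu au ud)) _.
    rewrite mulrA; apply: ler_wpM2r; first by rewrite subr_ge0 ltW.
    by apply: ler_mulDl1_le => //; exact: ltW.
  exact: drift_le h1.
- move=> u w Tu Tw u0 uw wt.
  have h1 : (v *m D w) 0 0 - (v *m D u) 0 0 <= m * L * (w - u).
    apply: le_trans (vD u w) _; rewrite -mulrA; apply: ler_wpM2l => //; exact: hL.
  exact: drift_lip (ltW e0) uw h1.
Qed.

Lemma variation_of_constants : delta_solution T A f x.
Proof.
move=> t Tt; split; first exact: h_integrable.
have D0 : D 0 = 0 by rewrite /D delta_integral0 subrr subr0.
suff : D t = 0 by move=> /eqP; rewrite /D -addrA -opprD subr_eq0 => /eqP.
apply/matrixP => i j; rewrite ord1 [RHS]mxE; apply/le_anti/andP; split.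
  have := D_le0 (delta_mx 0 i) Tt.
  by rewrite D0 mulmx0 -rowE !mxE.
have := D_le0 (- delta_mx 0 i) Tt.
by rewrite D0 mulmx0 mulNmx -rowE !mxE oppr_le0.
Qed.

End variation_of_constants.

(** * Reduction of the theorem to the Green function *)

Section regressive_systems.
Context {R : realType} {n : nat}.

(** Monotone on all of [R], so that the clock is Borel measurable; at negative times it integrates
    over the empty interval. *)
Lemma clock_nondecreasing (T : timeScale R) : {homo ts_clock T : a b / a <= b}.
Proof.
have neg a : a < 0 -> ts_clock T a = 0.
  by move=> a0; rewrite /ts_clock set_itv_ge ?bnd_simp -?ltNge// Rintegral_set0.
move=> a b ab; have [a0|a0] := leP 0 a; first exact: clock_le.
rewrite neg//; have [b0|b0] := leP 0 b; first exact: clock_ge0.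
by rewrite neg.
Qed.

(** On [T] the matrix [A] is the locally integrable [A'] composed with the monotone clock, and
    inherits its measurability. *)
Lemma corresponding_ode_measurable (T : timeScale R) (mlog : 'M[R[i]]_n -> 'M[R[i]]_n)
    (A : R -> 'M[R]_n) (A' : R -> 'M[R[i]]_n) :
  corresponding_ode T mlog A A' -> locally_integrable_mx A' ->
  forall b i j, measurable_fun (ts_set T `&` `[0, b[) (fun t => A t i j).
Proof.
move=> [odeA _] iA b i j.
have mA : measurable_fun (ts_set T `&` `[0, b[)
    (fun t => complex.Re (A' (ts_clock T t) i j)).
  apply: (@measurable_comp _ _ _ _ _ _ `[0, ts_clock T b]%classic
    (fun u => complex.Re (A' u i j)) _ (ts_clock T)).
  - exact: measurable_itv.
  - move=> y [t [Tt]]; rewrite /= in_itv /= => /andP[t0 tb] <-.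
    by rewrite in_itv /= clock_ge0//= clock_nondecreasing// ltW.
  - have [h _] := iA (ts_clock T b) i j.
    by apply/measurable_EFinP; exact: measurable_int h.
  - apply: measurable_funTS; apply: nondecreasing_measurable => //.
    exact: clock_nondecreasing.
apply: eq_measurable_fun mA => t /set_mem [Tt _].
by rewrite odeA// mxE.
Qed.

Lemma regressive_inverse_bound (T : timeScale R) (A : R -> 'M[R]_n) :
  uniformly_regressive T A -> bounded_with_inverse T A ->
  exists K1, forall t, ts_set T t ->
    (1 + graininess T t) * `|invmx (1%:M + graininess T t *: A t)| <= K1.
Proof.
move=> [regA [KR hKR]] [uA [M hM]].
exists (KR + n%:R * M * (1 + KR)) => t Tt; have m0 := graininess_ge0 T t.
have {}hKR := hKR t Tt; have {}hM := hM t Tt; have {}uA := uA t Tt; have {}regA := regA t Tt.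
set V := invmx _ in hKR *.
have e : graininess T t *: V = invmx (A t) *m (1%:M - V).
  have : (1%:M + graininess T t *: A t) *m V = 1%:M by exact: mulmxV.
  rewrite mulmxDl mul1mx -scalemxAl => <-.
  by rewrite addrC addKr -scalemxAr mulKmx.
have h : graininess T t * `|V| <= n%:R * M * (1 + KR).
  rewrite -{1}(ger0_norm m0) -mx_normZ e; apply: le_trans (mx_norm_mul _ _) _.
  apply: ler_pM; rewrite ?mulr_ge0//.
    by apply: ler_wpM2l => //; apply: le_trans hM; rewrite lerDr.
  by apply: le_trans (ler_normB _ _) _; apply: lerD; first exact: mx_norm1.
by rewrite mulrDl mul1r; apply: lerD.
Qed.

Lemma bounded_solution_of_green (T : timeScale R) (A X : R -> 'M[R]_n) (P : 'M[R]_n)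
    (f : R -> 'cV[R]_n) (K1 k lam : R) :
  rd_continuous T A -> uniformly_regressive T A ->
  (exists K, forall t, ts_set T t -> `|A t| <= K) ->
  (forall b i j, measurable_fun (ts_set T `&` `[0, b[) (fun t => A t i j)) ->
  (forall t, ts_set T t ->
    (1 + graininess T t) * `|invmx (1%:M + graininess T t *: A t)| <= K1) ->
  delta_flow T A X -> X 0 = 1%:M -> (forall t, ts_set T t -> X t \in unitmx) ->
  0 <= k -> 0 < lam ->
  (forall t tau, ts_set T t -> ts_set T tau -> tau <= t ->
    `|X t *m P *m invmx (X tau)| <= k * expR (- lam * (ts_clock T t - ts_clock T tau))) ->
  (forall t tau, ts_set T t -> ts_set T tau -> t <= tau ->
    `|X t *m (1%:M - P) *m invmx (X tau)| <=
      k * expR (- lam * (ts_clock T tau - ts_clock T t))) ->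
  P = 0 \/ (exists m, forall t, ts_set T t -> graininess T t <= m) ->
  Linfty T f ->
  exists x : R -> 'cV[R]_n, delta_solution T A f x /\ bounded_on T x.
Proof.
move=> rdA [regA _] [K AK] mA AK1 flowX X0 Xu k0 lam0 gP gQ Pm [mf [F0 fF0]].
have F00 : 0 <= F0 := le_trans (normr_ge0 _) (fF0 0 (ts_0 T)).
have clk_le1 t tau : ts_set T tau -> tau <= t ->
    k * expR (- lam * (ts_clock T t - ts_clock T tau)) <= k.
  move=> Ttau tt; rewrite ler_piMr// expR_le1 mulNr oppr_le0 mulr_ge0 ?(ltW lam0)//.
  by rewrite subr_ge0 clock_nondecreasing.
(* The Green function also bounds the inverse of [X] locally: its stable half is pulled back from a
   point [b] of [T] beyond [N], its unstable half is read at time 0, where [X] is the identity. *)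
have invX_bounded N : exists2 B, 0 <= B &
    forall t, ts_set T t -> t <= N -> `|invmx (X t)| <= B.
  have [b Tb Nb] := ts_unbounded T N.
  exists (n%:R * `|invmx (X b)| * k + k) => [|t Tt tN].
    by rewrite addr_ge0// !mulr_ge0.
  have tb : t <= b by apply: le_trans tN (ltW Nb).
  have -> : invmx (X t) = invmx (X b) *m (X b *m P *m invmx (X t)) +
      X 0 *m (1%:M - P) *m invmx (X t).
    by rewrite X0 mul1mx !mulmxA mulVmx ?Xu// mul1mx -mulmxDl addrC subrK mul1mx.
  apply: le_trans (ler_normD _ _) _; apply: lerD.
    apply: le_trans (mx_norm_mul _ _) _; apply: ler_wpM2l; first exact: mulr_ge0.
    exact: le_trans (gP b t Tb Tt tb) (clk_le1 b t Tt tb).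
  have t0 := ts_ge0 Tt.
  exact: le_trans (gQ 0 t (ts_0 T) Tt t0) (clk_le1 t 0 (ts_0 T) t0).
have [c cE] : exists c : R -> 'cV[R]_n, forall t,
    c t = delta_integral T t (fun u => invmx (X (sigma T u)) *m f u) by eexists.
have c0 : c 0 = 0 by rewrite cE delta_integral0.
have c_inc := forcing_increment flowX Xu invX_bounded mf fF0 cE.
have [x0 [B hB]] := bounded_initial_value AK1 regA flowX Xu k0 lam0 F00 gP gQ Pm c0 c_inc X0.
exists (fun t => X t *m (c t + x0)); split; last by exists B.
exact: (variation_of_constants AK rdA mA flowX Xu invX_bounded mf fF0 cE x0).
Qed.

End regressive_systems.

Theorem theorem5p1 (R : realType) (n : nat) (T : timeScale R)
    (mlog : 'M[R[i]]_n -> 'M[R[i]]_n) (A : R -> 'M[R]_n) :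
  matrix_log mlog ->
  rd_continuous T A ->
  uniformly_regressive T A ->
  bounded_with_inverse T A ->
  hyperbolic_ts T mlog A ->
  forall f : R -> 'cV[R]_n, Linfty T f ->
  exists x : R -> 'cV[R]_n, delta_solution T A f x /\ bounded_on T x.
Proof.
move=> [mlogK _ _] rdA ur bA [A' odeA hypA] f Lf.
have [K1 AK1] := regressive_inverse_bound ur bA.
have [regA _] := ur; have [_ [M hM]] := bA.
have AK t : ts_set T t -> `|A t| <= M.
  by move=> /hM; apply: le_trans; rewrite lerDl.
have nAK t : ts_set T t -> n%:R * `|A t| <= n%:R * M.
  by move=> Tt; apply: ler_wpM2l => //; exact: AK.
suff [X [P [k [lam [flowX X0 Xu [k0 lam0 gP gQ Pm] iA]]]]] :
    exists (X : R -> 'M[R]_n) (P : 'M[R]_n) (k lam : R),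
    [/\ delta_flow T A X, X 0 = 1%:M, forall t, ts_set T t -> X t \in unitmx,
     [/\ 0 <= k, 0 < lam,
       forall t tau, ts_set T t -> ts_set T tau -> tau <= t ->
         `|X t *m P *m invmx (X tau)| <=
           k * expR (- lam * (ts_clock T t - ts_clock T tau)),
       forall t tau, ts_set T t -> ts_set T tau -> t <= tau ->
         `|X t *m (1%:M - P) *m invmx (X tau)| <=
           k * expR (- lam * (ts_clock T tau - ts_clock T t))
     & P = 0 \/ exists m, forall t, ts_set T t -> graininess T t <= m]
     & locally_integrable_mx A'].
  apply: (bounded_solution_of_green (X := X) (P := P) rdA ur _ _ AK1 flowX X0 Xu k0 lam0) => //.
    by exists M.
  exact: corresponding_ode_measurable odeA iA.
have [hreal hcplx] := hypA.
(* The dichotomy lives in real or complex space according to [A']; the Green function extracted from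
   it is real in both cases. *)
have [rv|nrv] := pselect (forall s : R, 0 <= s -> real_mx (A' s)).
  have [Phi cauchyA dich] := hreal rv.
  have [X [flowX X0 Xu PsiX]] := transition_matrix mlogK AK rdA regA odeA cauchyA.
  have PhiX t tau : ts_set T t -> ts_set T tau -> Phi (ts_clock T t) (ts_clock T tau) =
      map_mx (idfun : {rmorphism R -> R}) (X t *m invmx (X tau)).
    by move=> Tt Ttau; rewrite map_mx_id//; apply: cplx_mx_inj; exact: PsiX.
  have [P [k [lam green]]] := dichotomy_green (emb := (idfun : {rmorphism R -> R}))
    (re := idfun) (nv := Num.norm) (fun _ _ => erefl) (fun _ => erefl) (fun _ _ => erefl)
    (fun _ _ => erefl) erefl (fun _ => lexx _) nAK AK1 regA flowX X0 Xu PhiX dich.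
  by exists X, P, k, lam; split => //; case: cauchyA.
have [Phi cauchyA dich] := hcplx nrv.
have [X [flowX X0 Xu PhiX]] := transition_matrix mlogK AK rdA regA odeA cauchyA.
have nvE (x : R[i]) : (complex.Re `|x|)%:C = `|x| by rewrite RRe_real// normr_real.
have [P [k [lam green]]] := dichotomy_green (emb := (real_complex R : {rmorphism R -> R[i]}))
    (re := @complex.Re R) (nv := fun x => complex.Re `|x|) (@lecR R) nvE (@ReD R) (@ReZ R)
    erefl (fun x => ltac:(by rewrite -lecR nvE; exact: normc_ge_Re))
    nAK AK1 regA flowX X0 Xu PhiX dich.
by exists X, P, k, lam; split => //; case: cauchyA.
Qed.
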